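(* Let $(E_n)_{n\in\mathbb N}$ be a sequence of nonzero finite dimensional Banach spaces. Assume that for some sequence of exponents $p_n>2$ with $p_n\to2$ the following conditions are satisfied: (a) for every $n$ and every $x,y\in E_n$, $$\|x+y\|_{E_n}^2+\|x-y\|_{E_n}^2\ \ge\ 2\big(\|x\|_{E_n}^{p_n}+\|y\|_{E_n}^{p_n}\big)^{2/p_n};$$ (b) for every $n$ there exists a basis $\mathcal B_n$ of $E_n$ such that for every $y\in\mathcal B_n$ there is $x\in\mathcal B_n$ such that $(x,y)$ is an $\ell_{p_n}$-pair, that is, $\|x+\lambda y\|_{E_n}^{p_n}=1+|\lambda|^{p_n}$ for every $\lambda\in\mathbb R$. Let $E=\big(\bigoplus_nE_n\big)_{\ell_2}$. Then every ultrapower of $E$ is linearly isometric to $E\oplus_2H$ for some Hilbert space $H$; for every Hilbert space $H$, every linear isometric operator $T:E\to E\oplus_2H$ satisfies $T(E)=E$; and the Banach space $E$ is uncountably categorical.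
   Context: Banach spaces are over $\mathbb K\in\{\mathbb R,\mathbb C\}$. Hilbert spaces may have any dimension (including finite or $0$). $\big(\bigoplus_nE_n\big)_{\ell_2}$ is the space of sequences $x=(x_n)$, $x_n\in E_n$, with $\|x\|^2=\sum_n\|x_n\|_{E_n}^2<\infty$. $X\oplus_2Y$ is the direct sum with norm $\|x+y\|^2=\|x\|^2+\|y\|^2$; $X$ and $Y$ are identified with subspaces of it. Ultrapowers are Banach space ultrapowers $X_{\mathcal U}=\ell_\infty(I,X)/\{(x_i):\lim_{i,\mathcal U}\|x_i\|=0\}$, $\mathcal U$ an ultrafilter on a set $I$. Banach spaces $X,Y$ are elementarily equivalent if there are ultrafilters $\mathcal U,\mathcal V$ such that $X_{\mathcal U}$ and $Y_{\mathcal V}$ are linearly isometric (this is an equivalence relation). The elementary class of $X$ is the class of all Banach spaces elementarily equivalent to $X$. An infinite dimensional Banach space is uncountably categorical if for some uncountable cardinal $\kappa$ its elementary class contains, up to linear isometry, exactly one space of density character $\kappa$. *)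

(* Defs.v *)
From HB Require Import structures.
From mathcomp Require Import all_boot all_order all_algebra.
From mathcomp Require Import all_classical all_reals all_analysis.
From mathcomp Require Import complex ring lra.

Set Implicit Arguments.
Unset Strict Implicit.
Unset Printing Implicit Defensive.

Import Order.TTheory GRing.Theory Num.Theory.
Import numFieldNormedType.Exports.

Local Open Scope classical_set_scope.
Local Open Scope ring_scope.

Variant scalar_kind := RealScalars | ComplexScalars.

Definition scalar_field (R : realType) (k : scalar_kind) : numFieldType :=
  match k with RealScalars => R | ComplexScalars => R[i] end.

Section scalars.
Variables (R : realType) (k : scalar_kind).

Definition of_real : R -> scalar_field R k :=
  match k return R -> scalar_field R k with
  | RealScalars => id
  | ComplexScalars => real_complex R
  end.

Definition re_part : scalar_field R k -> R :=
  match k return scalar_field R k -> R with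
  | RealScalars => id
  | ComplexScalars => @complex.Re R
  end.

Definition conj_scalar : scalar_field R k -> scalar_field R k :=
  match k return scalar_field R k -> scalar_field R k with
  | RealScalars => id
  | ComplexScalars => @conjc R
  end.

Lemma of_realK : cancel of_real re_part.
Proof. by rewrite /of_real /re_part /scalar_field; case: k. Qed.

Lemma re_partK (x : scalar_field R k) : 0 <= x -> of_real (re_part x) = x.
Proof.
rewrite /of_real /re_part /scalar_field; case: k x => //= -[a b].
by rewrite lecE /= => /andP[/eqP -> _].
Qed.

Lemma le_of_real : {mono of_real : x y / x <= y}.
Proof. by rewrite /of_real /scalar_field; case: k => // x y; rewrite lecR. Qed.

Lemma lt_of_real : {mono of_real : x y / x < y}.
Proof. by rewrite /of_real /scalar_field; case: k => // x y; rewrite ltcR. Qed.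

Lemma of_realD : {morph of_real : x y / x + y}.
Proof. by rewrite /of_real /scalar_field; case: k => // x y; rewrite rmorphD. Qed.

Lemma of_realM : {morph of_real : x y / x * y}.
Proof. by rewrite /of_real /scalar_field; case: k => // x y; rewrite rmorphM. Qed.

Lemma of_real0 : of_real 0 = 0.
Proof. by rewrite /of_real /scalar_field; case: k. Qed.

Lemma of_real1 : of_real 1 = 1.
Proof. by rewrite /of_real /scalar_field; case: k. Qed.

End scalars.
Arguments of_real {R k} _.
Arguments re_part {R k} _.
Arguments conj_scalar {R k} _.

(* The norm of a module over scalar_field R k takes its values in
   scalar_field R k; rnorm is its real-valued version, which can be raised to
   real powers. *)
Section real_norm.
Context {R : realType} {k : scalar_kind}.
Notation K := (scalar_field R k).

Definition rnorm (V : normedModType K) (x : V) : R := re_part `|x|.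

Section theory.
Variable V : normedModType K.
Implicit Types x y : V.

Lemma of_real_rnorm x : of_real (rnorm x) = `|x|.
Proof. by rewrite re_partK. Qed.

Lemma rnorm_ge0 x : 0 <= rnorm x.
Proof. by rewrite -(le_of_real k) of_real_rnorm of_real0. Qed.

Lemma ler_rnormD x y : rnorm (x + y) <= rnorm x + rnorm y.
Proof. by rewrite -(le_of_real k) of_realD !of_real_rnorm ler_normD. Qed.

Lemma rnormZ (a : K) x : rnorm (a *: x) = re_part `|a| * rnorm x.
Proof.
by rewrite -[LHS](of_realK k) of_real_rnorm normrZ -of_real_rnorm
           -[`|a|]re_partK// -of_realM !of_realK.
Qed.

Lemma rnormN x : rnorm (- x) = rnorm x.
Proof. by rewrite /rnorm normrN. Qed.

Lemma rnorm_distC x y : rnorm (x - y) = rnorm (y - x).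
Proof. by rewrite -rnormN opprB. Qed.

Lemma rnorm0 : rnorm (0 : V) = 0.
Proof. by rewrite /rnorm normr0 -(of_real0 R k) of_realK. Qed.

Lemma rnorm_eq0 x : rnorm x = 0 -> x = 0.
Proof. by move=> x0; apply/normr0_eq0; rewrite -of_real_rnorm x0 of_real0. Qed.

Lemma ler_rnormB x y z : rnorm (x - z) <= rnorm (x - y) + rnorm (y - z).
Proof. by rewrite -[x - z](subrKA y) ler_rnormD. Qed.

Lemma ler_dist_rnorm x y : `|rnorm x - rnorm y| <= rnorm (x - y).
Proof.
have := ler_rnormD (x - y) y; have := ler_rnormD (y - x) x.
rewrite !subrK [rnorm (y - x)]rnorm_distC ler_norml.
move: (rnorm _) (rnorm _) (rnorm _) => a b c ? ?; apply/andP; split; lra.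
Qed.

End theory.

Section norm_of_real_valued.
Variables (V : lmodType K) (N : V -> R).
Hypothesis ND : forall x y, N (x + y) <= N x + N y.
Hypothesis NZ : forall (a : K) x, N (a *: x) = re_part `|a| * N x.
Hypothesis N0 : forall x, N x = 0 -> x = 0.

Lemma of_real_normD x y :
  of_real (N (x + y)) <= of_real (N x) + of_real (N y) :> K.
Proof. by rewrite -of_realD le_of_real. Qed.

Lemma of_real_normZ (a : K) x :
  of_real (N (a *: x)) = `|a| * of_real (N x) :> K.
Proof. by rewrite NZ of_realM re_partK. Qed.

Lemma of_real_norm0 x : of_real (N x) = 0 :> K -> x = 0.
Proof.
by move=> /(congr1 re_part); rewrite of_realK -(of_real0 R k) of_realK => /N0.
Qed.

End norm_of_real_valued.

Lemma rapid_dist (V : normedModType K) (u : nat -> V) (C : R) :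
  (forall n, rnorm (u n.+1 - u n) <= C * 2^-1 ^+ n) ->
  forall n m, rnorm (u (n + m)%N - u n) <= 2 * C * 2^-1 ^+ n.
Proof.
move=> uC n m.
have C0 : 0 <= C.
  by have := le_trans (rnorm_ge0 _) (uC 0%N); rewrite expr0 mulr1.
suff : rnorm (u (n + m)%N - u n) <= 2 * C * 2^-1 ^+ n - 2 * C * 2^-1 ^+ (n + m).
  move=> /le_trans; apply; rewrite lerBlDr lerDl.
  by rewrite !mulr_ge0// exprn_ge0// invr_ge0.
elim: m => [|m IHm]; first by rewrite addn0 !subrr rnorm0.
rewrite (le_trans (ler_rnormB _ (u (n + m)%N) _))//.
rewrite addnS; have := uC (n + m)%N; rewrite exprS; move: IHm.
set a := 2^-1 ^+ (n + m); set b := 2^-1 ^+ n; move: (rnorm _) (rnorm _) => s t.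
lra.
Qed.

Lemma rapid_cvg (V : completeNormedModType K) (u : nat -> V) (C : R) :
  (forall n, rnorm (u n.+1 - u n) <= C * 2^-1 ^+ n) ->
  exists l, forall n, rnorm (l - u n) <= 2 * C * 2^-1 ^+ n.
Proof.
move=> uC; have ud := rapid_dist uC.
have geo0 (c e : R) : 0 < e -> exists N, forall n, (N <= n)%N -> c * 2^-1 ^+ n < e.
  move=> e0.
  have : (c * 2^-1 ^+ n) @[n --> \oo] --> (0 : R).
    rewrite -[X in _ --> X](mulr0 c); apply: cvgMr.
    by apply: cvg_expr; rewrite ger0_norm ?invr_ge0// invf_lt1// ltr1n.
  move=> /cvgrPdist_lt /(_ _ e0) [N _ Nn]; exists N => n /Nn /=.
  by rewrite sub0r normrN; apply: le_lt_trans; rewrite ler_norm.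
have cu : cvg (u @ \oo).
  apply: cauchy_cvg; apply/cauchyP => eps eps0.
  have e0 : 0 < re_part eps :> R.
    by rewrite -(lt_of_real k) of_real0 re_partK// ltW.
  have [N NP] := geo0 (2 * C) _ e0.
  exists (u N); exists N => // n /= Nn.
  rewrite -ball_normE /= -of_real_rnorm -[eps]re_partK ?ltW// lt_of_real.
  rewrite rnorm_distC -(subnKC Nn) (le_lt_trans (ud _ _))//; exact: NP.
exists (lim (u @ \oo)) => n; apply/ler_addgt0Pr => e e0.
have eK : (0 : K) < of_real e by rewrite -(of_real0 R k) lt_of_real.
have /cvgrPdist_lt/(_ _ eK) [N _ NP] := cu.
have := NP (n + N)%N (leq_addl _ _); rewrite /= -of_real_rnorm lt_of_real => h.
rewrite (le_trans (ler_rnormB _ (u (n + N)%N) _))// addrC.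
by rewrite lerD// ltW.
Qed.

Lemma rapid_complete (V : normedModType K) :
  (forall u : nat -> V, (forall n, rnorm (u n.+1 - u n) <= 2^-1 ^+ n) ->
    exists l C, forall n, rnorm (l - u n) <= C * 2^-1 ^+ n) ->
  forall F : set_system V, ProperFilter F -> cauchy F -> cvg F.
Proof.
move=> Vc F FF /cauchyP cF.
have h2 n : (0 : R) < 2^-1 ^+ n by rewrite exprn_gt0// invr_gt0.
pose e n : R := 2^-1 ^+ n.+1.
have eK n : (0 : K) < of_real (e n) by rewrite -(of_real0 R k) lt_of_real h2.
have /choice[u uP] n := cF _ (eK n).
have uB n y : ball (u n) (of_real (e n)) y -> rnorm (u n - y) < e n.
  by rewrite -ball_normE /= -of_real_rnorm lt_of_real.
have [n|l [C lC]] := Vc u.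
  have [y [/uB yn /uB ySn]] := filter_ex (filterI (uP n) (uP n.+1)).
  rewrite (le_trans (ler_rnormB _ y _))//.
  move: yn ySn; rewrite rnorm_distC /e !exprS; have := h2 n.
  set a := 2^-1 ^+ n; move: (rnorm _) (rnorm _) => s t; lra.
apply/cvg_ex; exists l; apply/cvgrPdist_lt => eps eps0.
have e0 : 0 < re_part eps :> R.
  by rewrite -(lt_of_real k) of_real0 re_partK// ltW.
have [n nP] : exists n, (`|C| + 1) * 2^-1 ^+ n < re_part eps.
  have : ((`|C| + 1) * 2^-1 ^+ n) @[n --> \oo] --> (0 : R).
    rewrite -[X in _ --> X](mulr0 (`|C| + 1)); apply: cvgMr.
    by apply: cvg_expr; rewrite ger0_norm ?invr_ge0// invf_lt1// ltr1n.
  move=> /cvgrPdist_lt /(_ _ e0) [N _ Nn]; exists N.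
  have := Nn N (leqnn N); rewrite /= sub0r normrN.
  by apply: le_lt_trans; rewrite ler_norm.
near=> y.
rewrite -of_real_rnorm -[eps]re_partK ?ltW// lt_of_real.
rewrite (le_lt_trans (ler_rnormB _ (u n) _))//.
apply: le_lt_trans nP; rewrite mulrDl mul1r lerD//.
  by rewrite (le_trans (lC n))// ler_wpM2r ?ler_norm// ltW.
apply/ltW; apply: (@lt_trans _ _ (e n)).
  by apply: uB; near: y; exact: uP.
by rewrite /e exprS gtr_pMl ?h2// invf_lt1// ltr1n.
Unshelve. all: by end_near. Qed.

End real_norm.

Section l2_inequalities.
Variable R : realType.
Implicit Types a b c : nat -> R.

Lemma minkowski2 (a b c d : R) :
  Num.sqrt ((a + b) ^+ 2 + (c + d) ^+ 2) <=
  Num.sqrt (a ^+ 2 + c ^+ 2) + Num.sqrt (b ^+ 2 + d ^+ 2).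
Proof.
have sq0 (x y : R) : 0 <= x ^+ 2 + y ^+ 2 by rewrite addr_ge0// sqr_ge0.
have cs : a * b + c * d <= Num.sqrt (a ^+ 2 + c ^+ 2) * Num.sqrt (b ^+ 2 + d ^+ 2).
  rewrite -sqrtrM// (le_trans (ler_norm _))// -sqrtr_sqr ler_wsqrtr// -subr_ge0.
  have -> : (a ^+ 2 + c ^+ 2) * (b ^+ 2 + d ^+ 2) - (a * b + c * d) ^+ 2 =
            (a * d - b * c) ^+ 2 by ring.
  exact: sqr_ge0.
rewrite -(@ler_pXn2r _ 2)// ?nnegrE ?addr_ge0 ?sqrtr_ge0//.
rewrite [leRHS]sqrrD !sqr_sqrtr//.
move: cs; move: (Num.sqrt _ * _) => t; rewrite !sqrrD !mulr2n; lra.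
Qed.

Definition l2_partial a n : R := Num.sqrt (\sum_(0 <= i < n) a i ^+ 2).

Lemma l2_partialS a n :
  l2_partial a n.+1 = Num.sqrt (l2_partial a n ^+ 2 + a n ^+ 2).
Proof.
rewrite /l2_partial big_nat_recr//= sqr_sqrtr//.
by rewrite sumr_ge0// => i _; rewrite sqr_ge0.
Qed.

Lemma l2_partial_le a b n : (forall i, 0 <= a i <= b i) ->
  l2_partial a n <= l2_partial b n.
Proof.
move=> ab; rewrite ler_wsqrtr//; apply: ler_sum => i _.
by have /andP[a0 ?] := ab i; rewrite ler_pXn2r// nnegrE// (le_trans a0).
Qed.

Lemma l2_partialD a b n :
  l2_partial (fun i => a i + b i) n <= l2_partial a n + l2_partial b n.
Proof.
elim: n => [|n IHn]; first by rewrite /l2_partial !big_geq// sqrtr0 addr0.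
rewrite !l2_partialS; apply: le_trans (minkowski2 _ _ _ _).
rewrite ler_wsqrtr// lerD2r ler_pXn2r// nnegrE ?addr_ge0 ?sqrtr_ge0//.
Qed.

Lemma l2_partialZ (r : R) a n : 0 <= r ->
  l2_partial (fun i => r * a i) n = r * l2_partial a n.
Proof.
move=> r0; rewrite /l2_partial -{2}(ger0_norm r0) -sqrtr_sqr -sqrtrM ?sqr_ge0//.
by rewrite mulr_sumr; congr Num.sqrt; apply: eq_bigr => i _; rewrite exprMn.
Qed.

Definition sq_summable a := cvgn (series (fun n => a n ^+ 2)).

Definition l2_norm a : R := Num.sqrt (limn (series (fun n => a n ^+ 2))).

Let sq_nondecr a : nondecreasing_seq (series (fun n => a n ^+ 2)).
Proof. by apply: nondecreasing_series => i _ _; rewrite sqr_ge0. Qed.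

Lemma l2_partial_le_norm a n : sq_summable a -> l2_partial a n <= l2_norm a.
Proof. by move=> sa; rewrite ler_wsqrtr// nondecreasing_cvgn_le. Qed.

Lemma l2_norm_ge a i : sq_summable a -> `|a i| <= l2_norm a.
Proof.
move=> sa; apply: le_trans (l2_partial_le_norm i.+1 sa).
by rewrite l2_partialS -sqrtr_sqr ler_wsqrtr// lerDr sqr_ge0.
Qed.

Lemma l2_bounded a (M : R) : (forall n, l2_partial a n <= M) ->
  sq_summable a /\ l2_norm a <= M.
Proof.
move=> aM.
have M0 : 0 <= M := le_trans (sqrtr_ge0 _) (aM 0%N).
have sM n : series (fun n => a n ^+ 2) n <= M ^+ 2.
  have := aM n; rewrite -(@ler_pXn2r _ 2)// ?nnegrE ?sqrtr_ge0// sqr_sqrtr//.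
  by rewrite sumr_ge0// => i _; rewrite sqr_ge0.
have sa : sq_summable a.
  by apply: nondecreasing_is_cvgn => //; exists (M ^+ 2) => _ [n _ <-].
split=> //; rewrite -(ger0_norm M0) -sqrtr_sqr ler_wsqrtr//.
by apply: limr_le => //; exact: nearW.
Qed.

End l2_inequalities.

Section l2_sum.
Context {R : realType} {k : scalar_kind}.
Notation K := (scalar_field R k).
Variable E : nat -> normedModType K.

Record l2_sum := L2Sum {
  l2_coord :> forall n, E n ;
  l2_coordP : sq_summable (fun n => rnorm (l2_coord n)) }.

Arguments l2_coordP : clear implicits.

HB.instance Definition _ := gen_eqMixin l2_sum.
HB.instance Definition _ := gen_choiceMixin l2_sum.

Lemma l2_sum_ext (x y : l2_sum) : (forall n, x n = y n) -> x = y.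
Proof.
case: x y => [x Px] [y Py] /= xy.
have e : x = y by apply: functional_extensionality_dep.
by case: y / e Py {xy} => Py; congr L2Sum; exact: Prop_irrelevance.
Qed.

Let rn (x : forall n, E n) n : R := rnorm (x n).

Let rn_D (x y : l2_sum) n : l2_partial (rn (fun i => x i + y i)) n <=
  l2_norm (rn x) + l2_norm (rn y).
Proof.
apply: (@le_trans _ _ (l2_partial (fun i => rn x i + rn y i) n)).
  by apply: l2_partial_le => i; rewrite /rn rnorm_ge0 ler_rnormD.
rewrite (le_trans (l2_partialD _ _ _))// lerD// l2_partial_le_norm//; exact: l2_coordP.
Qed.

Let rn_Z (a : K) (x : l2_sum) n : l2_partial (rn (fun i => a *: x i)) n =
  re_part `|a| * l2_partial (rn x) n.
Proof.
rewrite -l2_partialZ; last by rewrite -(le_of_real k) of_real0 re_partK.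
by rewrite /l2_partial; under eq_bigr do rewrite /rn rnormZ.
Qed.

Let rn_Z_le (a : K) (x : l2_sum) n : l2_partial (rn (fun i => a *: x i)) n <=
  re_part `|a| * l2_norm (rn x).
Proof.
rewrite rn_Z ler_wpM2l//; last by apply: l2_partial_le_norm; exact: l2_coordP.
by rewrite -(le_of_real k) of_real0 re_partK.
Qed.

Let l2_zero_subproof : sq_summable (fun n => rnorm (0 : E n)).
Proof.
have [n|//] := @l2_bounded _ (fun n => rnorm (0 : E n)) 0.
by rewrite /l2_partial big1 ?sqrtr0// => i _; rewrite rnorm0 expr0n.
Qed.

Let l2_opp_subproof (x : l2_sum) : sq_summable (fun n => rnorm (- x n)).
Proof. by under eq_fun do rewrite rnormN; exact: l2_coordP. Qed.

Definition l2_zero := @L2Sum (fun=> 0) l2_zero_subproof.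
Definition l2_add (x y : l2_sum) :=
  @L2Sum (fun n => x n + y n) (l2_bounded (rn_D x y)).1.
Definition l2_scale (a : K) (x : l2_sum) :=
  @L2Sum (fun n => a *: x n) (l2_bounded (rn_Z_le a x)).1.
Definition l2_opp (x : l2_sum) := @L2Sum (fun n => - x n) (@l2_opp_subproof x).

Let l2_addA : associative l2_add.
Proof. by move=> x y z; apply: l2_sum_ext => n /=; rewrite addrA. Qed.
Let l2_addC : commutative l2_add.
Proof. by move=> x y; apply: l2_sum_ext => n /=; rewrite addrC. Qed.
Let l2_add0 : left_id l2_zero l2_add.
Proof. by move=> x; apply: l2_sum_ext => n /=; rewrite add0r. Qed.
Let l2_addN : left_inverse l2_zero l2_opp l2_add.
Proof. by move=> x; apply: l2_sum_ext => n /=; rewrite addNr. Qed.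

HB.instance Definition _ :=
  GRing.isZmodule.Build l2_sum l2_addA l2_addC l2_add0 l2_addN.

Let l2_scaleA (a b : K) (x : l2_sum) :
  l2_scale a (l2_scale b x) = l2_scale (a * b) x.
Proof. by apply: l2_sum_ext => n /=; rewrite scalerA. Qed.
Let l2_scale1 : left_id 1 l2_scale.
Proof. by move=> x; apply: l2_sum_ext => n /=; rewrite scale1r. Qed.
Let l2_scaleDr : right_distributive l2_scale +%R.
Proof. by move=> a x y; apply: l2_sum_ext => n /=; rewrite scalerDr. Qed.
Let l2_scaleDl (x : l2_sum) : {morph l2_scale^~ x : a b / a + b}.
Proof. by move=> a b; apply: l2_sum_ext => n /=; rewrite scalerDl. Qed.

HB.instance Definition _ := GRing.Zmodule_isLmodule.Build K l2_sum
  l2_scaleA l2_scale1 l2_scaleDr l2_scaleDl.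

Lemma l2_sumBE (x y : l2_sum) n : (x - y) n = x n - y n. Proof. by []. Qed.

Definition l2_sum_norm (x : l2_sum) : R := l2_norm (fun n => rnorm (x n)).

Let l2_sum_normD (x y : l2_sum) :
  l2_sum_norm (x + y) <= l2_sum_norm x + l2_sum_norm y.
Proof. exact: (l2_bounded (rn_D x y)).2. Qed.

Let l2_sum_normZ (a : K) (x : l2_sum) :
  l2_sum_norm (a *: x) = re_part `|a| * l2_sum_norm x.
Proof.
apply/eqP; rewrite eq_le (l2_bounded (rn_Z_le a x)).2/=.
have [->|a0] := eqVneq a 0.
  by rewrite normr0 -(of_real0 R k) of_realK mul0r sqrtr_ge0.
have na0 : 0 < re_part `|a| :> R.
  by rewrite -(lt_of_real k) of_real0 re_partK// normr_gt0.
rewrite -ler_pdivlMl//; apply: (l2_bounded _).2 => n.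
rewrite ler_pdivlMl// -rn_Z; apply: l2_partial_le_norm.
exact: (l2_bounded (rn_Z_le a x)).1.
Qed.

Let l2_sum_norm0 (x : l2_sum) : l2_sum_norm x = 0 -> x = 0.
Proof.
move=> x0; apply: l2_sum_ext => n; apply: rnorm_eq0.
have := l2_norm_ge n (l2_coordP x); rewrite -/(l2_sum_norm x) x0.
by rewrite ger0_norm ?rnorm_ge0// => h; apply/eqP; rewrite eq_le h rnorm_ge0.
Qed.

HB.instance Definition _ := Lmodule_isNormed.Build K l2_sum
  (of_real_normD l2_sum_normD) (of_real_normZ l2_sum_normZ)
  (of_real_norm0 l2_sum_norm0).

Lemma rnorm_l2_sum (x : l2_sum) : rnorm x =
  Num.sqrt (limn (series (fun n => rnorm (x n) ^+ 2))).
Proof. exact: of_realK. Qed.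

Lemma rnorm_l2_coord (x : l2_sum) n : rnorm (x n) <= rnorm x.
Proof.
rewrite rnorm_l2_sum; have := l2_norm_ge n (l2_coordP x).
by rewrite ger0_norm// rnorm_ge0.
Qed.

End l2_sum.
Arguments l2_coordP {R k E} _.

Section l2_sum_complete.
Context {R : realType} {k : scalar_kind}.
Notation K := (scalar_field R k).
Variable E : nat -> completeNormedModType K.

Lemma l2_sum_complete (F : set_system (l2_sum E)) :
  ProperFilter F -> cauchy F -> cvg F.
Proof.
move: F; apply: rapid_complete => u ru.
have h2 n : (0 : R) < 2^-1 ^+ n by rewrite exprn_gt0// invr_gt0.
have ru1 n : rnorm (u n.+1 - u n) <= 1 * 2^-1 ^+ n by rewrite mul1r.
have lP n : exists l : E n, forall j, rnorm (l - u j n) <= 2 * 1 * 2^-1 ^+ j.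
  apply: (@rapid_cvg _ _ _ (fun j => u j n)) => j.
  have := le_trans (rnorm_l2_coord (u j.+1 - u j) n) (ru1 j).
  by rewrite l2_sumBE.
have /all_sig[l {}lP] := fun n => cid (lP n).
have lu j N : l2_partial (fun n => rnorm (l n - u j n)) N <= 2 * 1 * 2^-1 ^+ j.
  apply/ler_addgt0Pr => e e0.
  pose c : R := Num.sqrt N%:R.
  have [m mP] : exists m, c * (2 * 1 * 2^-1 ^+ (j + m)) < e.
    have : (c * 2 * 2^-1 ^+ m) @[m --> \oo] --> (0 : R).
      rewrite -[X in _ --> X](mulr0 (c * 2)); apply: cvgMr.
      by apply: cvg_expr; rewrite ger0_norm ?invr_ge0// invf_lt1// ltr1n.
    move=> /cvgrPdist_lt /(_ _ e0) [M _ Mn]; exists M.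
    have := Mn (j + M)%N (leq_addl _ _); rewrite /= sub0r normrN mulr1 -mulrA.
    by apply: le_lt_trans; rewrite ler_norm.
  apply: (@le_trans _ _ (l2_partial (fun n => rnorm ((u (j + m)%N - u j : l2_sum E) n)
     + 2 * 1 * 2^-1 ^+ (j + m)) N)).
    apply: l2_partial_le => i; rewrite rnorm_ge0 l2_sumBE /=.
    rewrite (le_trans (ler_rnormB _ (u (j + m)%N i) _))// addrC.
    by rewrite lerD2l lP.
  rewrite (le_trans (l2_partialD _ _ _))// lerD//.
    apply: le_trans (rapid_dist ru1 j m); rewrite rnorm_l2_sum.
    exact/l2_partial_le_norm/l2_coordP.
  apply: le_trans (ltW mP); rewrite /l2_partial big_const_nat subn0 iter_addr_0.
  by rewrite -[_ *+ N]mulr_natl sqrtrM// sqrtr_sqr ger0_norm.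
have dl j := l2_bounded (lu j).
pose z : l2_sum E := u 0%N + @L2Sum _ _ _ (fun n => l n - u 0%N n) (dl 0%N).1.
exists z, (2 * 1) => j; rewrite rnorm_l2_sum.
rewrite (_ : (fun n => _) = (fun n => rnorm (l n - u j n) ^+ 2)); first exact: (dl j).2.
by apply/funext => n; rewrite l2_sumBE /= addrCA subrr addr0.
Qed.

HB.instance Definition _ := Uniform_isComplete.Build (l2_sum E) l2_sum_complete.

End l2_sum_complete.

(* The type of pairs already carries the max norm in the library, whence a new
   type. *)
Definition l2_prod (X Y : Type) : Type := (X * Y)%type.

Section l2_prod.
Context {R : realType} {k : scalar_kind}.
Notation K := (scalar_field R k).
Variables X Y : normedModType K.

HB.instance Definition _ := GRing.Lmodule.copy (l2_prod X Y) (X * Y)%type.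

Definition l2_prod_norm (z : l2_prod X Y) : R :=
  Num.sqrt (rnorm z.1 ^+ 2 + rnorm z.2 ^+ 2).

Let l2_prod_normD (z t : l2_prod X Y) :
  l2_prod_norm (z + t) <= l2_prod_norm z + l2_prod_norm t.
Proof.
apply: le_trans (minkowski2 _ _ _ _); rewrite ler_wsqrtr// lerD//.
  by rewrite ler_pXn2r ?nnegrE ?addr_ge0 ?rnorm_ge0// ler_rnormD.
by rewrite ler_pXn2r ?nnegrE ?addr_ge0 ?rnorm_ge0// ler_rnormD.
Qed.

Let l2_prod_normZ (a : K) (z : l2_prod X Y) :
  l2_prod_norm (a *: z) = re_part `|a| * l2_prod_norm z.
Proof.
have a0 : 0 <= re_part `|a| :> R by rewrite -(le_of_real k) of_real0 re_partK.
rewrite /l2_prod_norm !rnormZ !exprMn -mulrDr sqrtrM ?sqr_ge0//.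
by rewrite sqrtr_sqr ger0_norm.
Qed.

Let l2_prod_norm0 (z : l2_prod X Y) : l2_prod_norm z = 0 -> z = 0.
Proof.
move=> /eqP; rewrite sqrtr_eq0 => h.
have h1 := sqr_ge0 (rnorm z.1); have h2 := sqr_ge0 (rnorm z.2).
have : rnorm z.1 ^+ 2 + rnorm z.2 ^+ 2 == 0 by rewrite eq_le h addr_ge0.
rewrite paddr_eq0// !sqrf_eq0 => /andP[/eqP/rnorm_eq0 z1 /eqP/rnorm_eq0 z2].
by case: z z1 z2 {h h1 h2} => x y /= -> ->.
Qed.

HB.instance Definition _ := Lmodule_isNormed.Build K (l2_prod X Y)
  (of_real_normD l2_prod_normD) (of_real_normZ l2_prod_normZ)
  (of_real_norm0 l2_prod_norm0).

Lemma rnorm_l2_prod (z : l2_prod X Y) :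
  rnorm z = Num.sqrt (rnorm z.1 ^+ 2 + rnorm z.2 ^+ 2).
Proof. exact: of_realK. Qed.

Definition l2_inl (x : X) : l2_prod X Y := (x, 0).

End l2_prod.

Section l2_prod_complete.
Context {R : realType} {k : scalar_kind}.
Notation K := (scalar_field R k).
Variables X Y : completeNormedModType K.

Lemma l2_prod_complete (F : set_system (l2_prod X Y)) :
  ProperFilter F -> cauchy F -> cvg F.
Proof.
move: F; apply: rapid_complete => u ru.
have c1 (z : l2_prod X Y) : rnorm z.1 <= rnorm z.
  rewrite rnorm_l2_prod -[leLHS]ger0_norm ?rnorm_ge0// -sqrtr_sqr.
  by rewrite ler_wsqrtr// lerDl sqr_ge0.
have c2 (z : l2_prod X Y) : rnorm z.2 <= rnorm z.
  rewrite rnorm_l2_prod -[leLHS]ger0_norm ?rnorm_ge0// -sqrtr_sqr.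
  by rewrite ler_wsqrtr// lerDr sqr_ge0.
have [n|x xu] := @rapid_cvg _ _ X (fun n => (u n).1) 1.
  by rewrite mul1r; exact: le_trans (c1 (u n.+1 - u n)) (ru n).
have [n|y yu] := @rapid_cvg _ _ Y (fun n => (u n).2) 1.
  by rewrite mul1r; exact: le_trans (c2 (u n.+1 - u n)) (ru n).
exists ((x, y) : l2_prod X Y), 4 => n; rewrite rnorm_l2_prod/=.
have b0 : (0 : R) <= 2^-1 ^+ n by rewrite exprn_ge0// invr_ge0.
rewrite -(@ger0_norm _ (4 * _)) ?mulr_ge0// -sqrtr_sqr ler_wsqrtr//.
have := xu n; have := yu n.
have := rnorm_ge0 (x - (u n).1); have := rnorm_ge0 (y - (u n).2).
move: (rnorm _) (rnorm _) (2^-1 ^+ n) b0 => s t b b0 s0 t0 sb tb.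
nra.
Qed.

HB.instance Definition _ :=
  Uniform_isComplete.Build (l2_prod X Y) l2_prod_complete.

End l2_prod_complete.

Section bounded_family.
Context {R : realType} {k : scalar_kind}.
Notation K := (scalar_field R k).
Variables (I : Type) (X : normedModType K).

Record bounded_family := BoundedFamily {
  family_val :> I -> X ;
  family_bounded : exists M : R, forall i, rnorm (family_val i) <= M }.

HB.instance Definition _ := gen_eqMixin bounded_family.
HB.instance Definition _ := gen_choiceMixin bounded_family.

Lemma bounded_family_ext (x y : bounded_family) :
  (forall i, x i = y i) -> x = y.
Proof.
case: x y => [x Px] [y Py] /= xy.
have e : x = y by apply/funext.
by case: y / e Py {xy} => Py; congr BoundedFamily; exact: Prop_irrelevance.
Qed.

Let zero_bounded : exists M : R, forall i : I, rnorm (0 : X) <= M.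
Proof. by exists 0 => i; rewrite rnorm0. Qed.
Let add_bounded (x y : bounded_family) :
  exists M : R, forall i, rnorm (x i + y i) <= M.
Proof.
have [M xM] := family_bounded x; have [N yN] := family_bounded y.
by exists (M + N) => i; rewrite (le_trans (ler_rnormD _ _))// lerD.
Qed.
Let opp_bounded (x : bounded_family) :
  exists M : R, forall i, rnorm (- x i) <= M.
Proof.
by have [M xM] := family_bounded x; exists M => i; rewrite rnormN.
Qed.
Let scale_bounded (a : K) (x : bounded_family) :
  exists M : R, forall i, rnorm (a *: x i) <= M.
Proof.
have [M xM] := family_bounded x; exists (re_part `|a| * M) => i.
by rewrite rnormZ ler_wpM2l// -(le_of_real k) of_real0 re_partK.
Qed.

Definition family_zero := BoundedFamily zero_bounded.
Definition family_add (x y : bounded_family) := BoundedFamily (add_bounded x y).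
Definition family_opp (x : bounded_family) := BoundedFamily (opp_bounded x).
Definition family_scale (a : K) (x : bounded_family) :=
  BoundedFamily (scale_bounded a x).

Let family_addA : associative family_add.
Proof. by move=> x y z; apply: bounded_family_ext => i /=; rewrite addrA. Qed.
Let family_addC : commutative family_add.
Proof. by move=> x y; apply: bounded_family_ext => i /=; rewrite addrC. Qed.
Let family_add0 : left_id family_zero family_add.
Proof. by move=> x; apply: bounded_family_ext => i /=; rewrite add0r. Qed.
Let family_addN : left_inverse family_zero family_opp family_add.
Proof. by move=> x; apply: bounded_family_ext => i /=; rewrite addNr. Qed.

HB.instance Definition _ := GRing.isZmodule.Build bounded_family
  family_addA family_addC family_add0 family_addN.

Let family_scaleA (a b : K) (x : bounded_family) :
  family_scale a (family_scale b x) = family_scale (a * b) x.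
Proof. by apply: bounded_family_ext => i /=; rewrite scalerA. Qed.
Let family_scale1 : left_id 1 family_scale.
Proof. by move=> x; apply: bounded_family_ext => i /=; rewrite scale1r. Qed.
Let family_scaleDr : right_distributive family_scale +%R.
Proof. by move=> a x y; apply: bounded_family_ext => i /=; rewrite scalerDr. Qed.
Let family_scaleDl (x : bounded_family) :
  {morph family_scale^~ x : a b / a + b}.
Proof. by move=> a b; apply: bounded_family_ext => i /=; rewrite scalerDl. Qed.

HB.instance Definition _ := GRing.Zmodule_isLmodule.Build K bounded_family
  family_scaleA family_scale1 family_scaleDr family_scaleDl.

Lemma familyDE (x y : bounded_family) i : (x + y) i = x i + y i.
Proof. by []. Qed.
Lemma familyBE (x y : bounded_family) i : (x - y) i = x i - y i.
Proof. by []. Qed.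
Lemma familyZE (a : K) (x : bounded_family) i : (a *: x) i = a *: x i.
Proof. by []. Qed.

End bounded_family.

Section ultrapower.
Context {R : realType} {k : scalar_kind} {I : Type}.
Notation K := (scalar_field R k).
Variables (U : set_system I) (UF : UltraFilter U) (X : normedModType K).
Implicit Types x y : bounded_family I X.

Definition null_family : {pred bounded_family I X} :=
  fun x => `[< rnorm (x i) @[i --> U] --> (0 : R) >].

Lemma null_familyP x :
  reflect (rnorm (x i) @[i --> U] --> (0 : R)) (x \in null_family).
Proof. exact: asboolP. Qed.

Lemma null_family_near x : (x \in null_family) <->
  forall e : R, 0 < e -> \forall i \near U, rnorm (x i) < e.
Proof.
split=> [/null_familyP/cvgrPdist_lt h e e0|h]; last apply/null_familyP/cvgrPdist_lt => e e0.
  by apply: filterS (h _ e0) => i; rewrite sub0r normrN ger0_norm// rnorm_ge0.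
by apply: filterS (h _ e0) => i; rewrite sub0r normrN ger0_norm// rnorm_ge0.
Qed.

Let null_family_zmod_closed : zmod_closed null_family.
Proof.
split=> [|x y /null_family_near x0 /null_family_near y0]; apply/null_family_near => e e0.
  by apply: nearW => i /=; rewrite rnorm0.
have e2 : 0 < e / 2 by rewrite divr_gt0.
apply: filterS2 (x0 _ e2) (y0 _ e2) => i xi yi.
by rewrite familyBE (le_lt_trans (ler_rnormD _ _))// rnormN (splitr e) ltrD.
Qed.

HB.instance Definition _ :=
  GRing.isZmodClosed.Build (bounded_family I X) null_family null_family_zmod_closed.

Definition ultrapower := Quotient.quot null_family.

HB.instance Definition _ := GRing.Zmodule.on ultrapower.

Definition ultra_class x : ultrapower := \pi_(Quotient.quot null_family)%qT x.
Definition ultra_repr (q : ultrapower) : bounded_family I X :=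
  repr (q : Quotient.quot null_family).

Lemma ultra_reprK q : ultra_class (ultra_repr q) = q.
Proof. exact: reprK. Qed.

Lemma ultra_classP x y :
  ultra_class x = ultra_class y <-> x - y \in null_family.
Proof. by rewrite Quotient.idealrBE; split=> /eqP. Qed.

Lemma ultra_classD x y : ultra_class (x + y) = ultra_class x + ultra_class y.
Proof. exact: (raddfD (\pi_(Quotient.quot null_family)%qT)). Qed.

Lemma ultra_classB x y : ultra_class (x - y) = ultra_class x - ultra_class y.
Proof. exact: (raddfB (\pi_(Quotient.quot null_family)%qT)). Qed.

Lemma ultra_class0 : ultra_class 0 = 0.
Proof. exact: (raddf0 (\pi_(Quotient.quot null_family)%qT)). Qed.

Definition ultra_scale (a : K) (q : ultrapower) : ultrapower :=
  ultra_class (a *: ultra_repr q).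

Lemma ultra_scaleE a x : ultra_scale a (ultra_class x) = ultra_class (a *: x).
Proof.
apply/ultra_classP; rewrite -scalerBr.
have /ultra_classP/null_family_near h := ultra_reprK (ultra_class x).
apply/null_family_near => e e0.
have a0 : (0 : R) <= re_part `|a| by rewrite -(le_of_real k) of_real0 re_partK.
have d0 : 0 < e / (re_part `|a| + 1) by rewrite divr_gt0// ltr_wpDl.
apply: filterS (h _ d0) => i; rewrite familyZE rnormZ ltr_pdivlMr ?ltr_wpDl//.
apply: le_lt_trans; rewrite mulrC ler_wpM2l ?rnorm_ge0// lerDl//.
Qed.

Let ultra_scaleA a b q : ultra_scale a (ultra_scale b q) = ultra_scale (a * b) q.
Proof. by rewrite -[q]ultra_reprK !ultra_scaleE scalerA. Qed.
Let ultra_scale1 : left_id 1 ultra_scale.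
Proof. by move=> q; rewrite -[q]ultra_reprK !ultra_scaleE scale1r. Qed.
Let ultra_scaleDr : right_distributive ultra_scale +%R.
Proof.
move=> a q r; rewrite -[q]ultra_reprK -[r]ultra_reprK -ultra_classD !ultra_scaleE.
by rewrite scalerDr ultra_classD.
Qed.
Let ultra_scaleDl q : {morph ultra_scale^~ q : a b / a + b}.
Proof.
by move=> a b; rewrite -[q]ultra_reprK !ultra_scaleE scalerDl ultra_classD.
Qed.

HB.instance Definition _ := GRing.Zmodule_isLmodule.Build K ultrapower
  ultra_scaleA ultra_scale1 ultra_scaleDr ultra_scaleDl.

Lemma ultra_classZ a x : ultra_class (a *: x) = a *: ultra_class x.
Proof. by rewrite -ultra_scaleE. Qed.

Lemma ultra_limit_cvg (f : I -> R) :
  (exists M, forall i, `|f i| <= M) -> cvg (f i @[i --> U]).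
Proof.
move=> [M fM].
have [|p [_ pP]] := @segment_compact R (- M) M (f i @[i --> U]) _.
  by apply: nearW => i /=; rewrite in_itv/= -ler_norml.
apply/cvg_ex; exists p => A pA.
have [//|nA] := in_ultra_setVsetC (f @^-1` A) UF.
have [y []] := pP _ _ (nA : (f i @[i --> U]) (~` A)) pA.
by [].
Qed.

(* This is the quotient norm: see rnorm_ultrapower below. *)
Definition ultra_norm (q : ultrapower) : R :=
  lim (rnorm (ultra_repr q i) @[i --> U]).

Let rnorm_family_cvg x : cvg (rnorm (x i) @[i --> U]).
Proof.
have [M xM] := family_bounded x; apply: ultra_limit_cvg; exists M => i.
by rewrite ger0_norm// rnorm_ge0.
Qed.

Lemma ultra_normE x : ultra_norm (ultra_class x) = lim (rnorm (x i) @[i --> U]).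
Proof.
have /ultra_classP/null_family_near h := ultra_reprK (ultra_class x).
apply/esym/cvg_lim => //; apply/cvgrPdist_lt => e e0.
have e2 : 0 < e / 2 by rewrite divr_gt0.
have /cvgrPdist_lt/(_ _ e2) h2 := @rnorm_family_cvg (ultra_repr (ultra_class x)).
apply: filterS2 (h _ e2) h2 => i h1 h3.
rewrite (splitr e) -[_ - _](subrKA (rnorm (ultra_repr (ultra_class x) i))).
rewrite (le_lt_trans (ler_normD _ _))// addrC ltrD//.
by rewrite (le_lt_trans (ler_dist_rnorm _ _))// -familyBE.
Qed.

Lemma ultra_norm_cvg x : rnorm (x i) @[i --> U] --> ultra_norm (ultra_class x).
Proof. by rewrite ultra_normE; exact: rnorm_family_cvg. Qed.

Lemma ultra_norm_le x (M : R) : (\forall i \near U, rnorm (x i) <= M) ->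
  ultra_norm (ultra_class x) <= M.
Proof. by move=> xM; rewrite ultra_normE; apply: limr_le. Qed.

Let ultra_normD q r : ultra_norm (q + r) <= ultra_norm q + ultra_norm r.
Proof.
rewrite -[q]ultra_reprK -[r]ultra_reprK -ultra_classD.
set x := ultra_repr q; set y := ultra_repr r.
have h : rnorm (x i) + rnorm (y i) @[i --> U] -->
    ultra_norm (ultra_class x) + ultra_norm (ultra_class y).
  by apply: cvgD; exact: ultra_norm_cvg.
rewrite -subr_ge0; apply: (cvgr_to_ge (cvgB h (@ultra_norm_cvg (x + y)))).
by apply: nearW => i /=; rewrite subr_ge0 ler_rnormD.
Qed.

Let ultra_normZ a q : ultra_norm (a *: q) = re_part `|a| * ultra_norm q.
Proof.
rewrite -[q]ultra_reprK -ultra_classZ; set x := ultra_repr q.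
rewrite [LHS]ultra_normE; apply: cvg_lim => //.
under eq_fun do rewrite familyZE rnormZ.
by apply: cvgMr; exact: ultra_norm_cvg.
Qed.

Let ultra_norm0 q : ultra_norm q = 0 -> q = 0.
Proof.
move=> q0; rewrite -[q]ultra_reprK -ultra_class0; apply/ultra_classP.
rewrite subr0; apply/null_familyP; rewrite -[X in _ --> X]q0 -{2}[q]ultra_reprK.
exact: ultra_norm_cvg.
Qed.

HB.instance Definition _ := Lmodule_isNormed.Build K ultrapower
  (of_real_normD ultra_normD) (of_real_normZ ultra_normZ)
  (of_real_norm0 ultra_norm0).

Lemma rnorm_ultra_class x :
  rnorm (ultra_class x) = lim (rnorm (x i) @[i --> U]).
Proof. by rewrite -ultra_normE; exact: of_realK. Qed.

Lemma ultra_class_lift q (e : R) : 0 < e ->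
  exists2 x, q = ultra_class x & forall i, rnorm (x i) <= rnorm q + e.
Proof.
move=> e0; pose y := ultra_repr q.
have qE : rnorm q = ultra_norm q by exact: of_realK.
pose f i : X := if rnorm (y i) <= rnorm q + e then y i else 0.
have fB i : rnorm (f i) <= rnorm q + e.
  by rewrite /f; case: ifPn => // _; rewrite rnorm0 addr_ge0 ?rnorm_ge0// ltW.
have fB' : exists M : R, forall i, rnorm (f i) <= M by exists (rnorm q + e).
exists (BoundedFamily fB') => //.
rewrite -[LHS]ultra_reprK; apply/ultra_classP/null_family_near => d d0.
have /cvgrPdist_lt/(_ _ e0) := @ultra_norm_cvg y; rewrite ultra_reprK -qE.
apply: filterS => i h; rewrite familyBE /= /f -/y ifT ?subrr ?rnorm0//.
by move: h; rewrite distrC => /ltr_distlDr/ltW.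
Qed.

Lemma rnorm_ultrapower q : rnorm q =
  inf [set sup (range (fun i => rnorm (x i))) |
        x in [set x | ultra_class x = q]].
Proof.
have [i0 _] : exists i : I, setT i by apply: (@filter_ex _ U); exact: filterT.
have sB x i : rnorm (x i) <= sup (range (fun i => rnorm (x i))).
  have [M xM] := family_bounded x.
  apply: ub_le_sup; last by exists i.
  by exists M => _ [j _ <-].
have lb : lbound [set sup (range (fun i => rnorm (x i))) | x in
    [set x | ultra_class x = q]] (rnorm q).
  move=> _ [x <- <-]; rewrite rnorm_ultra_class -ultra_normE.
  by apply: ultra_norm_le; exact: nearW.
apply/eqP; rewrite eq_le; apply/andP; split.
  apply: lb_le_inf => //; exists (sup (range (fun i => rnorm (ultra_repr q i)))).
  by exists (ultra_repr q) => //; exact: ultra_reprK.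
apply/ler_addgt0Pr => e e0; have [x qx xB] := ultra_class_lift q e0.
apply: (@le_trans _ _ (sup (range (fun i => rnorm (x i))))).
  by apply: ge_inf; [exists (rnorm q) | exists x].
by apply: ge_sup; [exists (rnorm (x i0)), i0 | move=> _ [i _ <-]].
Qed.

End ultrapower.

Section ultrapower_complete.
Context {R : realType} {k : scalar_kind} {I : Type}.
Notation K := (scalar_field R k).
Variables (U : set_system I) (UF : UltraFilter U) (X : completeNormedModType K).

Lemma ultrapower_complete (F : set_system (ultrapower UF X)) :
  ProperFilter F -> cauchy F -> cvg F.
Proof.
move: F; apply: rapid_complete => u ru.
have h2 n : (0 : R) < 2^-1 ^+ n by rewrite exprn_gt0// invr_gt0.
have /choice[d dP] n : exists x : bounded_family I X,
    ultra_class UF x = u n.+1 - u n /\ forall i, rnorm (x i) <= 2 * 2^-1 ^+ n.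
  have [x ux xB] := ultra_class_lift (u n.+1 - u n) (h2 n).
  by exists x; split=> // i; rewrite (le_trans (xB i))// mulr2n mulrDl !mul1r lerD2r.
pose v n := ultra_repr (u 0%N) + \sum_(j < n) d j.
have vu n : ultra_class UF (v n) = u n.
  elim: n => [|n IHn]; first by rewrite /v big_ord0 addr0 ultra_reprK.
  by rewrite /v big_ord_recr/= addrA ultra_classD IHn (dP n).1 addrC subrK.
have vS n i : rnorm (v n.+1 i - v n i) <= 2 * 2^-1 ^+ n.
  have -> : v n.+1 = d n + v n by rewrite /v big_ord_recr/= addrA addrC.
  by rewrite familyDE addrK; exact: (dP n).2.
have /choice[l lP] i := rapid_cvg (fun n => vS n i).
have lB : exists M : R, forall i, rnorm (l i) <= M.
  have [M vM] := family_bounded (v 0%N); exists (2 * 2 * 2^-1 ^+ 0 + M) => i.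
  rewrite -[l i](subrK (v 0%N i)) (le_trans (ler_rnormD _ _))// lerD//.
exists (ultra_class UF (BoundedFamily lB)), (2 * 2) => n.
rewrite -vu -ultra_classB rnorm_ultra_class -ultra_normE; apply: ultra_norm_le.
by apply: nearW => i; rewrite familyBE.
Qed.

HB.instance Definition _ :=
  Uniform_isComplete.Build (ultrapower UF X) ultrapower_complete.

End ultrapower_complete.

Section banach_spaces.
Context {R : realType} {k : scalar_kind}.
Notation K := (scalar_field R k).

(* dot is linear in its first argument and conjugate-linear in the second. *)
Definition is_hilbert (H : completeNormedModType K) : Prop :=
  exists dot : {dot H for @conj_scalar R k}, forall x : H, `|x| ^+ 2 = dot x x.

Definition is_linear_isometry (X Y : normedModType K)
    (T : {linear X -> Y}) : Prop :=
  forall x : X, `|T x| = `|x|.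

Definition linearly_isometric (X Y : normedModType K) : Prop :=
  exists T : {linear X -> Y},
    is_linear_isometry T /\ forall y : Y, exists x : X, T x = y.

Definition elementarily_equivalent (X Y : completeNormedModType K) : Prop :=
  exists (I : Type) (U : set_system I) (UF : UltraFilter U)
         (J : Type) (V : set_system J) (VF : UltraFilter V),
    linearly_isometric (ultrapower UF X) (ultrapower VF Y).

(* Cardinals are represented by types, up to equipotence. *)
Definition has_density_character (X : normedModType K) (kappa : Type) : Prop :=
  (exists A : set X, dense A /\ (A #= [set: kappa])%card) /\
  (forall A : set X, dense A -> ([set: kappa] #<= A)%card).

Definition is_basis (X : normedModType K) (B : seq X) : Prop :=
  (forall c : 'I_(size B) -> K, \sum_i c i *: B`_i = 0 -> forall i, c i = 0) /\
  (forall x : X, exists c : 'I_(size B) -> K, x = \sum_i c i *: B`_i).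

Definition finite_dimensional (X : normedModType K) : Prop :=
  exists B : seq X, is_basis B.

Definition uncountably_categorical (X : completeNormedModType K) : Prop :=
  ~ finite_dimensional X /\
  exists kappa : Type,
    [/\ ~ countable [set: kappa],
        (exists Y : completeNormedModType K,
           elementarily_equivalent Y X /\ has_density_character Y kappa) &
        (forall Y Z : completeNormedModType K,
           elementarily_equivalent Y X -> has_density_character Y kappa ->
           elementarily_equivalent Z X -> has_density_character Z kappa ->
           linearly_isometric Y Z)].

(* The scalar l is real also when K is the field of complex numbers. *)
Definition lp_pair (X : normedModType K) (p : R) (x y : X) : Prop :=
  forall l : R, rnorm (x + of_real l *: y) `^ p = 1 + `|l| `^ p.

End banach_spaces.

(* Main.v *)
(* Hypothesis (a), applied to x + y and x - y, gives the parallelogram inequality in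
   E_n up to a factor p_n - 1, which tends to 1.  In an ultrapower of E, the elements
   whose coordinatewise ultralimits vanish are represented by families supported on
   arbitrarily late coordinates, so they satisfy the exact parallelogram law and form
   a Hilbert space H orthogonal to the diagonal copy of E; since bounded families in
   E_n have ultralimits, the ultrapower is E (+)_2 H.

   Let T embed E isometrically in E (+)_2 H, let (x, y) be an l_p-pair of E_n with
   p = p_n, and put u = T x, v = T y.  Expanding |u + t v|^2 + |u - t v|^2 as t -> 0
   shows that v has no component in H nor in any E_m with p_m < p.  As the second
   members of pairs span E_n, T maps the sum F_s of the E_n with p_n >= s into itself
   for every s > 2; F_s is finite dimensional, so T F_s = F_s, and the union of the
   F_s is dense in E.

   If Y is elementarily equivalent to E, then Y embeds in an ultrapower Z of E, and
   E embeds in Z through an ultrapower of Y.  The rigidity of the copies of E, used in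
   an ultrapower of Z, puts E inside Y, so Y = E (+)_2 H' for a Hilbert space H'.  As
   E is separable, an uncountable density character of Y is the dimension of H',
   which determines Y. *)

From HB Require Import structures.
Require Import Defs.
From mathcomp Require Import all_boot all_order all_algebra.
From mathcomp Require Import all_classical all_reals all_analysis.
From mathcomp Require Import complex ring lra.

Set Implicit Arguments.
Unset Strict Implicit.
Unset Printing Implicit Defensive.

Import Order.TTheory GRing.Theory Num.Theory.
Import numFieldNormedType.Exports.

Local Open Scope classical_set_scope.
Local Open Scope ring_scope.

(** * Power inequalities *)

Section real_powers.
Variable R : realType.
Implicit Types a b c p q r s t u v : R.

(** The statements are phrased for a pair [hilbert_split J P], that is, for a space Z that contains
    a copy J E of E with a Hilbert complement ker P. The space E itself, E (+)_2 H and every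
    ultrapower of E are instances, and an ultrapower of a split space is split again. This reaches
    the ultrapower of an ultrapower, needed to descend to Y, without products of ultrafilters.

    In the rigidity argument the Hilbert summand behaves like a coordinate of exponent 2. An
    l_p-pair excludes only exponents below p, so the argument yields an inclusion of T F_s in F_s,
    and surjectivity is a dimension count. Here p_n -> 2 leaves finitely many summands in F_s, and
    p_n > 2 places each E_n in some F_s.

    Uniqueness requires density characters to behave as cardinals: that a family of sets has a
    member of least cardinality, and that finite sequences over an infinite type inject into it, are
    both derived from Zorn's lemma. *)

Lemma le_powR r a b : 0 <= r -> 0 <= a -> a <= b -> a `^ r <= b `^ r.
Proof.
by move=> r0 a0 ab; apply: (ge0_ler_powR r0); rewrite ?nnegrE// (le_trans a0).
Qed.

Lemma powR_divK a q : 0 <= a -> 0 < q -> (a `^ (2 / q)) `^ (q / 2) = a.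
Proof.
move=> a0 q0; rewrite -(powRrM a (2 / q) (q / 2)).
by rewrite mulrA divfK ?gt_eqF// divff ?powRr1.
Qed.

(** Young's inequality for a and 1 with exponents r and r / (r - 1); the case r = 1 has no finite
    conjugate exponent and is treated apart. *)
Lemma bernoulli_powR a r : 0 <= a -> 1 <= r -> 1 + r * (a - 1) <= a `^ r.
Proof.
move=> a0; rewrite le_eqVlt => /predU1P[<-|r1].
  by rewrite mul1r powRr1// addrC subrK.
have r0 : 0 < r by rewrite (lt_trans _ r1).
have rV : r^-1 < 1 by rewrite invf_lt1.
have q0 : 0 < (1 - r^-1)^-1 by rewrite invr_gt0 subr_gt0.
have := @conjugate_powR R a 1 r (1 - r^-1)^-1 a0 ler01 r0 q0.
rewrite invrK addrCA subrr addr0 mulr1 powR1 mul1r => /(_ erefl).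
rewrite -(ler_pM2l r0) mulrDr [r * (_ / r)]mulrC divfK ?gt_eqF//.
rewrite mulrBr mulfV ?gt_eqF// mulr1; lra.
Qed.

(** In Bernoulli's inequality at a and at b the linear terms cancel, a - 1 and b - 1 being
    opposite. *)
Lemma sum_powR_ge2 a b r : 0 <= a -> 0 <= b -> a + b = 2 -> 1 <= r ->
  2 <= a `^ r + b `^ r.
Proof.
move=> a0 b0 ab r1; have := bernoulli_powR a0 r1; have := bernoulli_powR b0 r1.
have -> : b = 2 - a by rewrite -ab addrAC subrr add0r.
lra.
Qed.

(** Bernoulli's inequality at 1 + s with exponent 1 / s gives 2 <= (1 + s)^(1/s). *)
Lemma powR2_le_onep s : 0 < s <= 1 -> 2 `^ s <= 1 + s.
Proof.
move=> /andP[s0 s1].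
have s10 : 0 <= 1 + s by lra.
have := @bernoulli_powR (1 + s) s^-1 s10; rewrite invf_ge1// => /(_ s1).
rewrite addrAC subrr add0r mulVf ?gt_eqF// -[1 + 1]/(2 : R) => h.
have : 2 `^ s <= ((1 + s) `^ s^-1) `^ s.
  by apply: (ge0_ler_powR (ltW s0)); rewrite ?nnegrE ?powR_ge0.
by rewrite -powRrM mulVf ?gt_eqF// powRr1.
Qed.

(** Power means give the constant 2^(1 - 2/p), which is at most 1 + (1 - 2/p) <= p - 1. The cruder p
    - 1 still tends to 1 as p -> 2. *)
Lemma sqr_sum_le_powR p u v : 2 < p -> 0 <= u -> 0 <= v ->
  u ^+ 2 + v ^+ 2 <= (p - 1) * (u `^ p + v `^ p) `^ (2 / p).
Proof.
move=> p2 u0 v0.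
have p0 : 0 < p by lra.
have [m0|m0] := leP (u ^+ 2 + v ^+ 2) 0.
  by rewrite (le_trans m0)// mulr_ge0 ?powR_ge0//; lra.
set m := (u ^+ 2 + v ^+ 2) / 2.
have m_gt0 : 0 < m by rewrite divr_gt0.
have dm w : 0 <= w ^+ 2 / m by rewrite mulr_ge0 ?sqr_ge0 ?invr_ge0 ?(ltW m_gt0).
have sqp w : 0 <= w -> w `^ p = (w ^+ 2 / m) `^ (p / 2) * m `^ (p / 2).
  move=> w0; rewrite -powRM ?dm ?(ltW m_gt0)// divfK ?gt_eqF//.
  by rewrite -powR_mulrn// -powRrM mulrCA divff// mulr1.
(* Dividing by the mean m of the squares normalises them: u^2 / m and v^2 / m add up to 2. *)
have h : 2 * m `^ (p / 2) <= u `^ p + v `^ p.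
  rewrite (sqp u)// (sqp v)// -mulrDl ler_wpM2r ?powR_ge0//.
  apply: sum_powR_ge2; rewrite ?dm//; last by rewrite ler_pdivlMr//; lra.
  by rewrite -mulrDl /m invf_div mulrCA divff ?gt_eqF// mulr1.
have h2 : 2 `^ (2 / p) * m <= (u `^ p + v `^ p) `^ (2 / p).
  have pp : p / 2 * (2 / p) = 1 by rewrite mulrA divfK// divff ?gt_eqF.
  have -> : 2 `^ (2 / p) * m = (2 * m `^ (p / 2)) `^ (2 / p).
    by rewrite (powRM _ (ler0n _ 2) (powR_ge0 _ _)) -powRrM pp powRr1 ?(ltW m_gt0).
  apply: le_powR h; first by rewrite divr_ge0 ?(ltW p0).
  by rewrite mulr_ge0 ?powR_ge0.
have -> : u ^+ 2 + v ^+ 2 = 2 * m by rewrite /m mulrC divfK.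
have p2V : 2 / p < 1 by rewrite ltr_pdivrMr// mul1r.
have p2V0 : 0 < 2 / p by rewrite divr_gt0.
have /powR2_le_onep h3 : 0 < 1 - 2 / p <= 1 by lra.
have ps : 1 - 2 / p <= p - 2.
  have -> : 1 - 2 / p = (p - 2) / p by rewrite mulrBl divff ?gt_eqF.
  rewrite ler_pdivrMr// -subr_ge0 -[X in _ - X]mulr1 -mulrBr mulr_ge0//; lra.
have e : (2 : R) = 2 `^ (1 - 2 / p) * 2 `^ (2 / p).
  by rewrite -powRD ?subrK ?powRr1//; apply/implyP => _; rewrite pnatr_eq0.
rewrite {1}e -mulrA ler_pM ?powR_ge0 ?(mulr_ge0 (powR_ge0 _ _) (ltW m_gt0))//.
by rewrite (le_trans h3)//; lra.
Qed.

Lemma le0_of_le_powR c C s : 0 < s -> 0 <= C ->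
  (forall t, 0 < t <= 1 -> c <= C * t `^ s) -> c <= 0.
Proof.
move=> s0 C0 h; rewrite leNgt; apply/negP => c0.
(* Chosen so that C d < c, also when C = 0; t is then the largest number in (0, 1] with t^s <= d. *)
pose d := c / (2 * (C + 1)).
have C1 : 0 < 2 * (C + 1) by lra.
have d0 : 0 < d by rewrite divr_gt0.
pose t := Num.min 1 (d `^ s^-1).
have t0 : 0 < t by rewrite lt_min ltr01 powR_gt0.
have : 0 < t <= 1 by rewrite t0 ge_min lexx.
move=> /h; apply/negP; rewrite -ltNge.
have : t `^ s <= d.
  have : t `^ s <= (d `^ s^-1) `^ s.
    by apply: le_powR; rewrite ?(ltW s0) ?(ltW t0)// /t ge_min lexx orbT.
  by rewrite -powRrM mulVf ?gt_eqF// powRr1// (ltW d0).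
move=> /(ler_wpM2l C0) /le_lt_trans; apply.
rewrite /d mulrCA gtr_pMr// ltr_pdivrMr// mul1r; lra.
Qed.

Lemma le0_of_le_small c C : 0 <= C ->
  (forall t, 0 < t <= 1 -> c <= C * t) -> c <= 0.
Proof.
move=> C0 h; apply: (le0_of_le_powR ltr01 C0) => t t01.
by rewrite powRr1 ?h//; case/andP: t01 => /ltW.
Qed.

(* Bernoulli's inequality at a^2 / (a^2 + t^p) turns the hypothesis into
   b^q <= C t^(p - q). *)
Lemma eq0_of_powR_perturb a b p q : 2 < q -> q < p -> 0 <= a <= 1 -> 0 <= b ->
  (forall t, 0 < t <= 1 -> (a `^ q + (t * b) `^ q) `^ (2 / q) <= a ^+ 2 + t `^ p) ->
  b = 0.
Proof.
move=> q2 qp /andP[a0 a1] b0 h.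
have q0 : 0 < q by lra.
pose r := q / 2.
have r1 : 1 <= r by rewrite ler_pdivlMr//; lra.
suff : b `^ q <= 0.
  by rewrite le_eqVlt ltNge powR_ge0 orbF powR_eq0 => /andP[/eqP].
(* The constant bounds the factor r X^(r - 1) of the error term, where X = a^2 + t^p <= 2. *)
apply: (@le0_of_le_powR _ (r * 2 `^ (r - 1)) (p - q)) => [||t /andP[t0 t1]].
- by rewrite subr_gt0.
- by rewrite mulr_ge0 ?powR_ge0//; lra.
have tp0 : 0 < t `^ p by rewrite powR_gt0.
have tp1 : t `^ p <= 1.
  have -> : 1 = (1 : R) `^ p by rewrite powR1.
  by apply: le_powR; rewrite ?(ltW t0)//; lra.
set X := a ^+ 2 + t `^ p.
have a21 : a ^+ 2 <= 1 by rewrite expr_le1.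
have X0 : 0 < X by rewrite ltr_wpDl ?sqr_ge0.
have hX : a `^ q + (t * b) `^ q <= X `^ r.
  have tt : 0 < t <= 1 by rewrite t0.
  have r0 : 0 <= r by lra.
  have := le_powR r0 (powR_ge0 _ _) (h t tt).
  by rewrite powR_divK ?addr_ge0 ?powR_ge0.
have aX : 0 <= a ^+ 2 / X by rewrite mulr_ge0 ?sqr_ge0 ?invr_ge0 ?(ltW X0).
have XrE : X `^ r = X * X `^ (r - 1).
  have : X `^ (r - 1 + 1) = X `^ (r - 1) * X `^ 1.
    by rewrite powRD//; apply/implyP => _; rewrite gt_eqF.
  by rewrite subrK (powRr1 (ltW X0)) mulrC.
have Xr0 : 0 < X `^ r by rewrite powR_gt0.
have aXE : (a ^+ 2 / X) `^ r * X `^ r = a `^ q.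
  rewrite -(powRM r aX (ltW X0)) divfK ?gt_eqF//.
  by rewrite -(powR_mulrn 2 a0) -(powRrM a 2%:R r) /r mulrCA divff ?mulr1.
have := bernoulli_powR aX r1.
rewrite -(ler_pM2r Xr0) aXE.
have -> : (1 + r * (a ^+ 2 / X - 1)) * X `^ r = X `^ r - r * X `^ (r - 1) * t `^ p.
  rewrite XrE; move: X0 (X `^ (r - 1)); rewrite /X => X0 w.
  by field; rewrite gt_eqF.
move=> h1.
have : X `^ (r - 1) <= 2 `^ (r - 1).
  by apply: le_powR; rewrite ?subr_ge0 ?(ltW X0)// /X; lra.
rewrite -(ler_pM2r tp0) -(@ler_pM2l _ r); last by lra.
move: h1; have -> : t `^ p = t `^ q * t `^ (p - q).
  by rewrite -powRD ?subrKC//; apply/implyP => _; rewrite gt_eqF.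
have tq0 : 0 < t `^ q by rewrite powR_gt0.
move: hX; rewrite (powRM q (ltW t0) b0) => hX h1 h2.
rewrite -(ler_pM2l tq0); move: hX h1 h2.
move: (t `^ q) (t `^ (p - q)) (X `^ r) (X `^ (r - 1)) (2 `^ (r - 1)) (a `^ q).
move=> A B C D D' F; move: (b `^ q) => G.
have -> : A * (r * D' * B) = r * (D' * (A * B)) by ring.
rewrite -!mulrA; lra.
Qed.

End real_powers.

(** * Linear isometries and total families *)

Section linear_toolkit.
Context {R : realType} {k : scalar_kind}.
Notation K := (scalar_field R k).

Lemma re_norm_ge0 (a : K) : 0 <= re_part `|a| :> R.
Proof. by rewrite -(le_of_real k) of_real0 re_partK. Qed.

Lemma re_norm_eq0 (a : K) : re_part `|a| = 0 :> R -> a = 0.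
Proof.
move=> a0; apply/eqP; rewrite -normr_eq0 -[`|a|]re_partK// a0.
by rewrite of_real0.
Qed.

Lemma re_norm_of_real (r : R) : re_part `|of_real r : K| = `|r|.
Proof.
have h0 (s : R) : 0 <= s -> re_part `|of_real s : K| = `|s|.
  move=> s0; rewrite ger0_norm ?of_realK ?ger0_norm//.
  by rewrite -(of_real0 R k) le_of_real.
have [/h0//|/ltW r0] := leP 0 r.
have -> : of_real r = - of_real (- r) :> K.
  apply/eqP; rewrite -addr_eq0 -of_realD subrr of_real0 //.
by rewrite normrN h0 ?oppr_ge0// normrN.
Qed.

Lemma rnorm_small_eq0 (V : normedModType K) (x : V) (C : R) : 0 < C ->
  (forall e, 0 < e -> rnorm x <= C * e) -> x = 0.
Proof.
move=> C0 h; apply: rnorm_eq0; apply/eqP; rewrite eq_le rnorm_ge0 andbT.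
apply/ler_addgt0Pr => e e0; rewrite add0r.
have := h (e / C); rewrite divr_gt0// => /(_ isT) /le_trans; apply.
by rewrite mulrC divfK ?gt_eqF.
Qed.

Lemma sum_sub2 (V : lmodType K) (x y : V) : x + y + (x - y) = (of_real 2 : K) *: x.
Proof. by rewrite (of_realD k 1 1) of_real1 scalerDl scale1r addrACA subrr addr0. Qed.

Lemma sub_sub2 (V : lmodType K) (x y : V) : x + y - (x - y) = (of_real 2 : K) *: y.
Proof.
rewrite (of_realD k 1 1) of_real1 scalerDl scale1r opprB [x + y]addrC.
by rewrite addrACA subrr addr0.
Qed.

Lemma rnorm_two (V : normedModType K) (x : V) : rnorm ((of_real 2 : K) *: x) = 2 * rnorm x.
Proof. by rewrite rnormZ re_norm_of_real ger0_norm. Qed.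

Lemma exists_half_lt (e : R) : 0 < e -> exists n, 2^-1 ^+ n < e.
Proof.
move=> e0; have : (2^-1 ^+ n : R) @[n --> \oo] --> (0 : R).
  by apply: cvg_expr; rewrite ger0_norm ?invr_ge0// invf_lt1// ltr1n.
move=> /cvgrPdist_lt /(_ _ e0) [N _ NP]; exists N.
have := NP N (leqnn N); rewrite /= sub0r normrN; apply: le_lt_trans.
exact: ler_norm.
Qed.

Lemma half_pow_gt0 n : (0 : R) < 2^-1 ^+ n.
Proof. by rewrite exprn_gt0// invr_gt0. Qed.

Definition linear_of (X Y : lmodType K) (f : X -> Y) (fl : linear f) :
  {linear X -> Y} := HB.pack f (GRing.isLinear.Build _ _ _ _ f fl).

Lemma isometryP (X Y : normedModType K) (T : {linear X -> Y}) :
  is_linear_isometry T <-> forall x, rnorm (T x) = rnorm x.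
Proof.
split=> h x; first by rewrite /rnorm h.
by rewrite -!of_real_rnorm h.
Qed.

Lemma isometry_inj (X Y : normedModType K) (T : {linear X -> Y}) :
  (forall x, rnorm (T x) = rnorm x) -> injective T.
Proof.
move=> iT x y Txy; apply/eqP; rewrite -subr_eq0; apply/eqP; apply: rnorm_eq0.
by rewrite -iT linearB /= Txy subrr rnorm0.
Qed.

Lemma linearly_isometric_inv (X Y : normedModType K) (T : {linear X -> Y}) :
  (forall x, rnorm (T x) = rnorm x) -> (forall y, exists x, T x = y) ->
  exists S : {linear Y -> X}, cancel S T /\ forall y, rnorm (S y) = rnorm y.
Proof.
move=> iT sT; pose g y := sval (cid (sT y)).
have gK : cancel g T by move=> y; exact: svalP (cid (sT y)).
have gl : linear g.
  by move=> a y z; apply: (isometry_inj iT); rewrite linearP /= !gK.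
by exists (linear_of gl); split=> // y; rewrite -iT gK.
Qed.

Lemma linearly_isometric_sym (X Y : normedModType K) :
  linearly_isometric X Y -> linearly_isometric Y X.
Proof.
move=> [T [/isometryP iT sT]]; have [S [SK iS]] := linearly_isometric_inv iT sT.
exists S; split; first exact/isometryP.
by move=> x; exists (T x); apply: (isometry_inj iT).
Qed.

Lemma linearly_isometric_trans (X Y Z : normedModType K) :
  linearly_isometric X Y -> linearly_isometric Y Z -> linearly_isometric X Z.
Proof.
move=> [T [iT sT]] [S [iS sS]]; exists (S \o T : {linear X -> Z}); split.
  by move=> x /=; rewrite iS iT.
by move=> z; have [y <-] := sS z; have [x <-] := sT y; exists x.
Qed.

Lemma approx_cvg (V : completeNormedModType K) (u : nat -> V) (C : R) :
  (forall n, rnorm (u n.+1 - u n) <= C * 2^-1 ^+ n) ->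
  exists l, forall e, 0 < e -> exists N, forall n, (N <= n)%N -> rnorm (l - u n) < e.
Proof.
move=> uC; have [l lP] := rapid_cvg uC; exists l => e e0.
have C0 : 0 <= C.
  by have := le_trans (rnorm_ge0 _) (uC 0%N); rewrite expr0 mulr1.
have [|N NP] := @exists_half_lt (e / (2 * C + 1)).
  by rewrite divr_gt0//; lra.
exists N => n Nn; apply: (le_lt_trans (lP n)).
have nN : (2^-1 : R) ^+ n <= 2^-1 ^+ N.
  by apply: ler_wiXn2l => //; lra.
move: NP; rewrite ltr_pdivlMr; last lra.
move: nN (half_pow_gt0 N); move: (_ ^+ n) (_ ^+ N) => a b; nra.
Qed.

(** T preserves distances, so points of X whose images approach y rapidly form a Cauchy sequence;
    its limit is sent to y. *)
Lemma isometry_closed_range (X : completeNormedModType K) (Y : normedModType K)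
    (T : {linear X -> Y}) (y : Y) :
  (forall x, rnorm (T x) = rnorm x) ->
  (forall e, 0 < e -> exists x, rnorm (y - T x) < e) -> exists x, T x = y.
Proof.
move=> iT hy; have /choice[u uP] n := hy _ (half_pow_gt0 n).
have [|x xP] := @approx_cvg X u 2.
  move=> n; rewrite -iT linearB (le_trans (ler_rnormB _ y _))//.
  rewrite rnorm_distC; have := uP n; have := uP n.+1; rewrite exprS.
  move: (half_pow_gt0 n) (rnorm _) (rnorm _) => + s t; move: (_ ^+ n) => a; lra.
exists x; apply/eqP; rewrite -subr_eq0; apply/eqP.
apply: (@rnorm_small_eq0 _ _ 2) => // e e0; have [N NP] := xP _ e0.
have [m mP] := exists_half_lt e0.
have := NP _ (leq_maxl N m); have := uP (maxn N m).
have : (2^-1 : R) ^+ (maxn N m) <= 2^-1 ^+ m.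
  by apply: ler_wiXn2l; rewrite ?leq_maxr//; lra.
have := ler_rnormB (T x) (T (u (maxn N m))) y.
rewrite -linearB iT [rnorm (T (u _) - y)]rnorm_distC.
move: (rnorm (T x - y)) (rnorm (x - _)) (rnorm (y - _)) => a b c.
move: mP; move: (2^-1 ^+ m : R) (2^-1 ^+ maxn N m : R) => d f; lra.
Qed.

Section combinations.
Variables (T : Type) (V : lmodType K).
Implicit Types (u : T -> V) (s : seq (K * T)).

(** Formal combinations are lists of pairs, with repetitions allowed, so that concatenation is
    addition over an arbitrary index type. *)
Definition comb u s : V := \sum_(t <- s) t.1 *: u t.2.

Definition comb_scale (a : K) s : seq (K * T) := [seq (a * t.1, t.2) | t <- s].

Lemma comb_cat u s1 s2 : comb u (s1 ++ s2) = comb u s1 + comb u s2.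
Proof. by rewrite /comb big_cat. Qed.

Lemma comb_scaleE u a s : comb u (comb_scale a s) = a *: comb u s.
Proof.
by rewrite /comb /comb_scale big_map scaler_sumr; apply: eq_bigr => t _ /=; rewrite scalerA.
Qed.

Lemma comb_seq1 u a t : comb u [:: (a, t)] = a *: u t.
Proof. by rewrite /comb big_seq1. Qed.

End combinations.

Definition total_family (T : Type) (V : normedModType K) (u : T -> V) :=
  forall x e, 0 < e -> exists s, rnorm (x - comb u s) < e.

Lemma linear_comb (T : Type) (V W : lmodType K) (f : {linear V -> W}) (u : T -> V) s :
  f (comb u s) = comb (f \o u) s.
Proof. by rewrite /comb linear_sum; apply: eq_bigr => t _; rewrite linearZ. Qed.

Section extension.
Variables (T : Type) (X Y : completeNormedModType K) (u : T -> X) (v : T -> Y).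
Hypothesis uv : forall s, rnorm (comb u s) = rnorm (comb v s).

(** The closure of the graph of comb u s |-> comb v s. It is a linear relation that preserves norms,
    hence is single-valued; when u is total, completeness of Y makes it defined everywhere. *)
Let G x y := forall e : R, 0 < e -> exists s, rnorm (x - comb u s) < e /\
  rnorm (y - comb v s) < e.

Let GP a x y x' y' : G x y -> G x' y' -> G (a *: x + x') (a *: y + y').
Proof.
move=> xy xy' e e0.
have C0 := re_norm_ge0 a; set C := re_part `|a| in C0.
have d0 : 0 < e / (2 * (C + 1)) by rewrite divr_gt0//; lra.
have e2 : 0 < e / 2 by rewrite divr_gt0.
have [s [xs ys]] := xy _ d0; have [s' [xs' ys']] := xy' _ e2.
have hC t : t < e / (2 * (C + 1)) -> 0 <= t -> C * t < e / 2.
  rewrite !ltr_pdivlMr//; last lra.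
  nra.
exists (comb_scale a s ++ s'); rewrite !comb_cat !comb_scaleE.
split; rewrite opprD addrACA -scalerBr (le_lt_trans (ler_rnormD _ _))//.
  by rewrite rnormZ (splitr e) ltrD// hC// rnorm_ge0.
by rewrite rnormZ (splitr e) ltrD// hC// rnorm_ge0.
Qed.

Let G_norm x y : G x y -> rnorm x = rnorm y.
Proof.
move=> xy; apply/eqP; rewrite -subr_eq0 -normr_eq0 eq_le normr_ge0 andbT.
apply/ler_addgt0Pr => e e0; rewrite add0r.
have e2 : 0 < e / 2 by rewrite divr_gt0.
have [s [xs ys]] := xy _ e2.
have := ler_dist_rnorm x (comb u s); have := ler_dist_rnorm y (comb v s).
rewrite uv; move: xs ys; move: (rnorm (x - _)) (rnorm (y - _)) (rnorm x) (rnorm y).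
move: (rnorm (comb v s)) => a b c d f; rewrite !ler_norml => ? ? /andP[? ?] /andP[? ?]; lra.
Qed.

Let G_fun x y y' : G x y -> G x y' -> y = y'.
Proof.
move=> xy xy'; have := GP (-1) xy xy'; rewrite scaleN1r addNr => /G_norm.
rewrite rnorm0 => /esym/rnorm_eq0; rewrite scaleN1r addrC => /eqP.
by rewrite subr_eq0 => /eqP.
Qed.

Let G_total : total_family u -> forall x, exists y, G x y.
Proof.
move=> tu x; have /choice[s sP] n := tu x _ (half_pow_gt0 n).
have [|y yP] := @approx_cvg Y (fun n => comb v (s n)) 2.
  move=> n; rewrite -scaleN1r -comb_scaleE -comb_cat -uv comb_cat comb_scaleE scaleN1r.
  rewrite (le_trans (ler_rnormB _ x _))//.
  rewrite rnorm_distC; have := sP n; have := sP n.+1; rewrite exprS.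
  move: (half_pow_gt0 n) (rnorm _) (rnorm _) => + a b; move: (_ ^+ n) => c; lra.
exists y => e e0; have [N NP] := yP _ e0; have [m mP] := exists_half_lt e0.
exists (s (maxn N m)); split; last exact/NP/leq_maxl.
apply: (lt_trans (sP _)); apply: le_lt_trans mP.
by apply: ler_wiXn2l; rewrite ?leq_maxr//; lra.
Qed.

Let G_uv t : G (u t) (v t).
Proof. by move=> e e0; exists [:: (1, t)]; rewrite !comb_seq1 !scale1r !subrr !rnorm0. Qed.

Lemma isometry_extension : total_family u ->
  exists F : {linear X -> Y}, [/\ forall x, rnorm (F x) = rnorm x,
    forall t, F (u t) = v t &
    forall y, (forall e, 0 < e -> exists s, rnorm (y - comb v s) < e) ->
      exists x, F x = y].
Proof.
move=> tu; have /choice[f fP] := G_total tu.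
have fl : linear f by move=> a x y; apply: G_fun (fP _) _; exact: GP.
have iF x : rnorm (linear_of fl x) = rnorm x by apply/esym/G_norm/fP.
have Fu t : linear_of fl (u t) = v t by apply: G_fun (fP _) _; exact: G_uv.
exists (linear_of fl); split => // y hy.
apply: isometry_closed_range => // e /hy[s sP]; exists (comb u s).
rewrite linear_comb; congr (rnorm (y - _) < e): sP.
by apply: eq_bigr => t _; rewrite /= -Fu.
Qed.

End extension.

End linear_toolkit.

(** * Cardinals *)

Section cardinals.
Local Open Scope card_scope.

(** Choosing a related point for each element of A gives an injection, since no point is related to
    two elements. *)
Lemma rel_card_le (T U : Type) (A : set T) (B : set U) (r : T -> U -> Prop) :
  (forall a, A a -> exists2 b, B b & r a b) ->
  (forall a a' b, A a -> A a' -> r a b -> r a' b -> a = a') -> A #<= B.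
Proof.
move=> rAB rI; have [->|/set0P[a0 Aa0]] := eqVneq A set0; first exact: card_ge0.
have [b0 _ _] := rAB _ Aa0.
have /choice[f fP] a : exists b, A a -> B b /\ r a b.
  by have [/rAB[b Bb rab]|nA] := pselect (A a); [exists b | exists b0].
have /injfunPex[g] : exists2 f, set_fun A B f & {in A &, injective f}.
  exists f; first by move=> a /fP[].
  move=> a a'; rewrite !inE => Aa Aa' fE.
  by apply: (rI _ _ (f a)) => //; [exact: (fP a Aa).2 | rewrite fE; exact: (fP a' Aa').2].
exact: inj_card_le.
Qed.

Lemma card_le_fun (T U : Type) (A : set T) (B : set U) : A #<= B -> A !=set0 ->
  exists2 f : T -> U, (forall a, A a -> B (f a)) &
    (forall a a', A a -> A a' -> f a = f a' -> a = a').
Proof.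
elim/Ppointed: U => U in B *; first by rewrite emptyE => /eqP -> [].
move=> /pcard_leP[f] _; exists f; first exact: funS.
move=> a a' Aa Aa' fE; apply: (@inj _ _ A f) => //; rewrite inE//.
Qed.

(* Honig's argument: a maximal set of choice functions all of whose evaluations
   are injective has a surjective evaluation. *)
Lemma exists_min_card (T : Type) (F : set (set T)) : F !=set0 ->
  exists2 A, F A & forall B, F B -> A #<= B.
Proof.
move=> F0.
pose P (S : set (set T -> T)) :=
  (forall f A, S f -> F A -> A (f A)) /\
  (forall f g A, S f -> S g -> F A -> f A = g A -> f = g).
have [|S [[SF SI] Smax]] := @Zorn_bigcup _ P.
  move=> C CP Ctot; split=> [f A [S CS Sf]|f g A [S CS Sf] [S' CS' S'g]].
    exact: (CP _ CS).1.
  have [SS'|S'S] := Ctot _ _ CS CS'; first exact: (CP _ CS').2 (SS' _ Sf) S'g.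
  exact: (CP _ CS).2 Sf (S'S _ S'g).
have [[A [FA Asurj]]|nsurj] :=
    pselect (exists A, F A /\ forall a, A a -> exists2 f, S f & f A = a).
  exists A => // B FB.
  (* Surjectivity of the evaluation at A makes f A |-> f B defined on all of A. *)
  apply: (@rel_card_le _ _ _ _ (fun a b => exists2 f, S f & f A = a /\ f B = b)).
    by move=> a /Asurj[f Sf fA]; exists (f B); [exact: SF Sf FB | exists f].
  move=> a a' b _ _ [f Sf [<- fB]] [g Sg [<- gB]].
  by rewrite (SI f g B Sf Sg FB) // fB gB.
have miss A : F A -> exists2 a, A a & forall f, S f -> f A <> a.
  move=> FA; apply: contrapT => h; apply: nsurj; exists A; split => // a Aa.
  apply: contrapT => h'; apply: h; exists a => // f Sf fa; apply: h'.
  by exists f.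
have [A0 FA0] := F0; have [t0 _ _] := miss _ FA0.
(* Without a surjective evaluation, picking a missed value in each A yields a choice function that
   could be added to S. *)
have /choice[g gP] A : exists a, F A -> A a /\ forall f, S f -> f A <> a.
  by have [/miss[a ? ?]|nFA] := pselect (F A); [exists a | exists t0].
exfalso; apply: (Smax (S `|` [set g])).
  split; first by move=> f; left.
  move=> h; have Sg : S g by apply: h; right.
  exact: (gP _ FA0).2 Sg erefl.
split=> [f A [Sf|->] FA|f f' A [Sf|->] [Sf'|->] FA].
- exact: SF Sf FA.
- exact: (gP _ FA).1.
- exact: SI Sf Sf' FA.
- by move=> e; case: ((gP _ FA).2 _ Sf).
- by move=> /esym e; case: ((gP _ FA).2 _ Sf').
- by [].
Qed.

Lemma card_le_total (T : Type) (A B : set T) : A #<= B \/ B #<= A.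
Proof.
have [|C [->|->] CAB] := @exists_min_card _ [set A; B]; first by exists A; left.
  by left; apply: CAB; right.
by right; apply: CAB; left.
Qed.

(* Zorn's lemma is applied to partial injections C * C -> C with C containing a
   countable set; C is recovered from the graph as the set of the x such that
   (x, x) is in its domain. *)
Lemma infinite_pairing (T : Type) (e : nat -> T) : injective e ->
  exists g : T -> T -> T, forall x y x' y', g x y = g x' y' -> x = x' /\ y = y'.
Proof.
move=> eI.
pose dom (G : set (T * T * T)) x := exists b, G (x, x, b).
pose Q (G : set (T * T * T)) := [/\ forall p b b', G (p, b) -> G (p, b') -> b = b',
  forall p p' b, G (p, b) -> G (p', b) -> p = p',
  forall x y b, G (x, y, b) -> [/\ dom G x, dom G y & dom G b] &
  forall x y, dom G x -> dom G y -> exists b, G (x, y, b)].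
(* The pairing of nat, transported along e; it keeps C infinite. *)
pose G0 : set (T * T * T) :=
  [set z | exists i j, z = (e i, e j, e (pickle (i, j)))].
have G0P i j : G0 (e i, e j, e (pickle (i, j))) by exists i, j.
have G0dom i : dom G0 (e i) by exists (e (pickle (i, i))); exact: G0P.
have QG0 : Q G0.
  split.
  - by move=> p b b' [i [j [-> ->]]] [i' [j' [/eI -> /eI -> ->]]].
  - move=> p p' b [i [j [-> ->]]] [i' [j' [-> /eI/(pcan_inj (@pickleK _))]]].
    by case=> -> ->.
  - by move=> x y b [i [j [-> -> ->]]].
  - move=> x y [_ [i [_ [-> _ _]]]] [_ [j [_ [-> _ _]]]].
    by exists (e (pickle (i, j))).
(* G0 is added inside the predicate because the union of the empty chain is empty. *)
have [|G [QG Gmax]] := @Zorn_bigcup _ (fun G => Q (G `|` G0)).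
  move=> F FQ Ftot; set V := _ `|` G0.
  have V2 z z' : V z -> V z' ->
      exists W, [/\ W `<=` V, Q W, W z & W z'].
    have XV X : F X -> X `|` G0 `<=` V.
      by move=> FX w [Xw|]; [left; exists X | right].
    move=> [[X FX Xz]|G0z] [[X' FX' X'z']|G0z'].
    - have [XX'|X'X] := Ftot _ _ FX FX'.
        exists (X' `|` G0); split; [exact: XV | exact: FQ | by left; exact: XX' | by left].
      exists (X `|` G0); split; [exact: XV | exact: FQ | by left | by left; exact: X'X].
    - exists (X `|` G0); split; [exact: XV | exact: FQ | by left | by right].
    - exists (X' `|` G0); split; [exact: XV | exact: FQ | by right | by left].
    - by exists G0; split => // w; right.
  have domV W x : W `<=` V -> dom W x -> dom V x by move=> WV [b /WV]; exists b.
  split.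
  - by move=> p b b' h /(V2 _ _ h)[W [_ [q1 _ _ _]]]; exact: q1.
  - by move=> p p' b h /(V2 _ _ h)[W [_ [_ q2 _ _]]]; exact: q2.
  - move=> x y b h; have [W [WV [_ _ q3 _] /q3[? ? ?] _]] := V2 _ _ h h.
    by split; apply: domV WV _.
  - move=> x y [b h] [b' h']; have [W [WV [_ _ _ q4] Wx Wy]] := V2 _ _ h h'.
    by have [||c /WV ?] := q4 x y; [exists b | exists b' | exists c].
set G1 := G `|` G0 in QG; pose C := dom G1.
have [q1 q2 q3 q4] := QG.
have Ce i : C (e i) by have [b ?] := G0dom i; exists b; right.
have /choice[g' g'P] p : exists b, C p.1 -> C p.2 -> G1 (p, b).
  have [[Cx Cy]|nC] := pselect (C p.1 /\ C p.2).
    by have [b Gb] := q4 _ _ Cx Cy; exists b; case: p Gb {Cx Cy}.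
  by exists (e 0%N) => Cx Cy; case: nC.
pose g x y := g' (x, y).
have gP x y : C x -> C y -> G1 (x, y, g x y) by move=> Cx Cy; exact: (g'P (x, y)).
have gC x y : C x -> C y -> C (g x y).
  by move=> Cx Cy; have [] := q3 _ _ _ (gP _ _ Cx Cy).
have gI x y x' y' : C x -> C y -> C x' -> C y' -> g x y = g x' y' -> x = x' /\ y = y'.
  move=> Cx Cy Cx' Cy' ge; have := gP _ _ Cx Cy; rewrite ge.
  by move=> /q2 /(_ (gP _ _ Cx' Cy')) [-> ->].
have tagI x y i j : C x -> C y -> g (e i) x = g (e j) y -> i = j /\ x = y.
  by move=> Cx Cy /gI[]// /eI.
have Cne : C !=set0 by exists (e 0%N).
(* If the complement of C is no larger than C, the two tags [e 0] and [e 1] code T into C, and g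
   pairs the codes. Otherwise f maps C injectively outside C, and G1 extends to the union of C and f
   C, against maximality. *)
have [/card_le_fun/(_ Cne)[f fC fI]|] := card_le_total C (~` C); last first.
  move=> cC.
  have [f fC fI] : exists2 f : T -> T, (forall a, ~ C a -> C (f a)) &
      (forall a a', ~ C a -> ~ C a' -> f a = f a' -> a = a').
    have [nC0|] := eqVneq (~` C) set0.
      by exists id => a; [|move=> a']; rewrite -[~ C a]/((~` C) a) nC0.
    by move=> /set0P/(card_le_fun cC).
  pose code x := if `[< C x >] then g (e 0%N) x else g (e 1%N) (f x).
  have codeC x : C (code x).
    by rewrite /code; case: asboolP => Cx; apply: gC => //; exact: fC.
  have codeI : injective code.
    move=> x y; rewrite /code; case: asboolP => Cx; case: asboolP => Cy.
    - by move=> /tagI[].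
    - by move=> /tagI[]//; exact: fC.
    - by move=> /tagI[]//; exact: fC.
    - by move=> /tagI[| |_ /fI]//; [exact: fC..|apply].
  exists (fun x y => g (code x) (code y)) => x y x' y' /gI[]//.
  by move=> /codeI -> /codeI ->.
pose D x := C x \/ exists2 c, C c & x = f c.
have fD c c' : C c -> C c' -> f c = c' -> False by move=> Cc Cc' fcc; apply: (fC c); rewrite ?fcc.
have codeP x : exists y, D x -> C y /\ ((C x /\ y = g (e 0%N) x) \/
    (exists2 c, C c & x = f c /\ y = g (e 1%N) c)).
  have [[Cx|[c Cc ->]]|nD] := pselect (D x); last by exists x.
    by exists (g (e 0%N) x) => _; split; [exact: gC | left].
  by exists (g (e 1%N) c) => _; split; [exact: gC | right; exists c].
have /choice[code {}codeP] := codeP.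
have codeC x : D x -> C (code x) by move=> /codeP[].
have codeI x y : D x -> D y -> code x = code y -> x = y.
  move=> /codeP[_ +] /codeP[_ +].
  move=> [[Cx ->]|[c Cc [-> ->]]] [[Cy ->]|[d Cd [-> ->]]] /tagI[]// _ ->//.
(* New pairs take their values in f C, which is disjoint from C, so they collide with no old
   value. *)
pose H : set (T * T * T) := G1 `|`
  [set z | [/\ D z.1.1, D z.1.2, ~ (C z.1.1 /\ C z.1.2) & z.2 = f (g (code z.1.1) (code z.1.2))]].
have G1C x y b : G1 (x, y, b) -> [/\ C x, C y & C b] by move=> /q3.
have DH x : D x -> dom H x.
  move=> [Cx|[c Cc ->]]; first by exists (g x x); left; exact: gP.
  have Dfc : D (f c) by right; exists c.
  exists (f (g (code (f c)) (code (f c)))); right; split => //=.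
  by move=> [Cfc _]; exact: fD Cc Cfc erefl.
have HD x : dom H x -> D x by move=> [b [/G1C[Cx _ _]|[]//]]; left.
have e1 : ~ C (f (e 0%N)) by exact: fC.
have HG0 : H `|` G0 = H.
  by apply/seteqP; split=> [z [//|]|z]; [left; right | left].
have De0 : D (f (e 0%N)) by right; exists (e 0%N).
exfalso; apply: (Gmax H); last rewrite HG0; split.
- by move=> z Gz; left; left.
- move=> HG; have [b /HG Gb] := DH _ De0.
  by apply: e1; exists b; left.
- move=> [x y] b b' [Gb|/= [Dx Dy nC ->]] [Gb'|/= [_ _ nC' ->]] //.
  + exact: q1 Gb Gb'.
  + by case: nC'; have [] := G1C _ _ _ Gb.
  + by case: nC; have [] := G1C _ _ _ Gb'.
- move=> [x y] [x' y'] b [Gb|/= [Dx Dy nC ->]] [Gb'|/= [Dx' Dy' nC' fE]].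
  + exact: q2 Gb Gb'.
  + by have [_ _] := G1C _ _ _ Gb; rewrite fE; case/(fC _ (gC _ _ (codeC _ Dx') (codeC _ Dy'))).
  + by have [_ _] := G1C _ _ _ Gb'; case/(fC _ (gC _ _ (codeC _ Dx) (codeC _ Dy))).
  + have := fI _ _ (gC _ _ (codeC _ Dx) (codeC _ Dy)) (gC _ _ (codeC _ Dx') (codeC _ Dy')) fE.
    move=> /(gI _ _ _ _ (codeC _ Dx) (codeC _ Dy) (codeC _ Dx') (codeC _ Dy'))[].
    by move=> /(codeI _ _ Dx Dx') -> /(codeI _ _ Dy Dy') ->.
- move=> x y b [Gb|/= [Dx Dy nC ->]].
    by have [? ? ?] := G1C _ _ _ Gb; split; apply: DH; left.
  split; [exact: DH..|]; apply: DH; right.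
  by exists (g (code x) (code y)) => //; apply: gC; exact: codeC.
- move=> x y /HD Dx /HD Dy; have [[Cx Cy]|nC] := pselect (C x /\ C y).
    by exists (g x y); left; exact: gP.
  by exists (f (g (code x) (code y))); right.
Qed.

Lemma infinite_seq_inj (T : Type) (e : nat -> T) : injective e ->
  exists f : seq T -> T, injective f.
Proof.
move=> eI; have [g gI] := infinite_pairing eI.
(* Folding is injective only among sequences of equal length, so the length is paired with the
   result. *)
pose h := fun s => foldr g (e 0%N) s.
have hI s s' : size s = size s' -> h s = h s' -> s = s'.
  elim: s s' => [|x s IHs] [|x' s']//= [ss] /gI[-> /IHs ->//].
exists (fun s => g (e (size s)) (h s)) => s s' /gI[/eI ss].
exact: hI.
Qed.

End cardinals.

(** * Inner products *)

Section inner_products.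
Context {R : realType} {k : scalar_kind}.
Notation K := (scalar_field R k).

(** Relative to a predicate, so that the law can be asserted of the kernel of a projection inside
    the ambient space. *)
Definition parallelogram (V : normedModType K) (S : V -> Prop) :=
  forall x y, S x -> S y ->
    rnorm (x + y) ^+ 2 + rnorm (x - y) ^+ 2 = 2 * (rnorm x ^+ 2 + rnorm y ^+ 2).

Definition inner_product (V : normedModType K) (dot : V -> V -> K) :=
  [/\ forall a x y z, dot (a *: x + y) z = a * dot x z + dot y z,
      forall x y, dot y x = conj_scalar (dot x y) &
      forall x, `|x| ^+ 2 = dot x x].

Lemma of_realN (r : R) : of_real (- r) = - of_real r :> K.
Proof. by apply/eqP; rewrite -addr_eq0 -of_realD addNr of_real0. Qed.

Lemma of_realB (r s : R) : of_real (r - s) = of_real r - of_real s :> K.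
Proof. by rewrite of_realD of_realN. Qed.

Lemma of_real_inj : injective (of_real : R -> K).
Proof. exact: can_inj (of_realK _). Qed.

Lemma of_real_sqr (r : R) : of_real (r ^+ 2) = of_real r ^+ 2 :> K.
Proof. by rewrite !expr2 of_realM. Qed.

Lemma of_real_sqr_rnorm (V : normedModType K) (x : V) :
  of_real (rnorm x ^+ 2) = `|x| ^+ 2 :> K.
Proof. by rewrite of_real_sqr of_real_rnorm. Qed.

Lemma conj_scalarD : {morph (@conj_scalar R k) : a b / a + b}.
Proof. by rewrite /conj_scalar /scalar_field; case: (k) => // a b; rewrite rmorphD. Qed.

Lemma conj_scalarM : {morph (@conj_scalar R k) : a b / a * b}.
Proof. by rewrite /conj_scalar /scalar_field; case: (k) => // a b; rewrite rmorphM. Qed.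

Lemma conj_scalar_real (r : R) : conj_scalar (of_real r) = of_real r :> K.
Proof.
by rewrite /conj_scalar /of_real /scalar_field; case: (k) => //=; rewrite oppr0.
Qed.

Lemma conj_scalarN (a : K) : conj_scalar (- a) = - conj_scalar a.
Proof.
apply/eqP; rewrite -addr_eq0 -conj_scalarD addNr -(of_real0 R k).
by rewrite conj_scalar_real.
Qed.

Lemma mul_conj_scalar (a : K) : a * conj_scalar a = `|a| ^+ 2.
Proof.
rewrite /conj_scalar /scalar_field; move: a; case: (k) => a /=.
  by rewrite real_normK ?num_real.
by rewrite -normCK; congr (_ * _).
Qed.

Section inner_product_theory.
Variables (V : normedModType K) (dot : V -> V -> K).
Hypothesis dotP : inner_product dot.

Lemma inner_linl a x y z : dot (a *: x + y) z = a * dot x z + dot y z.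
Proof. by case: dotP. Qed.

Lemma innerC x y : dot y x = conj_scalar (dot x y).
Proof. by case: dotP. Qed.

Lemma sqr_norm_inner x : `|x| ^+ 2 = dot x x.
Proof. by case: dotP. Qed.

Lemma inner_linr a x y z : dot x (a *: y + z) = conj_scalar a * dot x y + dot x z.
Proof. by rewrite innerC inner_linl conj_scalarD conj_scalarM -!innerC. Qed.

Lemma inner0l y : dot 0 y = 0.
Proof.
have := inner_linl 1 0 0 y; rewrite scale1r addr0 mul1r => /esym/eqP.
by rewrite -subr_eq0 addrK => /eqP.
Qed.

Lemma inner0r y : dot y 0 = 0.
Proof. by rewrite innerC inner0l -(of_real0 R k) conj_scalar_real. Qed.

Lemma sqr_rnorm_sub_proj (z b : V) : dot b b = 1 ->
  rnorm (z - dot z b *: b) ^+ 2 = rnorm z ^+ 2 - re_part `|dot z b| ^+ 2.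
Proof.
move=> b1; set t := dot z b.
have bz : dot b z = conj_scalar t by rewrite innerC.
apply: of_real_inj.
rewrite of_realB (of_real_sqr (re_part _)) re_partK//.
rewrite !of_real_sqr_rnorm !sqr_norm_inner addrC -scaleNr !inner_linl !inner_linr.
rewrite b1 bz -/t conj_scalarN mulr1 addNr mulr0 add0r -mul_conj_scalar.
by rewrite addrC mulNr [conj_scalar t * t]mulrC.
Qed.

End inner_product_theory.

(** The norm of a combination depends only on the Gram matrix of the family. *)
Lemma eq_inner_comb (V W : normedModType K) (dot : V -> V -> K)
    (dot' : W -> W -> K) (T : Type) (u : T -> V) (v : T -> W) :
  inner_product dot -> inner_product dot' ->
  (forall t t', dot (u t) (u t') = dot' (v t) (v t')) ->
  forall s, rnorm (comb u s) = rnorm (comb v s).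
Proof.
move=> dP dP' uv s.
have h1 t s' : dot (u t) (comb u s') = dot' (v t) (comb v s').
  elim: s' => [|q s' IH]; first by rewrite /comb !big_nil (inner0r dP) (inner0r dP').
  rewrite /comb !big_cons (inner_linr dP) (inner_linr dP') uv.
  by congr (_ + _); exact: IH.
have h2 s1 s' : dot (comb u s1) (comb u s') = dot' (comb v s1) (comb v s').
  elim: s1 => [|q s1 IH]; first by rewrite /comb !big_nil (inner0l dP) (inner0l dP').
  rewrite [comb u _]big_cons [comb v _]big_cons (inner_linl dP) (inner_linl dP') h1.
  by congr (_ + _); exact: IH.
have : rnorm (comb u s) ^+ 2 = rnorm (comb v s) ^+ 2.
  apply: of_real_inj.
  by rewrite !of_real_sqr_rnorm (sqr_norm_inner dP) (sqr_norm_inner dP') h2.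
by move=> /eqP; rewrite eqrXn2 ?rnorm_ge0// => /eqP.
Qed.

End inner_products.

(** * The Jordan-von Neumann theorem *)

Section real_inner_product.
Context {R : realType} {k : scalar_kind}.
Notation K := (scalar_field R k).
Variable V : normedModType K.
Hypothesis para : @parallelogram R k V (fun=> True).

(** Polarisation: the real part of the inner product to be constructed. *)
Definition real_dot (x y : V) : R := (rnorm (x + y) ^+ 2 - rnorm (x - y) ^+ 2) / 4.

Lemma real_dotC x y : real_dot x y = real_dot y x.
Proof. by rewrite /real_dot [x + y]addrC [rnorm (x - y)]rnorm_distC. Qed.

Lemma real_dotxx x : real_dot x x = rnorm x ^+ 2.
Proof.
have := para (x := x) (y := x) I I; rewrite /real_dot subrr rnorm0.
rewrite expr0n /=; lra.
Qed.

Lemma real_dotDl x x' y : real_dot (x + x') y = real_dot x y + real_dot x' y.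
Proof.
(* In h1 + h2 - h3 - h4 the mixed terms cancel by e1 and e2, while |x + x' + y|^2 and |x + x' - y|^2
   each occur twice. *)
have h1 := para (x := x + y) (y := x') I I.
have h2 := para (x := x' + y) (y := x) I I.
have h3 := para (x := x - y) (y := x') I I.
have h4 := para (x := x' - y) (y := x) I I.
have e1 : rnorm (x + y - x') = rnorm (x' - y - x).
  by rewrite -[LHS]rnormN !opprD !opprK; congr rnorm; rewrite addrC addrA addrAC.
have e2 : rnorm (x' + y - x) = rnorm (x - y - x').
  by rewrite -[LHS]rnormN !opprD !opprK; congr rnorm; rewrite addrC addrA addrAC.
have e3 : x + y + x' = x + x' + y by rewrite addrAC.
have e4 : x' + y + x = x + x' + y by rewrite addrAC [x' + x]addrC.
have e5 : x - y + x' = x + x' - y by rewrite addrAC.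
have e6 : x' - y + x = x + x' - y by rewrite addrAC [x' + x]addrC.
move: h1 h2 h3 h4; rewrite e1 e2 e3 e4 e5 e6 /real_dot; lra.
Qed.

Lemma real_dot_bound x y : `|real_dot x y| <= (rnorm x ^+ 2 + rnorm y ^+ 2) / 2.
Proof.
have := para (x := x) (y := y) I I; rewrite /real_dot.
have := sqr_ge0 (rnorm (x + y)); have := sqr_ge0 (rnorm (x - y)).
rewrite ler_norml => ? ? ?; apply/andP; split; lra.
Qed.

(* An additive map f on R, bounded on [0, 1] and with f 1 = 0, is periodic,
   hence bounded, hence zero. *)
Let additive_bounded_eq0 (f : R -> R) (M : R) :
  {morph f : r s / r + s} -> f 1 = 0 ->
  (forall r, 0 <= r <= 1 -> `|f r| <= M) -> forall r, f r = 0.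
Proof.
move=> fD f1 fM r.
have f0 : f 0 = 0 by have := fD 0 0; rewrite addr0; lra.
have fN s : f (- s) = - f s by have := fD s (- s); rewrite subrr f0; lra.
have fn s n : f (s *+ n) = f s *+ n.
  by elim: n => [|n IHn]; rewrite ?mulr0n// !mulrS fD IHn.
have fz (m : int) : f m%:~R = 0.
  by case: m => n; rewrite ?NegzE ?rmorphN/= ?fN fn f1 mul0rn ?oppr0.
have fB s : `|f s| <= M.
  have -> : f s = f (s - (Num.floor s)%:~R) by rewrite fD fN fz oppr0 addr0.
  apply: fM; rewrite subr_ge0 floor_le_tmp /= lerBlDl.
  by have := lt_succ_floor s; rewrite intrD => /ltW.
apply/eqP; apply: contraT => fr0.
have fr : 0 < `|f r| by rewrite normr_gt0.
have M0 : 0 <= M by apply: le_trans (fB 0).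
pose n := (Num.truncn (M / `|f r|)).+1.
have := fB (r *+ n); rewrite fn normrMn -mulr_natl leNgt => /negP[].
by rewrite -ltr_pdivrMr// truncnS_gt.
Qed.

Lemma real_dotZl (r : R) x y : real_dot (of_real r *: x) y = r * real_dot x y.
Proof.
apply/eqP; rewrite -subr_eq0; apply/eqP.
(* The defect r |-> <r x, y> - r <x, y> is additive and vanishes at 1. M bounds it on [0, 1], where
   |r x| <= |x|. *)
pose M := (rnorm x ^+ 2 + rnorm y ^+ 2) / 2 + `|real_dot x y|.
apply: (@additive_bounded_eq0 (fun r => real_dot (of_real r *: x) y - r * real_dot x y) M).
- by move=> s t; rewrite of_realD scalerDl real_dotDl; ring.
- by rewrite of_real1 scale1r mul1r subrr.
move=> s /andP[s0 s1]; rewrite (le_trans (ler_normB _ _))// lerD//.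
  rewrite (le_trans (real_dot_bound _ _))// ler_wpM2r// lerD2r.
  rewrite rnormZ re_norm_of_real ger0_norm// exprMn ler_piMl ?sqr_ge0//.
  by rewrite expr_le1.
by rewrite normrM ger0_norm// ler_piMl.
Qed.

Lemma real_dot_unit (a : K) x y : re_part `|a| = 1 :> R ->
  real_dot (a *: x) (a *: y) = real_dot x y.
Proof. by move=> a1; rewrite /real_dot -scalerDr -scalerBr !rnormZ a1 !mul1r. Qed.

End real_inner_product.

Lemma jordan_von_neumann (R : realType) (k : scalar_kind)
    (V : normedModType (scalar_field R k)) :
  @parallelogram R k V (fun=> True) -> exists dot, @inner_product R k V dot.
Proof.
case: k V => V para.
  exists (@real_dot R RealScalars V); split.
  - by move=> a x y z; rewrite (real_dotDl para) (real_dotZl para a).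
  - by move=> x y; rewrite real_dotC.
  - by move=> x; rewrite (real_dotxx para) -of_real_sqr_rnorm.
pose i : scalar_field R ComplexScalars := Complex 0 1.
have i2 : i * i = -1 by apply/eqP; rewrite eq_complex /=; apply/andP; split; apply/eqP; ring.
have i1 : re_part `|i| = 1 :> R.
  by rewrite [`|i|]normc_def /= expr0n add0r expr1n sqrtr1.
pose r := @real_dot R ComplexScalars V.
have rN x y : r (- x) y = - r x y.
  by rewrite /r -scaleN1r -(of_real1 R ComplexScalars) -of_realN (real_dotZl para) mulN1r.
have ri x y : r (i *: x) y = - r x (i *: y).
  by rewrite /r -(real_dot_unit _ _ i1) scalerA i2 scaleN1r; exact: rN.
(* Conjugate-linearity in y forces the imaginary part of <x, y> to be the real part of <x, i y>. *)
pose dot x y : scalar_field R ComplexScalars := of_real (r x y) + i * of_real (r x (i *: y)).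
have dotD x y z : dot (x + y) z = dot x z + dot y z.
  by rewrite /dot /r !(real_dotDl para) !of_realD mulrDr addrACA.
have dotR s x z : dot (of_real s *: x) z = of_real s * dot x z.
  rewrite /dot /r !(real_dotZl para) !of_realM mulrDr; congr (_ + _); exact: mulrCA.
have doti x z : dot (i *: x) z = i * dot x z.
  rewrite /dot ri mulrDr mulrA i2 mulN1r of_realN [RHS]addrC.
  by rewrite [r (i *: x) _](real_dot_unit _ _ i1).
have dot_conj x y : dot y x = conj_scalar (dot x y).
  rewrite /dot conj_scalarD conj_scalarM !conj_scalar_real; congr (_ + _).
    by rewrite /r real_dotC.
  have -> : conj_scalar i = - i by apply/eqP; rewrite eq_complex /= oppr0 !eqxx.
  by rewrite mulNr -mulrN -of_realN -ri /r real_dotC.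
exists dot; split => //.
  move=> a x y z; rewrite dotD; congr (_ + _).
  have -> : a = of_real (complex.Re a) + i * of_real (complex.Im a).
    by case: a => a b; apply/eqP; rewrite eq_complex /=; apply/andP; split; apply/eqP; ring.
  by rewrite scalerDl dotD -scalerA doti !dotR mulrDl mulrA.
move=> x; rewrite /dot -of_real_sqr_rnorm -(real_dotxx para).
suff -> : r x (i *: x) = 0 by rewrite of_real0 mulr0 addr0.
by have := ri x x; rewrite /r real_dotC; lra.
Qed.

Section hilbert.
Context {R : realType} {k : scalar_kind}.
Notation K := (scalar_field R k).

Lemma parallelogram_is_hilbert (H : completeNormedModType K) :
  @parallelogram R k H (fun=> True) -> is_hilbert H.
Proof.
move=> /jordan_von_neumann[dot dotP].
have c1 : conj_scalar (-1 : K) = -1.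
  by rewrite conj_scalarN -(of_real1 R k) conj_scalar_real.
have hl u : zmod_morphism (dot^~ u).
  by move=> x y /=; rewrite addrC -scaleN1r (inner_linl dotP) mulN1r addrC.
have hr u : zmod_morphism (dot u).
  by move=> x y /=; rewrite addrC -scaleN1r (inner_linr dotP) c1 mulN1r addrC.
have sl u : scalable_for *%R (dot^~ u).
  by move=> a x /=; rewrite -[a *: x]addr0 (inner_linl dotP) (inner0l dotP) addr0.
have sr u : scalable_for (@conj_scalar R k \; *%R) (dot u).
  by move=> a x /=; rewrite -[a *: x]addr0 (inner_linr dotP) (inner0r dotP) addr0.
pose bil := isBilinear.Build K H H K *%R (@conj_scalar R k \; *%R) dot hl hr sl sr.
have herm x y : dot x y = (-1) ^+ false * conj_scalar (dot y x).
  by rewrite expr0 mul1r (innerC dotP).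
have pos u : u != 0 -> 0 < dot u u.
  by move=> u0; rewrite -(sqr_norm_inner dotP) exprn_gt0 ?normr_gt0.
pose D : {dot H for @conj_scalar R k} := HB.pack dot bil
  (isHermitianSesquilinear.Build K H false (@conj_scalar R k) dot herm)
  (isDotProduct.Build K H dot pos).
by exists D => x; exact: sqr_norm_inner.
Qed.

Lemma is_hilbert_parallelogram (H : completeNormedModType K) :
  is_hilbert H -> @parallelogram R k H (fun=> True).
Proof.
move=> [dot dN] x y _ _; apply: (@of_real_inj R k).
rewrite of_realM !of_realD !of_real_sqr_rnorm !dN.
have hB u v w : dot (u - v) w = dot u w - dot v w.
  have h := @zmod_morphisml_subproof _ _ _ _ _ _ dot w.
  exact: (h u v).
have hD u v w : dot (u + v) w = dot u w + dot v w.
  have h0 : dot 0 w = 0 by rewrite -(subrr 0) hB subrr.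
  by rewrite -[v in LHS]opprK hB -(sub0r v) hB h0 sub0r opprK.
rewrite hD hB !(raddfB (dot _)) !(raddfD (dot _)) /=.
by rewrite of_real1; ring.
Qed.

Definition orthonormal_family (V : normedModType K) (dot : V -> V -> K)
    (T : Type) (u : T -> V) :=
  forall t t', dot (u t) (u t') = if `[< t = t' >] then 1 else 0.

End hilbert.

(** * Orthonormal bases *)

Section orthonormal_bases.
Context {R : realType} {k : scalar_kind}.
Notation K := (scalar_field R k).

Section existence.
Variables (V : completeNormedModType K) (dot : V -> V -> K).
Hypotheses (dotP : inner_product dot) (para : @parallelogram R k V (fun=> True)).

(** z is the difference between x and its closest point p in the closed span of u; p is the limit of
    a minimising sequence of combinations. *)
Let projection (T : Type) (u : T -> V) (x : V) :
  ~ (forall e, 0 < e -> exists s, rnorm (x - comb u s) < e) ->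
  (forall t, dot (u t) (u t) = 1) ->
  exists2 z, z != 0 & forall t, dot z (u t) = 0.
Proof.
move=> xN u1.
pose A := range (fun s => rnorm (x - comb u s)).
have A0 : has_inf A.
  split; first by exists (rnorm (x - comb u [::])), [::].
  by exists 0 => _ [s _ <-]; exact: rnorm_ge0.
pose d := inf A.
have dA s : d <= rnorm (x - comb u s).
  by apply: ge_inf; [exact: A0.2 | exists s].
have d0 : 0 <= d.
  by apply: lb_le_inf A0.1 _ => _ [s _ <-]; exact: rnorm_ge0.
(* The excess over d^2 is the square of 2^-n, so that the parallelogram law bounds successive
   distances by 2 * 2^-n and the sequence converges. *)
have /choice[s sP] n : exists s, rnorm (x - comb u s) ^+ 2 <= d ^+ 2 + (2^-1 ^+ n) ^+ 2.
  have c0 : 0 < (2^-1 ^+ n : R) ^+ 2 by rewrite exprn_gt0// half_pow_gt0.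
  pose e := Num.sqrt (d ^+ 2 + (2^-1 ^+ n) ^+ 2).
  have e2 : e ^+ 2 = d ^+ 2 + (2^-1 ^+ n) ^+ 2.
    by rewrite sqr_sqrtr// addr_ge0 ?sqr_ge0.
  have de : d < e.
    by rewrite -(@ltr_pXn2r _ 2)// ?nnegrE ?sqrtr_ge0// e2 ltrDl.
  have ed0 : 0 < e - d by rewrite subr_gt0.
  have [_ [s _ <-]] := inf_adherent ed0 A0; rewrite -/d subrKC => h.
  by exists s; rewrite -e2 ler_pXn2r ?nnegrE ?rnorm_ge0 ?sqrtr_ge0// ltW.
pose m n := comb u (s n).
have m2 n : rnorm (m n.+1 - m n) <= 2 * 2^-1 ^+ n.
  have := para (x := x - m n) (y := x - m n.+1) I I.
  have -> : x - m n - (x - m n.+1) = m n.+1 - m n.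
    by rewrite opprD opprK addrACA subrr add0r addrC.
  (* The midpoint of [m n] and [m n.+1] is again a combination, hence at distance at least d from
     x. *)
  have h4 : (2 * d) ^+ 2 <= rnorm (x - m n + (x - m n.+1)) ^+ 2.
    rewrite ler_pXn2r ?nnegrE ?rnorm_ge0 ?mulr_ge0//.
    have h2 : re_part `|of_real 2 : K| = 2 :> R by rewrite re_norm_of_real ger0_norm.
    have -> : x - m n + (x - m n.+1) =
        (of_real 2 : K) *: (x - comb u (comb_scale (of_real 2^-1) (s n ++ s n.+1))).
      rewrite comb_scaleE comb_cat scalerBr scalerA -of_realM divff ?pnatr_eq0//.
      rewrite of_real1 scale1r (of_realD k 1 1) of_real1 scalerDl scale1r addrACA.
      by rewrite -opprD.
    by rewrite rnormZ h2 ler_pM2l// dA.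
  have := sP n; have := sP n.+1; rewrite -/(m n) -/(m n.+1) => h5 h6 h7.
  have c0 := half_pow_gt0 (R := R) n.
  have : rnorm (m n.+1 - m n) ^+ 2 <= (2 * 2^-1 ^+ n) ^+ 2.
    move: h4 h5 h6 h7; rewrite [2^-1 ^+ n.+1]exprS !exprMn.
    have := sqr_ge0 (2^-1 ^+ n : R).
    move: (d ^+ 2) ((2^-1 ^+ n) ^+ 2) (rnorm (m _ - _) ^+ 2) => a b c; lra.
  by rewrite ler_pXn2r// nnegrE ?rnorm_ge0// mulr_ge0// ltW.
have [p pP] := approx_cvg m2.
pose z := x - p.
have zd : rnorm z <= d.
  apply/ler_addgt0Pr => e e0.
  have e2 : 0 < e / 2 by rewrite divr_gt0.
  have [N NP] := pP _ e2; have [M MP] := exists_half_lt e2.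
  pose n := maxn N M; have := NP n (leq_maxl _ _); rewrite rnorm_distC => h1.
  have h2 : (2^-1 : R) ^+ n <= 2^-1 ^+ M.
    by apply: ler_wiXn2l; rewrite ?leq_maxr//; lra.
  have h3 : rnorm (x - m n) <= d + 2^-1 ^+ n.
    have c0 := half_pow_gt0 (R := R) n.
    rewrite -(@ler_pXn2r _ 2)// ?nnegrE ?rnorm_ge0 ?addr_ge0 ?(ltW c0)//.
    rewrite (le_trans (sP n))// sqrrD addrAC lerDl mulr2n addr_ge0// mulr_ge0// ltW//.
  by have := ler_rnormB x (m n) p; rewrite -/z; lra.
(* Adding a multiple of [u t] to p stays in the closed span. *)
have zb t : d <= rnorm (z - dot z (u t) *: u t).
  apply/ler_addgt0Pr => e e0; have [N NP] := pP _ e0.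
  have := dA (s N ++ [:: (dot z (u t), t)]).
  rewrite comb_cat comb_seq1 -/(m N); set c := _ *: _.
  have -> : x - (m N + c) = z - c + (p - m N).
    by rewrite /z [x - p - c]addrAC subrKA opprD addrA addrAC.
  move=> /le_trans; apply; rewrite (le_trans (ler_rnormD _ _))// lerD2l.
  exact/ltW/NP.
exists z; first apply/eqP => z0.
  apply: xN => e e0; have [N NP] := pP _ e0; exists (s N).
  by move/eqP: z0; rewrite subr_eq0 => /eqP ->; exact: NP.
(* Removing the component of z along [u t] lowers |z|^2 by |<z, u t>|^2, but not below d^2 >=
   |z|^2. *)
move=> t; apply: (@re_norm_eq0 R k); apply/eqP.
rewrite -[_ == _]orbb -mulf_eq0 -expr2 eq_le sqr_ge0 andbT.
have := zb t; rewrite -(@ler_pXn2r _ 2) ?nnegrE ?rnorm_ge0//.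
rewrite (sqr_rnorm_sub_proj dotP)//.
have : rnorm z ^+ 2 <= d ^+ 2 by rewrite ler_pXn2r ?nnegrE ?rnorm_ge0.
lra.
Qed.

(** A maximal orthonormal set is total: otherwise the vector given by [projection], once normalised,
    could be added. *)
Lemma exists_orthonormal_basis : exists B : set V,
  orthonormal_family dot (fun b : set_type B => val b) /\
  total_family (fun b : set_type B => val b).
Proof.
pose P (B : set V) := forall b b', B b -> B b' -> dot b b' = if `[< b = b' >] then 1 else 0.
have [|B [PB Bmax]] := @Zorn_bigcup _ P.
  move=> F FP Ftot b b' [X FX Xb] [Y FY Yb'].
  have [XY|YX] := Ftot _ _ FX FY; first exact: (FP _ FY) (XY _ Xb) Yb'.
  exact: (FP _ FX) Xb (YX _ Yb').
have Bu (b : set_type B) : B (val b) by exact: set_mem (valP b).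
exists B; split.
  move=> b b'; rewrite (PB _ _ (Bu b) (Bu b')).
  by congr (if _ then _ else _); apply/asbool_equiv_eq; split=> [/val_inj|->].
move=> x; apply: contrapT => xN.
have [|b|z z0 zB] := projection (u := fun b : set_type B => val b) (x := x).
- by move=> h; apply: xN => e; exact: h.
- by rewrite (PB _ _ (Bu b) (Bu b)) asboolT.
have zB' b : B b -> dot z b = 0 by move=> Bb; exact: (zB (SigSub (mem_set Bb))).
have rz : rnorm z != 0 by apply: contra_neq z0 => /rnorm_eq0.
pose a : K := of_real (rnorm z)^-1; pose e := a *: z.
have eB b : B b -> dot e b = 0.
  by move=> Bb; rewrite /e -[_ *: z]addr0 (inner_linl dotP) zB'// (inner0l dotP) mulr0 addr0.
have Be b : B b -> dot b e = 0.
  by move=> Bb; rewrite (innerC dotP) eB// -(of_real0 R k) conj_scalar_real.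
have ee : dot e e = 1.
  rewrite -(sqr_norm_inner dotP) -of_real_sqr_rnorm rnormZ re_norm_of_real.
  rewrite ger0_norm ?invr_ge0 ?rnorm_ge0// mulVf// expr1n; exact: of_real1.
have nBe : ~ B e by move=> /eB/eqP; rewrite ee oner_eq0.
apply: (Bmax (B `|` [set e])).
  split; first by move=> b; left.
  by move=> h; apply: nBe; apply: h; right.
move=> b b' [Bb|->] [Bb'|->].
- exact: PB.
- by rewrite Be// asboolF// => be; apply: nBe; rewrite -be.
- by rewrite eB// asboolF// => be; apply: nBe; rewrite be.
- by rewrite ee asboolT.
Qed.

End existence.
End orthonormal_bases.

(** * Splittings *)

Section kernel_space.
Context {R : realType} {k : scalar_kind}.
Notation K := (scalar_field R k).
Variables (Z X : completeNormedModType K) (P : {linear Z -> X}).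
Hypothesis P_le : forall z, rnorm (P z) <= rnorm z.

Definition kernel_pred : {pred Z} := fun z => P z == 0.

Let kernel_submod_closed : submod_closed kernel_pred.
Proof.
split=> [|a x y]; rewrite !unfold_in /= ?linear0// => /eqP x0 /eqP y0.
by rewrite linearP /= x0 y0 scaler0 addr0.
Qed.

HB.instance Definition _ :=
  GRing.isSubmodClosed.Build K Z kernel_pred kernel_submod_closed.

(* The contraction hypothesis is a parameter of the type, so that the instance
   of completeness below can depend on it. *)
Record kernel_space (Ple : forall z, rnorm (P z) <= rnorm z) :=
  KernelSpace { kernel_val : Z ; _ : kernel_val \in kernel_pred }.

HB.instance Definition _ := [isSub of kernel_space P_le for @kernel_val P_le].
HB.instance Definition _ := [Choice of kernel_space P_le by <:].
HB.instance Definition _ := [SubChoice_isSubLmodule of kernel_space P_le by <:].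

Definition kernel_norm (x : kernel_space P_le) : R := rnorm (\val x).

Let kernel_normD x y : kernel_norm (x + y) <= kernel_norm x + kernel_norm y.
Proof. by rewrite /kernel_norm raddfD ler_rnormD. Qed.
Let kernel_normZ (a : K) x : kernel_norm (a *: x) = re_part `|a| * kernel_norm x.
Proof. by rewrite /kernel_norm linearZ rnormZ. Qed.
Let kernel_norm0 x : kernel_norm x = 0 -> x = 0.
Proof. by move=> /rnorm_eq0 x0; apply: val_inj; rewrite x0 raddf0. Qed.

HB.instance Definition _ := Lmodule_isNormed.Build K (kernel_space P_le)
  (of_real_normD kernel_normD) (of_real_normZ kernel_normZ)
  (of_real_norm0 kernel_norm0).

Lemma rnorm_kernel (x : kernel_space P_le) : rnorm x = rnorm (\val x).
Proof. exact: of_realK. Qed.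

Lemma rnorm_kernelD (x y : kernel_space P_le) : rnorm (x + y) = rnorm (\val x + \val y).
Proof. by rewrite rnorm_kernel raddfD. Qed.

Lemma rnorm_kernelB (x y : kernel_space P_le) : rnorm (x - y) = rnorm (\val x - \val y).
Proof. by rewrite rnorm_kernel raddfB. Qed.

Lemma kernel_val_linear (a : K) (x y : kernel_space P_le) :
  \val (a *: x + y) = a *: \val x + \val y.
Proof. by rewrite linearP. Qed.

Lemma kernel_valP (x : kernel_space P_le) : P (\val x) = 0.
Proof. by have /eqP := valP x. Qed.

Lemma kernel_lift (z : Z) : P z = 0 -> exists x : kernel_space P_le, \val x = z.
Proof. by move=> /eqP Pz; exists (@KernelSpace P_le z Pz). Qed.

Lemma kernel_complete (F : set_system (kernel_space P_le)) :
  ProperFilter F -> cauchy F -> cvg F.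
Proof.
move: F; apply: rapid_complete => u ru.
have [n|l lP] := @rapid_cvg _ _ Z (fun n => \val (u n)) 1.
  by rewrite mul1r -raddfB -rnorm_kernel; exact: ru.
have [|l' l'E] := @kernel_lift l.
  (* The contraction property keeps limits of kernel elements in the kernel. *)
  apply: (@rnorm_small_eq0 _ _ _ _ 2) => // e e0.
  have [n nP] := exists_half_lt e0.
  rewrite -[P l]subr0 -(kernel_valP (u n)) -raddfB (le_trans (P_le _))//.
  by rewrite (le_trans (lP n))// mulr1 ler_wpM2l// ltW.
exists l', 2 => n; rewrite rnorm_kernel raddfB /= l'E.
by have := lP n; rewrite mulr1.
Qed.

HB.instance Definition _ :=
  Uniform_isComplete.Build (kernel_space P_le) kernel_complete.

End kernel_space.

Section hilbert_splittings.
Context {R : realType} {k : scalar_kind}.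
Notation K := (scalar_field R k).

(* Z is the l2-sum of J X and of ker P, and ker P is a Hilbert space. *)
Definition hilbert_split (X Z : normedModType K)
    (J : {linear X -> Z}) (P : {linear Z -> X}) :=
  [/\ cancel J P,
      forall x h, P h = 0 -> rnorm (J x + h) ^+ 2 = rnorm x ^+ 2 + rnorm h ^+ 2 &
      @parallelogram R k Z (fun h => P h = 0)].

Section theory.
Variables (X Z : normedModType K) (J : {linear X -> Z}) (P : {linear Z -> X}).
Hypothesis JP : hilbert_split J P.

Lemma splitK : cancel J P. Proof. by case: JP. Qed.

Lemma split_ker z : P (z - J (P z)) = 0.
Proof. by rewrite linearB splitK subrr. Qed.

Lemma split_sqr_rnormD x h : P h = 0 ->
  rnorm (J x + h) ^+ 2 = rnorm x ^+ 2 + rnorm h ^+ 2.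
Proof. by case: JP => _ + _; exact. Qed.

Lemma split_sqr_rnorm z : rnorm z ^+ 2 = rnorm (P z) ^+ 2 + rnorm (z - J (P z)) ^+ 2.
Proof. by rewrite -split_sqr_rnormD ?split_ker// subrKC. Qed.

Lemma split_isometry x : rnorm (J x) = rnorm x.
Proof.
have := split_sqr_rnormD x (linear0 P); rewrite addr0 rnorm0 expr0n addr0.
by move=> /eqP; rewrite eqrXn2 ?rnorm_ge0// => /eqP.
Qed.

Lemma split_contraction z : rnorm (P z) <= rnorm z.
Proof.
rewrite -(@ler_pXn2r _ 2)// ?nnegrE ?rnorm_ge0// split_sqr_rnorm.
by rewrite lerDl sqr_ge0.
Qed.

End theory.

Lemma split_linearly_isometric (X Z : completeNormedModType K)
    (J : {linear X -> Z}) (P : {linear Z -> X}) (JP : hilbert_split J P) :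
  @parallelogram R k (kernel_space (split_contraction JP)) (fun=> True) /\
  linearly_isometric Z (l2_prod X (kernel_space (split_contraction JP))).
Proof.
split.
  move=> x y _ _; rewrite rnorm_kernelD rnorm_kernelB !rnorm_kernel.
  by have [_ _ para] := JP; apply: para; exact: kernel_valP.
apply: linearly_isometric_sym.
pose f (z : l2_prod X (kernel_space (split_contraction JP))) : Z := J z.1 + \val z.2.
have fl : linear f.
  move=> a x y; rewrite /f.
  have -> : \val (a *: x + y).2 = a *: \val x.2 + \val y.2 := kernel_val_linear a x.2 y.2.
  have -> : J (a *: x + y).1 = a *: J x.1 + J y.1 := linearP J a x.1 y.1.
  by rewrite scalerDr addrACA.
exists (linear_of fl); split.
  apply/isometryP => z; rewrite rnorm_l2_prod -(ger0_norm (rnorm_ge0 _)).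
  rewrite -sqrtr_sqr; congr Num.sqrt.
  by rewrite /= (split_sqr_rnormD JP) ?rnorm_kernel//; exact: kernel_valP.
move=> z; have [h hE] := kernel_lift (split_contraction JP) (split_ker JP z).
by exists (P z, h); rewrite /= /f /= hE subrKC.
Qed.

Lemma l2_prod_split (X H : completeNormedModType K) : is_hilbert H ->
  exists (J : {linear X -> l2_prod X H}) (P : {linear l2_prod X H -> X}),
    hilbert_split J P /\ forall x, J x = l2_inl H x.
Proof.
move=> /is_hilbert_parallelogram para.
have Jl : linear (fun x : X => l2_inl H x : l2_prod X H).
  move=> a x y; rewrite /l2_inl; congr pair.
  by rewrite /= addr0 scaler0.
have Pl : linear (fun z : l2_prod X H => z.1 : X) by [].
exists (linear_of Jl), (linear_of Pl); split => //; split => //.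
- move=> x h /= h0; rewrite !rnorm_l2_prod /= h0 rnorm0 expr0n add0r addr0 add0r.
  by rewrite !sqr_sqrtr ?addr_ge0 ?sqr_ge0.
- move=> h h' /= h0 h'0; rewrite !rnorm_l2_prod /= h0 h'0 subrr addr0 rnorm0 expr0n !add0r.
  by rewrite !sqr_sqrtr ?addr_ge0 ?sqr_ge0//; exact: para.
Qed.

(** The trivial splitting, with zero kernel, makes E itself an instance of the results on split
    spaces. *)
Lemma identity_split (X : normedModType K) :
  hilbert_split (idfun : {linear X -> X}) idfun.
Proof.
split=> // [x h /= ->|h h' /= -> ->]; first by rewrite addr0 rnorm0 expr0n addr0.
by rewrite subrr addr0 rnorm0 expr0n /=; lra.
Qed.

End hilbert_splittings.

(** * Ultralimits in finite dimension *)

Section ultralimits.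
Context {R : realType} {k : scalar_kind}.
Notation K := (scalar_field R k).

Definition ultra_cvg (I : Type) (U : set_system I) (V : normedModType K)
    (y : I -> V) (l : V) :=
  forall e : R, 0 < e -> \forall i \near U, rnorm (y i - l) < e.

Lemma real_ultra_limit (I : Type) (U : set_system I) (UF : UltraFilter U)
    (f : I -> R) (M : R) : (forall i, `|f i| <= M) ->
  exists l, forall e : R, 0 < e -> \forall i \near U, `|f i - l| < e.
Proof.
move=> fM; have /cvg_ex[l /cvgrPdist_lt lP] := ultra_limit_cvg UF (ex_intro _ M fM).
by exists l => e /lP; apply: filterS => i; rewrite distrC.
Qed.

Lemma re_norm_complex (z : scalar_field R ComplexScalars) :
  re_part `|z| = Num.sqrt (complex.Re z ^+ 2 + complex.Im z ^+ 2).
Proof. by rewrite [`|z|]normc_def. Qed.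

Lemma re_norm_complex_lt (z : scalar_field R ComplexScalars) (e : R) :
  `|complex.Re z| < e / 2 -> `|complex.Im z| < e / 2 -> re_part `|z| < e.
Proof.
rewrite re_norm_complex; move: (complex.Re z) (complex.Im z) => x y xe ye.
have e0 : 0 < e by have := normr_ge0 x; lra.
rewrite -(@ltr_pXn2r _ 2) ?nnegrE ?sqrtr_ge0 ?(ltW e0)// sqr_sqrtr; last first.
  by rewrite addr_ge0 ?sqr_ge0.
rewrite -[x ^+ 2]real_normK ?num_real// -[y ^+ 2]real_normK ?num_real//.
move: (normr_ge0 x) (normr_ge0 y) xe ye; move: `|x| `|y| => ? ?; nra.
Qed.

Lemma scalar_ultra_limit (I : Type) (U : set_system I) (UF : UltraFilter U)
    (a : I -> K) (M : R) : (forall i, re_part `|a i| <= M) ->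
  exists l, forall e : R, 0 < e -> \forall i \near U, re_part `|a i - l| < e.
Proof.
case: k a => a; first exact: real_ultra_limit.
move=> aM.
have ReM i : `|complex.Re (a i)| <= M.
  by apply: le_trans (aM i); rewrite re_norm_complex -sqrtr_sqr ler_wsqrtr// lerDl sqr_ge0.
have ImM i : `|complex.Im (a i)| <= M.
  by apply: le_trans (aM i); rewrite re_norm_complex -sqrtr_sqr ler_wsqrtr// lerDr sqr_ge0.
have [r rP] := real_ultra_limit UF ReM; have [s sP] := real_ultra_limit UF ImM.
exists (Complex r s) => e e0.
have e2 : 0 < e / 2 by rewrite divr_gt0.
apply: filterS2 (rP _ e2) (sP _ e2) => i h1 h2.
by apply: (@re_norm_complex_lt (a i - Complex r s)); case: (a i) h1 h2.
Qed.

Section spans.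
Variable V : normedModType K.
Implicit Types (s : seq V) (x y : V).

(** Recursion on the list serves the induction of [in_span_ultra_limit], which removes one generator
    at a time. *)
Fixpoint in_span s x : Prop :=
  if s is v :: s' then exists a : K, in_span s' (x - a *: v) else x = 0.

Lemma in_span_linear s a x y : in_span s x -> in_span s y -> in_span s (a *: x + y).
Proof.
elim: s x y => [|v s IHs] x y /=; first by move=> -> ->; rewrite scaler0 addr0.
move=> [b xb] [c yc]; exists (a * b + c).
by have := IHs _ _ xb yc; rewrite scalerBr scalerA addrACA -opprD -scalerDl.
Qed.

Lemma in_span0 s : in_span s 0.
Proof. by elim: s => //= v s IHs; exists 0; rewrite scale0r subr0. Qed.

Lemma in_spanZ s a x : in_span s x -> in_span s (a *: x).
Proof. by move=> xs; rewrite -[_ *: x]addr0; apply: in_span_linear (in_span0 s). Qed.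

Lemma in_span_sum s (c : 'I_(size s) -> K) : in_span s (\sum_i c i *: s`_i).
Proof.
elim: s c => [|v s IHs] c /=; first by rewrite big_ord0.
by exists (c ord0); rewrite big_ord_recl /= addrAC subrr add0r; exact: IHs.
Qed.

Lemma span_comb s x : in_span s x -> exists c, x = \sum_(i < size s) c i *: s`_i.
Proof.
elim: s x => [|v s IHs] x /=; first by move=> ->; exists (fun=> 0); rewrite big_ord0.
move=> [a /IHs[c xE]].
exists (fun i : 'I_(size s).+1 => oapp c a (unlift ord0 i)).
rewrite big_ord_recl unlift_none /= -[LHS](subrKC (a *: v)) xE.
by congr (_ + _); apply: eq_bigr => i _; rewrite liftK.
Qed.

Lemma in_span_mem s x : x \in s -> in_span s x.
Proof.
elim: s => //= v s IHs; rewrite in_cons => /predU1P[->|/IHs xs].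
  by exists 1; rewrite scale1r subrr; exact: in_span0.
by exists 0; rewrite scale0r subr0.
Qed.

Lemma in_span_cat s1 s2 x : in_span s1 x -> in_span (s1 ++ s2) x.
Proof.
elim: s1 x => /= [x ->|v s1 IHs x [a /IHs xs]]; first exact: in_span0.
by exists a.
Qed.

Lemma in_span_catr s1 s2 x : in_span s2 x -> in_span (s1 ++ s2) x.
Proof. by elim: s1 x => //= v s1 IHs x /IHs xs; exists 0; rewrite scale0r subr0. Qed.

(** A generator v outside the span of the others is at a positive distance d from it. The
    coefficients of v along the family are then bounded by M / d and have a limit, and the remainder
    falls under the induction hypothesis. That this span is closed follows from the same hypothesis
    for an ultrafilter on nat, hence the induction with I and U general. *)
Lemma in_span_ultra_limit s (I : Type) (U : set_system I) (UF : UltraFilter U)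
    (y : I -> V) (M : R) :
  (forall i, in_span s (y i)) -> (forall i, rnorm (y i) <= M) ->
  exists l, in_span s l /\ ultra_cvg U y l.
Proof.
elim: s I U UF y M => [|v s IHs] I U UF y M.
  move=> /= y0 _; exists 0; split => // e e0; apply: nearW => i.
  by rewrite y0 subrr rnorm0.
move=> ys yM; have [vs|nvs] := pselect (in_span s v).
  have [|l [ls lP]] := IHs I U UF y M _ yM.
    move=> i; have [a ya] := ys i.
    by have := in_span_linear a vs ya; rewrite subrKC.
  by exists l; split => //=; exists 0; rewrite scale0r subr0.
have [d d0 dP] : exists2 d : R, 0 < d & forall w, in_span s w -> d <= rnorm (v - w).
  apply: contrapT => nd; apply: nvs.
  have /choice[w wP] n : exists w, in_span s w /\ rnorm (v - w) < 2^-1 ^+ n.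
    apply: contrapT => nw; apply: nd; exists (2^-1 ^+ n); first exact: half_pow_gt0.
    by move=> w ws; rewrite leNgt; apply/negP => h; apply: nw; exists w.
  have [G [GF oG]] := ultraFilterLemma eventually_filter.
  have [|n|l [ls lP]] := IHs nat G GF w (rnorm v + 1).
  - by move=> n; exact: (wP n).1.
  - rewrite -[w n](subrKC v) (le_trans (ler_rnormD _ _))// lerD2l rnorm_distC.
    by rewrite (le_trans (ltW (wP n).2))// exprn_ile1 ?invr_ge0// invf_le1// ler1n.
  suff -> : v = l by [].
  apply/eqP; rewrite -subr_eq0; apply/eqP; apply: (@rnorm_small_eq0 _ _ _ _ 2) => // e e0.
  have [N NP] := exists_half_lt e0.
  have GN : G [set n | (N <= n)%N] by apply: oG; exists N.
  have [n [/= nP Nn]] := filter_ex (filterI (lP _ e0) GN).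
  rewrite (le_trans (ler_rnormB _ (w n) _))//.
  have := (wP n).2; have : (2^-1 : R) ^+ n <= 2^-1 ^+ N.
    by apply: ler_wiXn2l => //; lra.
  move: nP NP; lra.
have /choice[a aP] := ys.
have aM i : re_part `|a i| <= M / d.
  rewrite ler_pdivlMr//; apply: le_trans (yM i).
  have [->|ai0] := eqVneq (a i) 0.
    by rewrite normr0 -(of_real0 R k) of_realK mul0r rnorm_ge0.
  have -> : y i = a i *: (v - (- (a i)^-1) *: (y i - a i *: v)).
    rewrite scalerBr scalerA mulrN divff// scaleN1r opprK.
    by rewrite subrKC.
  by rewrite rnormZ ler_wpM2l ?re_norm_ge0// dP//; exact/in_spanZ/aP.
have [b bP] := scalar_ultra_limit UF aM.
have [|l [ls lP]] := IHs I U UF (fun i => y i - a i *: v) (M + M / d * rnorm v) aP.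
  move=> i; rewrite (le_trans (ler_rnormD _ _))// rnormN lerD// rnormZ.
  by rewrite ler_wpM2r ?rnorm_ge0.
exists (l + b *: v); split => /=; first by exists b; rewrite addrK.
move=> e e0; have e2 : 0 < e / 2 by rewrite divr_gt0.
have ev : 0 < e / 2 / (rnorm v + 1) by rewrite divr_gt0// ltr_wpDl// rnorm_ge0.
apply: filterS2 (lP _ e2) (bP _ ev) => i.
have -> : y i - (l + b *: v) = (y i - a i *: v - l) + (a i - b) *: v.
  by rewrite scalerBl opprD addrA [y i - _ - l]addrAC subrKA.
move=> h1; rewrite ltr_pdivlMr ?ltr_wpDl ?rnorm_ge0// => h2.
rewrite (le_lt_trans (ler_rnormD _ _))// (splitr e) ltrD//.
apply: le_lt_trans h2; rewrite rnormZ ler_wpM2l ?re_norm_ge0// lerDl//.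
Qed.

End spans.

Lemma findim_ultra_limit (V : normedModType K) (I : Type) (U : set_system I)
    (UF : UltraFilter U) (y : I -> V) (M : R) :
  finite_dimensional V -> (forall i, rnorm (y i) <= M) ->
  exists l, ultra_cvg U y l.
Proof.
move=> [B [_ Bspan]] yM; have [|l [_ lP]] := @in_span_ultra_limit V B I U UF y M _ yM.
  by move=> i; have [c ->] := Bspan (y i); exact: in_span_sum.
by exists l.
Qed.

Lemma ultra_cvg_unique (V : normedModType K) (I : Type) (U : set_system I)
    (UF : UltraFilter U) (y : I -> V) l l' :
  ultra_cvg U y l -> ultra_cvg U y l' -> l = l'.
Proof.
move=> yl yl'; apply/eqP; rewrite -subr_eq0; apply/eqP.
apply: (@rnorm_small_eq0 _ _ _ _ 2) => // e e0.
have [i [/= h h']] := filter_ex (filterI (yl _ e0) (yl' _ e0)).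
by have := ler_rnormB l (y i) l'; rewrite [rnorm (l - y i)]rnorm_distC; lra.
Qed.

Lemma ultra_cvg_linear (V : normedModType K) (I : Type) (U : set_system I)
    (UF : UltraFilter U) (a : K) (y z : I -> V) l m :
  ultra_cvg U y l -> ultra_cvg U z m ->
  ultra_cvg U (fun i => a *: y i + z i) (a *: l + m).
Proof.
move=> yl zm e e0; have e2 : 0 < e / 2 by rewrite divr_gt0.
have a0 := re_norm_ge0 a.
have ea : 0 < e / 2 / (re_part `|a| + 1) by rewrite divr_gt0// ltr_wpDl.
apply: filterS2 (yl _ ea) (zm _ e2) => i h1 h2.
rewrite opprD addrACA -scalerBr (le_lt_trans (ler_rnormD _ _))// (splitr e) ltrD//.
rewrite rnormZ; move: h1; rewrite ltr_pdivlMr ?ltr_wpDl//; apply: le_lt_trans.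
by rewrite mulrC ler_wpM2l ?rnorm_ge0// lerDl.
Qed.

Lemma ultra_cvg_rnorm (V : normedModType K) (I : Type) (U : set_system I)
    (UF : UltraFilter U) (y : I -> V) l :
  ultra_cvg U y l -> rnorm (y i) @[i --> U] --> rnorm l.
Proof.
move=> yl; apply/cvgrPdist_lt => e /yl; apply: filterS => i.
by rewrite distrC; apply: le_lt_trans; exact: ler_dist_rnorm.
Qed.

End ultralimits.

(** * Coordinates in an l2-sum *)

Section l2_sums.
Context {R : realType} {k : scalar_kind}.
Notation K := (scalar_field R k).
Variable E : nat -> completeNormedModType K.
Implicit Types x y z t : l2_sum E.

Lemma l2_sq_cvg x : series (fun n => rnorm (x n) ^+ 2) @ \oo --> rnorm x ^+ 2.
Proof.
have cx := l2_coordP x; rewrite rnorm_l2_sum sqr_sqrtr//.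
by apply: limr_ge => //; apply: nearW => n; apply: sumr_ge0 => i _; rewrite sqr_ge0.
Qed.

Lemma l2_partial_sqr_le x N :
  \sum_(0 <= i < N) rnorm (x i) ^+ 2 <= rnorm x ^+ 2.
Proof.
have h0 : 0 <= \sum_(0 <= i < N) rnorm (x i) ^+ 2.
  by apply: sumr_ge0 => i _; rewrite sqr_ge0.
rewrite -(sqr_sqrtr h0) ler_pXn2r ?nnegrE ?sqrtr_ge0 ?rnorm_ge0//.
by rewrite rnorm_l2_sum; exact/l2_partial_le_norm/l2_coordP.
Qed.

Lemma l2_sqr_le (c : R) x y z t :
  (forall n, rnorm (x n) ^+ 2 + rnorm (y n) ^+ 2 <=
     c * (rnorm (z n) ^+ 2 + rnorm (t n) ^+ 2)) ->
  rnorm x ^+ 2 + rnorm y ^+ 2 <= c * (rnorm z ^+ 2 + rnorm t ^+ 2).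
Proof.
move=> h; pose S (w : l2_sum E) := series (fun n => rnorm (w n) ^+ 2).
have hl : (S x n + S y n) @[n --> \oo] --> rnorm x ^+ 2 + rnorm y ^+ 2.
  by apply: cvgD; exact: l2_sq_cvg.
have hr : (c * (S z n + S t n)) @[n --> \oo] --> c * (rnorm z ^+ 2 + rnorm t ^+ 2).
  by apply: cvgMr; apply: cvgD; exact: l2_sq_cvg.
apply: (ler_cvg_to hl hr); apply: nearW => n /=.
by rewrite /S /series /= -!big_split /= mulr_sumr; apply: ler_sum => i _; exact: h.
Qed.

Lemma l2_sqr_disjoint x y : (forall n, x n = 0 \/ y n = 0) ->
  rnorm (x + y) ^+ 2 = rnorm x ^+ 2 + rnorm y ^+ 2.
Proof.
move=> xy; pose S (w : l2_sum E) := series (fun n => rnorm (w n) ^+ 2).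
have : (S x n + S y n) @[n --> \oo] --> rnorm x ^+ 2 + rnorm y ^+ 2.
  by apply: cvgD; exact: l2_sq_cvg.
have -> : (fun n => S x n + S y n) = S (x + y).
  apply/funext => n; rewrite /S /series /= -big_split /=; apply: eq_bigr => i _.
  by case: (xy i) => ->; rewrite rnorm0 expr0n ?add0r ?addr0.
by move=> /(cvg_unique (@Rhausdorff R) (@l2_sq_cvg (x + y))).
Qed.

Definition restrict_coord (D : pred nat) x n : E n := if D n then x n else 0.

Let restrict_summable D x : sq_summable (fun n => rnorm (restrict_coord D x n)).
Proof.
apply: (@l2_bounded _ _ (rnorm x) _).1 => N; rewrite rnorm_l2_sum.
apply: le_trans (l2_partial_le_norm N (l2_coordP x)); apply: l2_partial_le => i.
by rewrite rnorm_ge0 /restrict_coord; case: ifP => _; rewrite ?rnorm0 ?lexx ?rnorm_ge0.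
Qed.

Definition restrict_fun D x : l2_sum E :=
  @L2Sum _ _ _ (restrict_coord D x) (@restrict_summable D x).

Let restrict_fun_linear D : linear (restrict_fun D).
Proof.
move=> a x y; apply: l2_sum_ext => n /=; rewrite /restrict_coord.
by case: ifP => //; rewrite scaler0 addr0.
Qed.

Definition restrict D : {linear l2_sum E -> l2_sum E} :=
  linear_of (restrict_fun_linear D).

Lemma restrictE D x n : restrict D x n = if D n then x n else 0.
Proof. by []. Qed.

Lemma restrict_split D x : x = restrict D x + restrict (predC D) x.
Proof.
apply: l2_sum_ext => n /=; rewrite /restrict_coord /=.
by case: (D n); rewrite ?addr0 ?add0r.
Qed.

Lemma sqr_rnorm_restrict D x :
  rnorm x ^+ 2 = rnorm (restrict D x) ^+ 2 + rnorm (restrict (predC D) x) ^+ 2.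
Proof.
rewrite {1}[x](restrict_split D) l2_sqr_disjoint// => n; rewrite !restrictE /=.
by case: (D n); [right|left].
Qed.

Notation head N := (restrict (fun i => i < N)%N).

Lemma sqr_rnorm_head N x :
  rnorm (head N x) ^+ 2 = \sum_(0 <= i < N) rnorm (x i) ^+ 2.
Proof.
apply: (cvg_unique (@Rhausdorff R) (@l2_sq_cvg (head N x))).
apply: cvg_near_cst; exists N => // n /= Nn.
rewrite /series /= (@big_cat_nat _ _ _ N)//= [X in _ + X]big1_seq ?addr0.
  apply: eq_big_nat => i /andP[_ iN].
  by rewrite /restrict_coord iN.
move=> i /andP[_]; rewrite mem_index_iota => /andP[Ni _].
by rewrite /restrict_coord ltnNge Ni rnorm0 expr0n.
Qed.

Lemma head_cvg x e : 0 < e -> exists N, rnorm (x - head N x) < e.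
Proof.
move=> e0; have e2 : 0 < e ^+ 2 by rewrite exprn_gt0.
have /cvgrPdist_lt/(_ _ e2)[N _ /(_ N (leqnn N))/=] := @l2_sq_cvg x.
rewrite /series /= -sqr_rnorm_head {1}(sqr_rnorm_restrict (fun i => i < N)%N x).
rewrite addrAC subrr add0r ger0_norm ?sqr_ge0// => h; exists N.
rewrite {1}[x](restrict_split (fun i => i < N)%N) addrAC subrr add0r.
by rewrite -(@ltr_pXn2r _ 2)// nnegrE ?rnorm_ge0// ltW.
Qed.

(** The type of a coordinate depends on its index, so v is transported along a proof of n = m. *)
Definition embed_coord n (v : E n) m : E m :=
  if @eqP _ n m is ReflectT nm then ecast i (E i) nm v else 0.

Lemma embed_coord_id n (v : E n) : embed_coord v n = v.
Proof. by rewrite /embed_coord; case: eqP => // nn; rewrite eq_axiomK. Qed.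

Lemma embed_coord_neq n (v : E n) m : n <> m -> embed_coord v m = 0.
Proof. by rewrite /embed_coord; case: eqP. Qed.

Let embed_summable n (v : E n) : sq_summable (fun m => rnorm (embed_coord v m)).
Proof.
apply: (@l2_bounded _ _ (rnorm v) _).1 => N.
rewrite /l2_partial -(ger0_norm (rnorm_ge0 v)) -sqrtr_sqr ler_wsqrtr//.
rewrite big_mkord.
have [nN|Nn] := ltnP n N.
  rewrite (bigD1 (Ordinal nN))//= embed_coord_id big1 ?addr0// => i.
  rewrite -val_eqE /= => ni; rewrite embed_coord_neq ?rnorm0 ?expr0n//.
  by apply/eqP; rewrite eq_sym.
rewrite big1 ?sqr_ge0// => i _; rewrite embed_coord_neq ?rnorm0 ?expr0n//.
by move=> ni; move: Nn; rewrite ni leqNgt ltn_ord.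
Qed.

Definition embed_fun n (v : E n) : l2_sum E := @L2Sum _ _ _ (embed_coord v) (@embed_summable n v).

Let embed_fun_linear n : linear (@embed_fun n).
Proof.
move=> a u v; apply: l2_sum_ext => m /=; have [nm|nm] := eqVneq n m.
  by move: nm => /[dup] + <-; rewrite !embed_coord_id.
by rewrite !embed_coord_neq ?scaler0 ?addr0//; exact/eqP.
Qed.

Definition embed n : {linear E n -> l2_sum E} := linear_of (@embed_fun_linear n).

Lemma embed_id n (v : E n) : embed n v n = v.
Proof. exact: embed_coord_id. Qed.

Lemma embed_neq n (v : E n) m : n <> m -> embed n v m = 0.
Proof. exact: embed_coord_neq. Qed.

Lemma rnorm_embed n (v : E n) : rnorm (embed n v) = rnorm v.
Proof.
apply/eqP; rewrite -(@eqrXn2 _ 2) ?rnorm_ge0//; apply/eqP.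
apply: (cvg_unique (@Rhausdorff R) (@l2_sq_cvg (embed n v))).
apply: cvg_near_cst; exists n.+1 => // N /= nN.
rewrite /series /= big_mkord (bigD1 (Ordinal nN))//= embed_coord_id big1 ?addr0// => i.
rewrite -val_eqE /= => ni; rewrite embed_coord_neq ?rnorm0 ?expr0n//.
by apply/eqP; rewrite eq_sym.
Qed.

Lemma head_embed N x : head N x = \sum_(i < N) embed i (x i).
Proof.
apply: l2_sum_ext => m.
have sumE (s : seq 'I_N) : (\sum_(i <- s) embed i (x i)) m = \sum_(i <- s) embed i (x i) m.
  by elim: s => [|i s IHs]; rewrite ?big_nil// !big_cons -IHs.
rewrite restrictE sumE; case: ifPn => [mN|]; last first.
  rewrite -leqNgt => Nm; rewrite big1// => i _; rewrite embed_neq// => im.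
  by move: Nm; rewrite -im leqNgt ltn_ord.
rewrite (bigD1 (Ordinal mN))//= embed_coord_id big1 ?addr0// => i.
by rewrite -val_eqE /= => im; rewrite embed_coord_neq//; exact/eqP.
Qed.

End l2_sums.

(** * Ultrapowers of split spaces *)

Section ultrapower_toolkit.
Context {R : realType} {k : scalar_kind}.
Notation K := (scalar_field R k).
Variables (I : Type) (U : set_system I) (UF : UltraFilter U).

Lemma ultra_rnorm_cvg (Z : normedModType K) (f : bounded_family I Z) :
  rnorm (f i) @[i --> U] --> rnorm (ultra_class UF f).
Proof.
have -> : rnorm (ultra_class UF f) = ultra_norm (ultra_class UF f) by exact: of_realK.
exact: ultra_norm_cvg.
Qed.

Lemma ultra_class_eqP (Z : normedModType K) (f g : bounded_family I Z) :
  ultra_class UF f = ultra_class UF g <->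
  forall e : R, 0 < e -> \forall i \near U, rnorm (f i - g i) < e.
Proof. by split=> [/ultra_classP/null_family_near|h]; [|apply/ultra_classP/null_family_near]. Qed.

Lemma const_bounded (Z : normedModType K) (z : Z) :
  exists M : R, forall i : I, rnorm (cst z i) <= M.
Proof. by exists (rnorm z). Qed.

Definition diagonal_fun (Z : normedModType K) (z : Z) : ultrapower UF Z :=
  ultra_class UF (BoundedFamily (const_bounded z)).

Lemma diagonal_fun_linear (Z : normedModType K) : linear (@diagonal_fun Z).
Proof.
move=> a x y; rewrite /diagonal_fun -ultra_classZ -ultra_classD.
by congr ultra_class; apply: bounded_family_ext.
Qed.

Definition diagonal (Z : normedModType K) : {linear Z -> ultrapower UF Z} :=
  linear_of (@diagonal_fun_linear Z).

Lemma rnorm_diagonal (Z : normedModType K) (z : Z) : rnorm (diagonal Z z) = rnorm z.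
Proof. by rewrite rnorm_ultra_class; exact: lim_cst. Qed.

Section ultra_map.
Variables (Y Z : normedModType K) (S : {linear Y -> Z}).
Hypothesis iS : forall y, rnorm (S y) = rnorm y.

Lemma ultra_map_bounded (f : bounded_family I Y) :
  exists M : R, forall i, rnorm (S (f i)) <= M.
Proof. by have [M fM] := family_bounded f; exists M => i; rewrite iS. Qed.

Definition ultra_map_family (f : bounded_family I Y) :=
  BoundedFamily (ultra_map_bounded f).

Definition ultra_map_fun (q : ultrapower UF Y) : ultrapower UF Z :=
  ultra_class UF (ultra_map_family (ultra_repr q)).

Lemma ultra_map_class f : ultra_map_fun (ultra_class UF f) = ultra_class UF (ultra_map_family f).
Proof.
apply/ultra_class_eqP => e e0; have /ultra_class_eqP := ultra_reprK (ultra_class UF f).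
by move=> /(_ e e0); apply: filterS => i /=; rewrite -linearB iS.
Qed.

Lemma ultra_map_fun_linear : linear ultra_map_fun.
Proof.
move=> a q r; rewrite -[q]ultra_reprK -[r]ultra_reprK -ultra_classZ -ultra_classD.
rewrite !ultra_map_class -ultra_classZ -ultra_classD; congr ultra_class.
by apply: bounded_family_ext => i; rewrite /= linearP.
Qed.

Definition ultra_map : {linear ultrapower UF Y -> ultrapower UF Z} :=
  linear_of ultra_map_fun_linear.

Lemma rnorm_ultra_map q : rnorm (ultra_map q) = rnorm q.
Proof.
set f := ultra_repr q; rewrite -[q]ultra_reprK [ultra_map _]ultra_map_class -/f.
have h := @ultra_rnorm_cvg Z (ultra_map_family f).
have h' : rnorm (ultra_map_family f i) @[i --> U] --> rnorm (ultra_class UF f).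
  by under eq_fun do rewrite /= iS; exact: ultra_rnorm_cvg.
exact: (cvg_unique (@Rhausdorff R) h h').
Qed.

End ultra_map.
End ultrapower_toolkit.

(** * The splitting of an ultrapower of a split space *)

Section ultrapower_split.
Context {R : realType} {k : scalar_kind}.
Notation K := (scalar_field R k).
Variable E : nat -> completeNormedModType K.
Hypothesis E_findim : forall n, finite_dimensional (E n).

Definition asymptotically_hilbert := forall c : R, 1 < c -> exists N, forall n, (N <= n)%N ->
  forall x y : E n,
    rnorm (x + y) ^+ 2 + rnorm (x - y) ^+ 2 <= 2 * c * (rnorm x ^+ 2 + rnorm y ^+ 2).

Notation head N := (restrict E (fun i => i < N)%N).

Variables (I : Type) (U : set_system I) (UF : UltraFilter U).

Definition coord_limit (f : I -> l2_sum E) (l : forall n, E n) :=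
  forall n, ultra_cvg U (fun i => f i n) (l n).

Lemma coord_limit_head_cvg f (l : forall n, E n) N : coord_limit f l ->
  \sum_(0 <= n < N) rnorm (f i n) ^+ 2 @[i --> U] --> \sum_(0 <= n < N) rnorm (l n) ^+ 2.
Proof.
move=> fl; elim: N => [|N IHN].
  by rewrite big_geq//; under eq_fun do rewrite big_geq//; exact: cvg_cst.
rewrite big_nat_recr//=; under eq_fun do rewrite big_nat_recr//=.
apply: cvgD IHN _; under eq_fun do rewrite expr2.
by rewrite expr2; apply: cvgM; exact: ultra_cvg_rnorm.
Qed.

(** Finite sums commute with ultralimits, so every partial sum of squares of the limit is at most
    M^2. *)
Lemma coord_limit_exists (f : I -> l2_sum E) (M : R) :
  (forall i, rnorm (f i) <= M) -> exists l : l2_sum E, coord_limit f l.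
Proof.
move=> fM; have lP n : exists l : E n, ultra_cvg U (fun i => f i n) l.
  apply: (@findim_ultra_limit _ _ _ _ _ _ _ M (E_findim n)) => i.
  exact: le_trans (rnorm_l2_coord _ _) (fM i).
have /all_sig[l {}lP] := fun n => cid (lP n).
have sl : sq_summable (fun n => rnorm (l n)).
  apply: (@l2_bounded _ _ M _).1 => N.
  have [i0 _] : exists i : I, setT i by apply: (@filter_ex _ U); exact: filterT.
  have M0 : 0 <= M := le_trans (rnorm_ge0 _) (fM i0).
  rewrite /l2_partial -(ger0_norm M0) -sqrtr_sqr ler_wsqrtr//.
  have h := @coord_limit_head_cvg f l N lP.
  apply: (cvgr_to_le h); apply: nearW => i.
  by rewrite (le_trans (l2_partial_sqr_le _ _))// ler_pXn2r ?nnegrE ?rnorm_ge0.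
by exists (@L2Sum _ _ _ l sl).
Qed.

Variables (Z : normedModType K) (J : {linear l2_sum E -> Z}) (P : {linear Z -> l2_sum E}).
Hypothesis JP : hilbert_split J P.

Lemma proj_limit_exists (f : bounded_family I Z) : exists l : l2_sum E, coord_limit (P \o f) l.
Proof.
have [M fM] := family_bounded f; apply: (@coord_limit_exists _ M) => i.
exact: le_trans (split_contraction JP _) (fM i).
Qed.

Definition limit_fun (q : ultrapower UF Z) : l2_sum E :=
  sval (cid (proj_limit_exists (ultra_repr q))).

Lemma limit_class (f : bounded_family I Z) : coord_limit (P \o f) (limit_fun (ultra_class UF f)).
Proof.
move=> n e e0; have e2 : 0 < e / 2 by rewrite divr_gt0.
have /ultra_class_eqP := ultra_reprK (ultra_class UF f).
move=> /(_ _ e2) h; have := svalP (cid (proj_limit_exists (ultra_repr (ultra_class UF f)))).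
move=> /(_ n _ e2) h'; apply: filterS2 h h' => i h h'.
rewrite (le_lt_trans (ler_rnormB _ (P (ultra_repr (ultra_class UF f) i) n) _))//.
rewrite (splitr e) ltrD// rnorm_distC; apply: le_lt_trans h.
rewrite -l2_sumBE -linearB (le_trans (rnorm_l2_coord _ _))//.
exact: split_contraction JP _.
Qed.

Lemma limit_uniq (f : bounded_family I Z) (l : l2_sum E) :
  coord_limit (P \o f) l -> limit_fun (ultra_class UF f) = l.
Proof.
move=> fl; apply: l2_sum_ext => n; apply: ultra_cvg_unique (fl n).
exact: limit_class.
Qed.

Lemma limit_fun_linear : linear limit_fun.
Proof.
move=> a q r; rewrite -[q]ultra_reprK -[r]ultra_reprK -ultra_classZ -ultra_classD.
set f := ultra_repr q; set g := ultra_repr r; apply: limit_uniq => n.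
have := ultra_cvg_linear UF a (limit_class f n) (limit_class g n).
by congr (ultra_cvg U _ _); apply/funext => i /=; rewrite linearP.
Qed.

Definition limit_map : {linear ultrapower UF Z -> l2_sum E} := linear_of limit_fun_linear.

(** The first N coordinates of [P (f i)] have ultralimit 0 and are finite in number, so subtracting
    their image under J does not change the class. *)
Lemma tail_representative h N : limit_map h = 0 -> exists2 t : bounded_family I Z,
  ultra_class UF t = h & forall i n, (n < N)%N -> P (t i) n = 0.
Proof.
move=> h0; set f := ultra_repr h.
have fh : ultra_class UF f = h by exact: ultra_reprK.
have f0 : coord_limit (P \o f) (0 : l2_sum E) by rewrite -h0 -fh; exact: limit_class.
have [M fM] := family_bounded f.
have tM : exists M : R, forall i, rnorm (f i - J (head N (P (f i)))) <= M.
  exists (M + M) => i; rewrite (le_trans (ler_rnormD _ _))// lerD// rnormN.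
  rewrite (split_isometry JP) (le_trans _ (fM i))//.
  apply: le_trans (split_contraction JP _).
  rewrite -(@ler_pXn2r _ 2) ?nnegrE ?rnorm_ge0//.
  by rewrite sqr_rnorm_head l2_partial_sqr_le.
exists (BoundedFamily tM) => [|i n nN]; last first.
  by rewrite /= linearB (splitK JP) l2_sumBE restrictE nN subrr.
rewrite -fh; apply/ultra_class_eqP => e e0; have e2 : 0 < e ^+ 2 by rewrite exprn_gt0.
have := coord_limit_head_cvg (N := N) f0.
rewrite [X in _ --> X]big1; last by move=> n _; rewrite rnorm0 expr0n.
move=> /cvgrPdist_lt/(_ _ e2); apply: filterS => i /=.
rewrite sub0r normrN -sqr_rnorm_head ger0_norm ?sqr_ge0// => h1.
rewrite addrAC subrr add0r rnormN (split_isometry JP).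
by rewrite -(@ltr_pXn2r _ 2)// nnegrE ?rnorm_ge0// ltW.
Qed.

Lemma sqr_ultra_rnorm_cvg (f : bounded_family I Z) :
  rnorm (f i) ^+ 2 @[i --> U] --> rnorm (ultra_class UF f) ^+ 2.
Proof. by under eq_fun do rewrite expr2; rewrite expr2; apply: cvgM; exact: ultra_rnorm_cvg. Qed.

Lemma limit_ker_orthogonal x h : limit_map h = 0 ->
  rnorm (diagonal UF Z (J x) + h) ^+ 2 = rnorm x ^+ 2 + rnorm h ^+ 2.
Proof.
(* Against [head N x], a tail representative has disjoint coordinates, and the identity holds at
   every index i. Heads then approximate x. *)
move=> h0; have headP N : rnorm (diagonal UF Z (J (head N x)) + h) ^+ 2 =
    rnorm (head N x) ^+ 2 + rnorm h ^+ 2.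
  have [t <- t0] := tail_representative N h0.
  rewrite /diagonal /= /diagonal_fun -ultra_classD.
  set g := _ + t; have h1 := @sqr_ultra_rnorm_cvg g.
  have h2 : rnorm (g i) ^+ 2 @[i --> U] -->
      rnorm (head N x) ^+ 2 + rnorm (ultra_class UF t) ^+ 2.
    have gE i : rnorm (g i) ^+ 2 = rnorm (head N x) ^+ 2 + rnorm (t i) ^+ 2.
      rewrite familyDE /= (split_sqr_rnorm JP (t i)).
      rewrite -{1}[t i](subrKC (J (P (t i)))) addrA -linearD.
      rewrite (split_sqr_rnormD JP) ?(split_ker JP)// addrA.
      congr (_ + _); rewrite l2_sqr_disjoint// => n; rewrite restrictE.
      by case: ifP => [/t0 ->|_]; [right|left].
    under eq_fun do rewrite gE.
    by apply: cvgD; [exact: cvg_cst | exact: sqr_ultra_rnorm_cvg].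
  exact: (cvg_unique (@Rhausdorff R) h1 h2).
apply/eqP; rewrite -subr_eq0 -normr_eq0 eq_le normr_ge0 andbT.
pose A := rnorm (diagonal UF Z (J x) + h); pose B := rnorm x.
have A0 : 0 <= A by exact: rnorm_ge0.
have B0 : 0 <= B by exact: rnorm_ge0.
(* Replacing x by a head changes A and B by at most e <= 1, so |A - A'| (A + A') <= e (2 A + 1), and
   likewise for B; the constant adds the two bounds. *)
apply: (@le0_of_le_small R _ (2 * A + 2 * B + 2)); first by lra.
move=> e /andP[e0 e1]; have [N NP] := head_cvg x e0.
have := ler_dist_rnorm (diagonal UF Z (J x) + h) (diagonal UF Z (J (head N x)) + h).
rewrite opprD addrACA subrr addr0 -!linearB rnorm_diagonal (split_isometry JP) => h1.
have h2 := ler_dist_rnorm x (head N x).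
have := headP N; have := rnorm_ge0 (diagonal UF Z (J (head N x)) + h).
have := rnorm_ge0 (head N x); move: h1 h2 NP.
rewrite -/A -/B; move: (rnorm (x - _)) (rnorm (_ + h)) (rnorm (head N x)) => d A' B'.
move=> h1 h2 de B'0 A'0 hh; rewrite opprD addrA.
have -> : A ^+ 2 - B ^+ 2 - rnorm h ^+ 2 = (A - A') * (A + A') - (B - B') * (B + B').
  by move: hh; rewrite !expr2; lra.
have hA : `|A - A'| <= e by lra.
have hB : `|B - B'| <= e by lra.
rewrite (le_trans (ler_normB _ _))// !normrM.
rewrite (ger0_norm (addr_ge0 A0 A'0)) (ger0_norm (addr_ge0 B0 B'0)).
have h3 : `|A - A'| * (A + A') <= e * (2 * A + 1).
  apply: ler_pM => //; first exact: addr_ge0.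
  by move: hA; rewrite ler_norml => /andP[? ?]; lra.
have h4 : `|B - B'| * (B + B') <= e * (2 * B + 1).
  apply: ler_pM => //; first exact: addr_ge0.
  by move: hB; rewrite ler_norml => /andP[? ?]; lra.
by rewrite (le_trans (lerD h3 h4))//; lra.
Qed.

Hypothesis E_asym : asymptotically_hilbert.

(** Tail representatives live on coordinates n >= N, where the law holds up to the factor 1 + e;
    their components in ker P satisfy it exactly. *)
Lemma limit_ker_parallelogram_le h h' : limit_map h = 0 -> limit_map h' = 0 ->
  rnorm (h + h') ^+ 2 + rnorm (h - h') ^+ 2 <= 2 * (rnorm h ^+ 2 + rnorm h' ^+ 2).
Proof.
move=> h0 h'0; set S := _ ^+ 2 + _ ^+ 2; set S' := rnorm h ^+ 2 + _.
have S'0 : 0 <= S' by rewrite addr_ge0 ?sqr_ge0.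
rewrite -subr_le0; apply: (@le0_of_le_small R _ (2 * S')); first by rewrite mulr_ge0.
move=> e /andP[e0 _]; rewrite lerBlDl.
have -> : 2 * S' + 2 * S' * e = 2 * (1 + e) * S' by ring.
have c1 : 1 < 1 + e by rewrite ltrDl.
have [N NP] := E_asym c1; rewrite /S /S' {S S' S'0}.
have [t <- t0] := tail_representative N h0.
have [s <- s0] := tail_representative N h'0.
rewrite -ultra_classD -ultra_classB.
have hl : (rnorm ((t + s) i) ^+ 2 + rnorm ((t - s) i) ^+ 2) @[i --> U] -->
    rnorm (ultra_class UF (t + s)) ^+ 2 + rnorm (ultra_class UF (t - s)) ^+ 2.
  by apply: cvgD; exact: sqr_ultra_rnorm_cvg.
have hr : (2 * (1 + e) * (rnorm (t i) ^+ 2 + rnorm (s i) ^+ 2)) @[i --> U] -->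
    2 * (1 + e) * (rnorm (ultra_class UF t) ^+ 2 + rnorm (ultra_class UF s) ^+ 2).
  by apply: cvgMr; apply: cvgD; exact: sqr_ultra_rnorm_cvg.
rewrite -subr_ge0; apply: (cvgr_to_ge (cvgB hr hl)); apply: nearW => i /=; rewrite subr_ge0.
move: (t i) (s i) (t0 i) (s0 i) => {hl hr t0 s0}y z y0 z0.
rewrite (split_sqr_rnorm JP (y + z)) (split_sqr_rnorm JP (y - z)).
rewrite (split_sqr_rnorm JP y) (split_sqr_rnorm JP z).
have -> : P (y + z) = P y + P z by rewrite linearD.
have -> : P (y - z) = P y - P z by rewrite linearB.
have -> : y + z - J (P y + P z) = (y - J (P y)) + (z - J (P z)).
  by rewrite linearD opprD addrACA.
have -> : y - z - J (P y - P z) = (y - J (P y)) - (z - J (P z)).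
  by rewrite linearB !opprD addrACA.
have [_ _ para] := JP; have := para _ _ (split_ker JP y) (split_ker JP z).
have : rnorm (P y + P z) ^+ 2 + rnorm (P y - P z) ^+ 2 <=
    2 * (1 + e) * (rnorm (P y) ^+ 2 + rnorm (P z) ^+ 2).
  apply: l2_sqr_le => n; have [nN|Nn] := ltnP n N.
    have -> : (P y + P z) n = P y n + P z n by [].
    rewrite l2_sumBE y0// z0// addr0 subr0 rnorm0 expr0n/= !addr0.
    by rewrite mulr0.
  exact: NP.
have := sqr_ge0 (rnorm (y - J (P y))); have := sqr_ge0 (rnorm (z - J (P z))).
move: (rnorm (y - J (P y)) ^+ 2) (rnorm (z - J (P z)) ^+ 2) => a b b0 a0 h1 h2.
rewrite addrACA h2 [leRHS](_ : _ = 2 * (1 + e) * (rnorm (P y) ^+ 2 + rnorm (P z) ^+ 2)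
  + 2 * (1 + e) * (a + b)); last by ring.
by rewrite lerD// ler_wpM2r ?addr_ge0// ler_peMr// ltW.
Qed.

Theorem ultrapower_split : hilbert_split (diagonal UF Z \o J) limit_map.
Proof.
split.
- move=> x; apply: limit_uniq => n e e0; apply: nearW => i /=.
  by rewrite (splitK JP) subrr rnorm0.
- exact: limit_ker_orthogonal.
move=> h h' h0 h'0; apply/eqP; rewrite eq_le limit_ker_parallelogram_le//=.
(* The inequality at h + h' and h - h' is the reverse inequality at h and h'. *)
have := @limit_ker_parallelogram_le (h + h') (h - h').
rewrite linearD linearB h0 h'0 subrr addr0 => /(_ erefl erefl).
rewrite sum_sub2 sub_sub2 !rnorm_two !exprMn.
lra.
Qed.

End ultrapower_split.

(** * Rigidity of isometries *)

Section linear_dependence.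
Context {R : realType} {k : scalar_kind}.
Notation K := (scalar_field R k).
Variable V : normedModType K.

(** The coefficient matrix of f 0, ..., f N over the N generators has more rows than columns, hence
    a nonzero left kernel. *)
Lemma span_dependent (S : seq V) (f : nat -> V) : (forall j, in_span S (f j)) ->
  exists2 c : seq K, has (fun a => a != 0) c & \sum_(j < size c) c`_j *: f j = 0.
Proof.
move=> fS; pose N := size S.
have /choice[m mP] j := span_comb (fS j).
pose M : 'M[K]_(N.+1, N) := \matrix_(j, i) m j i.
have ker0 : kermx M != 0.
  by rewrite -mxrank_eq0 mxrank_ker -lt0n subn_gt0 ltnS rank_leq_col.
have /rowV0Pn[v /sub_kermxP vM v0] := ker0.
pose c := [seq v 0 j | j <- enum 'I_N.+1].
have sc : size c = N.+1 by rewrite size_map size_enum_ord.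
exists c.
  have /rV0Pn[j vj] := v0; apply/hasP; exists (v 0 j) => //.
  by apply: map_f; rewrite mem_enum.
rewrite sc (eq_bigr (fun j : 'I_N.+1 => \sum_i (v 0 j * M j i) *: S`_i)); last first.
  move=> j _; rewrite (nth_map ord0) ?size_enum_ord// nth_ord_enum mP scaler_sumr.
  by apply: eq_bigr => i _; rewrite scalerA mxE.
rewrite exchange_big /= big1// => i _; rewrite -scaler_suml.
by have /matrixP/(_ 0 i) := vM; rewrite !mxE => ->; rewrite scale0r.
Qed.

Variables (T : {linear V -> V}) (F : V -> Prop).
Hypotheses (F_lin : forall a x y, F x -> F y -> F (a *: x + y)) (F0 : F 0).
Hypotheses (FT : forall x, F x -> F (T x)).
Hypothesis T_inj : forall x, F x -> T x = 0 -> x = 0.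

(* The iterates of y under T satisfy a nontrivial linear relation; cancelling the
   lowest power of T by injectivity exhibits y as a value of T. *)
Lemma finite_span_surjective (S : seq V) : (forall x, F x -> in_span S x) ->
  forall y, F y -> exists2 w, F w & T w = y.
Proof.
move=> FS y Fy.
(* Horner's scheme: [ev c] is the polynomial in T with coefficients c, applied to y. *)
pose ev := fix ev (c : seq K) : V := if c is a :: c' then a *: y + T (ev c') else 0.
have Fev c : F (ev c) by elim: c => //= a c IHc; apply: F_lin => //; exact: FT.
have evE c : ev c = \sum_(j < size c) c`_j *: iter j T y.
  elim: c => [|a c IHc]; first by rewrite big_ord0.
  by rewrite big_ord_recl /= IHc linear_sum; congr (_ + _); apply: eq_bigr => j _; rewrite linearZ.
have Fiter j : F (iter j T y) by elim: j => //= j IHj; exact: FT.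
have [c c0] := span_dependent (fun j => FS _ (Fiter j)); rewrite -evE.
elim: c c0 => //= a c IHc; have [->|a0] /= := eqVneq a 0.
  by rewrite scale0r add0r => /IHc{}IHc /T_inj ev0; apply: IHc; exact: ev0.
move=> _ /eqP; rewrite addr_eq0 => /eqP ay.
exists ((- a^-1) *: ev c + 0); first exact: F_lin.
by rewrite addr0 linearZ /= scaleNr -scalerN -ay scalerA mulVf// scale1r.
Qed.

End linear_dependence.

(** * Images of l_p-pairs under isometries into a split space *)

Section isometries_into_splittings.
Context {R : realType} {k : scalar_kind}.
Notation K := (scalar_field R k).
Variables (E : nat -> completeNormedModType K) (p : nat -> R).
Hypotheses (p_gt2 : forall n, 2 < p n) (p_cvg : p n @[n --> \oo] --> (2 : R)).
Hypothesis hypa : forall (n : nat) (x y : E n),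
  rnorm (x + y) ^+ 2 + rnorm (x - y) ^+ 2 >=
  2 * (rnorm x `^ p n + rnorm y `^ p n) `^ (2 / p n).

(* Hypothesis (a) at x + y and x - y. *)
Lemma sqr_sum_le n (x y : E n) : rnorm (x + y) ^+ 2 + rnorm (x - y) ^+ 2 <=
  2 * (p n - 1) * (rnorm x ^+ 2 + rnorm y ^+ 2).
Proof.
have := hypa (x + y) (x - y); rewrite sum_sub2 sub_sub2 !rnorm_two !exprMn.
have := sqr_sum_le_powR (p_gt2 n) (rnorm_ge0 (x + y)) (rnorm_ge0 (x - y)).
set w := (_ + _) `^ _; move: w => w; have := p_gt2 n; set q := p n; move: q => q.
move: (rnorm (x + y) ^+ 2) (rnorm (x - y) ^+ 2) (rnorm x ^+ 2) (rnorm y ^+ 2) => a b c d.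
move=> q2 h1 h2; apply: (le_trans h1).
have -> : 2 * (q - 1) * (c + d) = (q - 1) * (2 * (c + d)) by ring.
by rewrite ler_pM2l; lra.
Qed.

Lemma hypa_asymptotically_hilbert : asymptotically_hilbert E.
Proof.
move=> c c1; have c1' : 0 < c - 1 by rewrite subr_gt0.
have /cvgrPdist_lt/(_ _ c1')[N _ NP] := p_cvg.
exists N => n /NP /= pn x y; apply: (le_trans (sqr_sum_le x y)).
rewrite ler_wpM2r ?addr_ge0 ?sqr_ge0// ler_pM2l//.
by move: pn; rewrite ltr_norml => /andP[? ?]; lra.
Qed.

(** The triangle inequality for 2 x and convexity of the square. It serves on the summands where the
    contribution of v to u + t v and u - t v is dropped. *)
Lemma le_sqr_sum (V : normedModType K) (x y : V) :
  2 * rnorm x ^+ 2 <= rnorm (x + y) ^+ 2 + rnorm (x - y) ^+ 2.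
Proof.
have := ler_rnormD (x + y) (x - y); rewrite sum_sub2 rnorm_two.
have := rnorm_ge0 (x + y); have := rnorm_ge0 (x - y); have := rnorm_ge0 x.
move: (rnorm x) (rnorm (x + y)) (rnorm (x - y)) => a b c a0 c0 b0 h.
have : (2 * a) ^+ 2 <= (b + c) ^+ 2 by rewrite ler_pXn2r ?nnegrE ?mulr_ge0 ?addr_ge0.
by have := sqr_ge0 (b - c); rewrite !exprMn sqrrB sqrrD; lra.
Qed.

(** The norm r satisfies r^q = 1 + |t|^q, and r^2 <= r^q when r > 1 because q > 2. *)
Lemma lp_pair_sqr_le (V : normedModType K) (q : R) (x y : V) (t : R) :
  2 < q -> lp_pair q x y -> rnorm (x + of_real t *: y) ^+ 2 <= 1 + `|t| `^ q.
Proof.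
move=> q2 xy; have := xy t; set r := rnorm _; have r0 : 0 <= r by exact: rnorm_ge0.
have tq := powR_ge0 `|t| q.
move=> rE; have [r1|r1] := leP r 1.
  by apply: (@le_trans _ _ 1); [rewrite expr_le1 | rewrite lerDl].
by rewrite -rE -powR_mulrn// ler_powR ?ltW.
Qed.

Lemma lp_pair_rnorm (V : normedModType K) (q : R) (x y : V) :
  0 < q -> lp_pair q x y -> rnorm x = 1.
Proof.
move=> q0 /(_ 0); rewrite of_real0 scale0r addr0 normr0 powR0 ?gt_eqF// addr0 => h.
have := rnorm_ge0 x; move: h; move: (rnorm x) => r h r0.
rewrite -[r]powRr1// -[X in r `^ X](@divff _ q) ?gt_eqF// powRrM h.
by rewrite powR1.
Qed.

Variables (Z : normedModType K) (J : {linear l2_sum E -> Z}) (P : {linear Z -> l2_sum E}).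
Hypothesis JP : hilbert_split J P.
Variable T : {linear l2_sum E -> Z}.
Hypothesis iT : forall x, rnorm (T x) = rnorm x.

Lemma restrict_pred1 m (z : l2_sum E) : rnorm (restrict E (pred1 m) z) = rnorm (z m).
Proof.
rewrite -(rnorm_embed (z m)); congr rnorm; apply: l2_sum_ext => n.
rewrite restrictE /=; case: eqVneq => [->|nm]; first by rewrite embed_coord_id.
by rewrite embed_coord_neq//; apply/eqP; rewrite eq_sym.
Qed.

(* As t -> 0, the mean of |u + t v|^2 and |u - t v|^2 is at most 1 + t^(p n), to
   which the Hilbert part of v contributes t^2 and a coordinate v_m contributes
   t^(p m). *)
Lemma lp_pair_image n (x y : E n) (v := T (embed E n y)) : lp_pair (p n) x y ->
  v = J (P v) /\ forall m, p m < p n -> P v m = 0.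
Proof.
move=> xy; set u := T (embed E n x).
pose a := P u; pose b := P v; pose g := u - J a; pose h := v - J b.
have u1 : rnorm a ^+ 2 + rnorm g ^+ 2 = 1.
  rewrite -(split_sqr_rnorm JP) iT rnorm_embed (lp_pair_rnorm _ xy) ?expr1n//.
  by rewrite (lt_trans _ (p_gt2 n)).
(* The sum of the estimates for t and -t; the Hilbert components g and h are combined by the exact
   parallelogram law. *)
have bound t : 0 < t <= 1 ->
    rnorm (a + (of_real t : K) *: b) ^+ 2 + rnorm (a - (of_real t : K) *: b) ^+ 2 +
    2 * (rnorm g ^+ 2 + t ^+ 2 * rnorm h ^+ 2) <= 2 + 2 * t `^ p n.
  move=> /andP[t0 _].
  have hs s : `|s| = t -> rnorm (a + (of_real s : K) *: b) ^+ 2 +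
      rnorm (g + (of_real s : K) *: h) ^+ 2 <= 1 + t `^ p n.
    move=> st; apply: le_trans (_ : rnorm (u + (of_real s : K) *: v) ^+ 2 <= _); last first.
      rewrite /u /v -!linearZ -!linearD /= iT.
      by rewrite rnorm_embed -st; exact: lp_pair_sqr_le.
    have Pw : P (u + (of_real s : K) *: v) = a + (of_real s : K) *: b.
      by rewrite addrC linearP addrC.
    have Jw : J (a + (of_real s : K) *: b) = J a + (of_real s : K) *: J b.
      by rewrite addrC linearP addrC.
    by rewrite (split_sqr_rnorm JP (u + _)) Pw Jw /g /h scalerBr addrACA -opprD.
  have h1 := hs t (gtr0_norm t0).
  have := hs (- t); rewrite normrN gtr0_norm// of_realN !scaleNr => /(_ erefl) h2.
  have [_ _ para] := JP.
  have := para g ((of_real t : K) *: h); rewrite linearZ /= !(split_ker JP) scaler0.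
  move=> /(_ erefl erefl); rewrite rnormZ re_norm_of_real gtr0_norm// exprMn => h3.
  by rewrite -h3; lra.
split.
  apply/eqP; rewrite -subr_eq0 -/b -/h; apply/eqP; apply: rnorm_eq0; apply/eqP.
  rewrite -sqrf_eq0 eq_le sqr_ge0 andbT.
  (* Dropping b leaves t^2 |h|^2 <= t^(p n), that is, |h|^2 <= t^(p n - 2). *)
  apply: (@le0_of_le_powR R _ 1 (p n - 2)); rewrite ?subr_gt0//.
  move=> t t01; have := bound t t01; have := le_sqr_sum a ((of_real t : K) *: b).
  have /andP[t0 t1] := t01; rewrite mul1r.
  have -> : t `^ p n = t ^+ 2 * t `^ (p n - 2).
    by rewrite -powR_mulrn ?ltW// -powRD ?subrKC//; apply/implyP => _; rewrite gt_eqF.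
  move=> h1 h2; rewrite -(@ler_pM2l _ (t ^+ 2)) ?exprn_gt0//; lra.
move=> m pmn; apply: rnorm_eq0.
apply: (@eq0_of_powR_perturb R (rnorm (a m)) _ (p n) (p m)) => //.
  have := rnorm_l2_coord a m; have := rnorm_ge0 (a m); have := sqr_ge0 (rnorm g).
  move=> g0 am0 ama; rewrite am0 /= -(@expr_le1 _ 2)//.
  have : rnorm (a m) ^+ 2 <= rnorm a ^+ 2 by rewrite ler_pXn2r ?nnegrE ?rnorm_ge0.
  by lra.
  exact: rnorm_ge0.
move=> t t01; have := bound t t01; have /andP[t0 t1] := t01.
set D := restrict E (pred1 m); set D' := restrict E (predC (pred1 m)).
have sD (z : l2_sum E) : rnorm z ^+ 2 = rnorm (z m) ^+ 2 + rnorm (D' z) ^+ 2.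
  by rewrite (sqr_rnorm_restrict (pred1 m)) restrict_pred1.
rewrite (sD (a + _)) (sD (a - _)) (linearD D') (linearB D').
(* Hypothesis (a) is applied in coordinate m only. Elsewhere the contribution of v is dropped, and
   by u1 that of u is 1 - |a m|^2. *)
have := le_sqr_sum (D' a) (D' ((of_real t : K) *: b)).
have := hypa (a m) ((of_real t : K) *: b m).
have : 0 <= t ^+ 2 * rnorm h ^+ 2 by rewrite mulr_ge0 ?sqr_ge0.
have := sD a; move: u1.
rewrite rnormZ re_norm_of_real gtr0_norm// l2_sumBE.
have -> : (a + (of_real t : K) *: b) m = a m + (of_real t : K) *: b m by [].
have -> : ((of_real t : K) *: b) m = (of_real t : K) *: b m by [].
lra.
Qed.

Hypothesis hypb : forall n : nat, exists B : seq (E n), is_basis B /\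
  forall y : E n, y \in B -> exists2 x : E n, x \in B & lp_pair (p n) x y.

(* The sequences in the sum of the E_n with s <= p n; finitely many n if s > 2. *)
Definition supported (s : R) (x : l2_sum E) := forall n, p n < s -> x n = 0.

Lemma supported_linear s a x y : supported s x -> supported s y ->
  supported s (a *: x + y).
Proof.
move=> xs ys n ns; have -> : (a *: x + y) n = a *: x n + y n by [].
by rewrite xs// ys// scaler0 addr0.
Qed.

Lemma supported0 s : supported s 0.
Proof. by []. Qed.

(** The property is linear in v, and each basis vector is the second member of a pair. *)
Lemma embed_image s n (v : E n) : s <= p n ->
  T (embed E n v) = J (P (T (embed E n v))) /\ supported s (P (T (embed E n v))).
Proof.
move=> sn; have [B [[_ Bspan] Bpair]] := hypb n.
pose Q (w : l2_sum E) := T w = J (P (T w)) /\ supported s (P (T w)).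
have Qlin a w w' : Q w -> Q w' -> Q (a *: w + w').
  move=> [h1 h2] [h1' h2']; split; first by rewrite !linearP /= -h1 -h1'.
  by rewrite !linearP; exact: supported_linear.
have Q0 : Q 0 by split; rewrite !linear0//; exact: supported0.
suff : Q (embed E n v) by [].
have [c ->] := Bspan v; rewrite linear_sum; elim/big_rec: _ => // i w _ Qw.
rewrite linearZ; apply: Qlin => //.
have [x _ xy] := Bpair _ (mem_nth 0 (ltn_ord i)).
have [h1 h2] := lp_pair_image xy; split => // m ms; apply: h2.
exact: lt_le_trans ms sn.
Qed.

Lemma supported_head s : 2 < s -> exists N, forall x, supported s x ->
  x = restrict E (fun i => i < N)%N x.
Proof.
move=> s2; have s20 : 0 < s - 2 by rewrite subr_gt0.
have /cvgrPdist_lt/(_ _ s20)[N _ NP] := p_cvg.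
exists N => x xs; apply: l2_sum_ext => n; rewrite restrictE; case: ltnP => // /NP /=.
by rewrite ltr_norml => /andP[h _]; apply: xs; lra.
Qed.

Lemma supported_image s x : 2 < s -> supported s x ->
  T x = J (P (T x)) /\ supported s (P (T x)).
Proof.
move=> /supported_head[N NP] xs; rewrite (NP x xs) head_embed.
elim/big_rec: _ => [|i w _ [h1 h2]]; first by split; rewrite !linear0//; exact: supported0.
have [Qi Si] : T (embed E i (x i)) = J (P (T (embed E i (x i)))) /\
    supported s (P (T (embed E i (x i)))).
  have [/xs ->|] := ltP (p i) s; last exact: embed_image.
  by split; rewrite !linear0//; exact: supported0.
rewrite !linearD /= -h1 -Qi; split => //.
by have := supported_linear 1 Si h2; rewrite scale1r.
Qed.

Lemma head_span N : exists S : seq (l2_sum E), forall x,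
  in_span S (restrict E (fun i => i < N)%N x).
Proof.
suff [S SP] : exists S : seq (l2_sum E), forall x : l2_sum E,
    in_span S (\sum_(i < N) embed E i (x i)).
  by exists S => x; rewrite head_embed.
elim: N => [|N [S SP]]; first by exists [::] => x; rewrite big_ord0.
have [B [[_ Bspan] _]] := hypb N.
exists (map (embed E N) B ++ S) => x.
have -> : \sum_(i < N.+1) embed E i (x i) =
    1 *: embed E N (x N) + \sum_(i < N) embed E i (x i).
  by rewrite big_ord_recr /= addrC scale1r.
apply: in_span_linear; last exact: in_span_catr.
apply: in_span_cat; have [c ->] := Bspan (x N); rewrite linear_sum.
elim/big_rec: _ => [|i w _ ws]; first exact: in_span0.
rewrite linearZ; apply: in_span_linear => //; apply: in_span_mem.
exact/map_f/mem_nth.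
Qed.

(** [P \o T] maps the sequences supported above s injectively into themselves, and these lie in a
    finite span. *)
Lemma supported_preimage s y : 2 < s -> supported s y -> exists w, T w = J y.
Proof.
move=> s2 ys; have [N NP] := supported_head s2; have [S SP] := head_span N.
have PT_inj x : supported s x -> P (T x) = 0 -> x = 0.
  move=> /(supported_image s2)[Tx _] PT0; apply: rnorm_eq0.
  by rewrite -iT Tx PT0 linear0 rnorm0.
have PTs x : supported s x -> supported s (P (T x)).
  by move=> /(supported_image s2)[].
have Sspan x : supported s x -> in_span S x by move=> /NP ->; exact: SP.
have [w ws wy] := @finite_span_surjective R k _ (P \o T) (supported s)
  (@supported_linear s) (@supported0 s) PTs PT_inj S Sspan y ys.
by exists w; rewrite (supported_image s2 ws).1; congr (J _).
Qed.

Lemma head_supported N : exists2 s, 2 < s & forall x,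
  supported s (restrict E (fun i => i < N)%N x).
Proof.
(* s is the least of 3 and the [p n] with n < N; 3 is an arbitrary number above 2. *)
elim: N => [|N [s s2 sP]]; first by exists 3 => [|x n _]; [lra | rewrite restrictE].
exists (Num.min s (p N)) => [|x n]; first by rewrite lt_min s2 p_gt2.
rewrite lt_min => /andP[ns nN]; rewrite restrictE; case: ifP => //.
rewrite ltnS leq_eqVlt => /predU1P[nE|nlN]; first by move: nN; rewrite nE ltxx.
by have := sP x n ns; rewrite restrictE nlN.
Qed.

Theorem isometry_image_sub x : T x = J (P (T x)).
Proof.
apply/eqP; rewrite -subr_eq0; apply/eqP.
apply: (@rnorm_small_eq0 R k _ _ 1) => // e e0; rewrite mul1r.
have [N NP] := head_cvg x e0; have [s s2 sP] := head_supported N.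
have := (supported_image s2 (sP x)).1; set h := restrict _ _ _ => hE.
(* The map z |-> z - J (P z) is a contraction that vanishes at T h, so its value at T x has norm at
   most |x - h|. *)
have -> : T x - J (P (T x)) = T (x - h) - J (P (T (x - h))).
  have -> : T (x - h) = T x - T h by rewrite linearB.
  have -> : J (P (T x - T h)) = J (P (T x)) - T h by rewrite !linearB /= -hE.
  by rewrite opprB addrA subrK.
apply: le_trans (ltW NP); rewrite -iT -/h.
rewrite -(@ler_pXn2r _ 2) ?nnegrE ?rnorm_ge0//.
by rewrite [leRHS](split_sqr_rnorm JP) lerDr sqr_ge0.
Qed.

Theorem isometry_image_sup y : exists x, T x = J y.
Proof.
apply: isometry_closed_range => // e e0.
have [N NP] := head_cvg y e0; have [s s2 sP] := head_supported N.
have [w Tw] := supported_preimage s2 (sP y); exists w.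
by rewrite Tw -linearB (split_isometry JP).
Qed.

End isometries_into_splittings.

(** * Density characters *)

Section density.
Context {R : realType} {k : scalar_kind}.
Notation K := (scalar_field R k).
Local Open Scope card_scope.

Lemma denseP (V : normedModType K) (A : set V) :
  dense A <-> forall x (e : R), 0 < e -> exists2 a, A a & rnorm (x - a) < e.
Proof.
split=> [dA x e e0|h O [x Ox] oO].
  have eK : (0 : K) < of_real e by rewrite -(of_real0 R k) lt_of_real.
  have [||a [xa Aa]] := dA (ball x (of_real e)).
  - by exists x; exact: ballxx.
  - exact: ball_open.
  exists a => //; move: xa; rewrite -ball_normE /= -of_real_rnorm.
  by rewrite lt_of_real.
have /nbhs_ballP[eps eps0 xO] : nbhs x O by apply: open_nbhs_nbhs.
have e0 : 0 < re_part eps :> R.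
  by rewrite -(lt_of_real k) of_real0 re_partK// ltW.
have [a Aa xa] := h x _ e0; exists a; split => //; apply: xO.
by rewrite -ball_normE /= -of_real_rnorm -[eps]re_partK ?lt_of_real// ltW.
Qed.

Lemma separated_card_le (V : normedModType K) (A : set V) (T : Type) (u : T -> V) :
  dense A -> (forall t t', t <> t' -> 1 <= rnorm (u t - u t')) -> [set: T] #<= A.
Proof.
move=> /denseP dA usep.
apply: (@rel_card_le _ _ _ _ (fun t a => rnorm (u t - a) < 2^-1)).
  by move=> t _; have [|a Aa ?] := dA (u t) 2^-1; [rewrite invr_gt0 | exists a].
move=> t t' a _ _ h h'; apply: contrapT => /usep.
have := ler_rnormB (u t) a (u t'); rewrite [rnorm (a - _)]rnorm_distC.
move: h h'; move: (rnorm _) (rnorm _) (rnorm _) => ? ? ?; lra.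
Qed.

Lemma rational_scalar : exists q : rat * rat -> K,
  forall (a : K) (e : R), 0 < e -> exists r, re_part `|a - q r| < e.
Proof.
have ratP (x e : R) : 0 < e -> exists r : rat, `|x - ratr r| < e.
  move=> e0; have [|r] := @rat_in_itvoo R (x - e) (x + e); first by lra.
  by rewrite in_itv /= => /andP[h1 h2]; exists r; rewrite ltr_norml; lra.
case: (k).
  exists (fun r => ratr r.1) => a e e0; have [r rP] := ratP a e e0.
  by exists (r, 0).
exists (fun r => Complex (ratr r.1) (ratr r.2)) => -[a b] e e0.
have e2 : 0 < e / 2 by rewrite divr_gt0.
have [r rP] := ratP a _ e2; have [s sP] := ratP b _ e2; exists (r, s).
exact: (@re_norm_complex_lt R (Complex a b - Complex (ratr r) (ratr s))).
Qed.

(** Combinations with rational coefficients are dense, and finite sequences over the infinite type T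
    inject into T. *)
Lemma dense_of_total (V : normedModType K) (T : Type) (u : T -> V) (e : nat -> T) :
  total_family u -> injective e -> exists2 D : set V, dense D & D #<= [set: T].
Proof.
move=> tu eI; have [q qP] := rational_scalar.
pose F (s : seq (rat * rat * T)) := comb u [seq (q t.1, t.2) | t <- s].
exists (range F); last first.
  have [f fI] := infinite_seq_inj eI.
  (* The coefficient becomes a number of copies of the index, one more than its code, so that the
     sequence is nonempty and its head recovers the index. *)
  pose g (t : rat * rat * T) := f (nseq (pickle t.1).+1 t.2).
  have gI : injective g.
    move=> [r t] [r' t'] /fI tt'; have tE : t = t' := congr1 (head t) tt'.
    by have := congr1 size tt'; rewrite !size_nseq tE => -[] /(pcan_inj (@pickleK _)) ->.
  apply: card_le_trans (card_image_le F setT) _.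
  apply: (@rel_card_le _ _ _ _ (fun s t => f (map g s) = t)).
    by move=> s _; exists (f (map g s)).
  by move=> s s' t _ _ <- /fI /(inj_map gI).
apply/denseP => x d d0; have d2 : 0 < d / 2 by rewrite divr_gt0.
have [s sx] := tu x _ d2.
suff [r rs] : exists r, rnorm (comb u s - F r) < d / 2.
  exists (F r); first by exists r.
  by rewrite (splitr d) (le_lt_trans (ler_rnormB _ (comb u s) _))// ltrD.
elim: s {sx} (d / 2) d2 => [|[a t] s IHs] c c0.
  by exists [::]; rewrite /F /comb !big_nil subrr rnorm0.
have c2 : 0 < c / 2 by rewrite divr_gt0.
have [r rP] := IHs _ c2.
have ct : 0 < c / 2 / (rnorm (u t) + 1) by rewrite divr_gt0// ltr_wpDl ?rnorm_ge0.
have [b] := qP a _ ct; rewrite ltr_pdivlMr ?ltr_wpDl ?rnorm_ge0// => bP.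
exists ((b, t) :: r); rewrite /F /comb !big_cons /= opprD addrACA -scalerBl.
rewrite (le_lt_trans (ler_rnormD _ _))// (splitr c) ltrD//.
by apply: le_lt_trans bP; rewrite rnormZ ler_wpM2l ?re_norm_ge0// lerDl.
Qed.

(** The inner product of u t - u t' with the unit vector u t' is -1. The distance is in fact the
    square root of 2; the bound 1 is enough for counting. *)
Lemma orthonormal_separated (V : normedModType K) (dot : V -> V -> K) (T : Type)
    (u : T -> V) t t' : inner_product dot -> orthonormal_family dot u ->
  t <> t' -> 1 <= rnorm (u t - u t').
Proof.
move=> dotP uo tt'; have b1 : dot (u t') (u t') = 1 by rewrite uo asboolT.
have d1 : dot (u t - u t') (u t') = -1.
  by rewrite addrC -scaleN1r (inner_linl dotP) !uo asboolT// asboolF// addr0 mulr1.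
have := sqr_rnorm_sub_proj dotP (u t - u t') b1; rewrite d1 normrN normr1.
rewrite -(of_real1 R k) of_realK expr1n => h.
rewrite -(@ler_pXn2r _ 2) ?nnegrE ?rnorm_ge0// expr1n -subr_ge0.
by rewrite -h sqr_ge0.
Qed.

Section split_basis.
Variable E : nat -> completeNormedModType K.
Hypothesis E_findim : forall n, finite_dimensional (E n).

Lemma l2_total_family : exists u : nat * nat -> l2_sum E, total_family u.
Proof.
have /all_sig[B Bspan] n : { B : seq (E n) | forall x, in_span B x }.
  apply: cid; have [B [_ BP]] := E_findim n; exists B => x.
  by have [c ->] := BP x; exact: in_span_sum.
(* An index beyond the length of the list gives the zero vector, which does no harm in a total
   family. *)
pose u (ij : nat * nat) := embed E ij.1 (nth 0 (B ij.1) ij.2).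
exists u => x e e0; have [N NP] := head_cvg x e0.
suff [s sE] : exists s, comb u s = restrict E (fun i => i < N)%N x.
  by exists s; rewrite sE.
rewrite head_embed; elim: N {NP} => [|N [s sE]].
  by exists [::]; rewrite /comb big_nil big_ord0.
have [c cE] := span_comb (Bspan N (x N)).
exists (s ++ [seq (c i, (N, val i)) | i <- enum 'I_(size (B N))]).
have -> : \sum_(i < N.+1) embed E i (x i) =
    \sum_(i < N) embed E i (x i) + embed E N (x N) by rewrite big_ord_recr.
rewrite comb_cat sE cE linear_sum; congr (_ + _).
rewrite /comb big_map big_enum.
by apply: eq_bigr => i _; rewrite linearZ.
Qed.

(** An orthonormal basis B of H is 1-separated, so B injects into kappa. Conversely B and a
    countable total family of E yield a dense set no larger than [nat * nat + B], into which kappa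
    injects. As kappa is uncountable, B is infinite and absorbs the countable part. *)
Lemma split_density_basis (Z : completeNormedModType K)
    (J : {linear l2_sum E -> Z}) (P : {linear Z -> l2_sum E})
    (JP : hilbert_split J P) (kappa : Type) :
  has_density_character Z kappa -> ~ countable [set: kappa] ->
  let H : completeNormedModType K := kernel_space (split_contraction JP) in
  exists (dot : H -> H -> K) (u : kappa -> H),
    [/\ inner_product dot, orthonormal_family dot u & total_family u].
Proof.
move=> [[A [dA Akappa]] kappa_min] kappa_unc.
have [para _] := split_linearly_isometric JP.
set H := kernel_space _ => /=; have [dot dotP] := jordan_von_neumann para.
have [B [Bo Bt]] := @exists_orthonormal_basis R k H dot dotP para.
pose v (b : set_type B) : Z := \val (val b).
have Bkappa : [set: set_type B] #<= [set: kappa].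
  apply: (@card_le_trans _ _ _ A); last by move: Akappa; rewrite card_eq_le => /andP[].
  apply: (separated_card_le dA (u := v)) => b b' bb'.
  rewrite /v -rnorm_kernelB; exact: orthonormal_separated dotP Bo bb'.
have [w wt] := l2_total_family.
pose T := (nat * nat + set_type B)%type.
pose y (t : T) : Z := match t with inl ij => J (w ij) | inr b => v b end.
have yt : total_family y.
  move=> z e e0; have e2 : 0 < e / 2 by rewrite divr_gt0.
  have [s sP] := wt (P z) _ e2.
  have [h hE] := kernel_lift (split_contraction JP) (split_ker JP z).
  have [r rP] := Bt h _ e2.
  exists ([seq (t.1, inl t.2) | t <- s] ++ [seq (t.1, inr t.2) | t <- r]).
  rewrite comb_cat; have -> : comb y [seq (t.1, inl t.2) | t <- s] = J (comb w s).
    by rewrite linear_comb /comb big_map.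
  have -> : comb y [seq (t.1, inr t.2) | t <- r] = \val (comb (fun b => val b) r).
    by rewrite linear_comb /comb big_map.
  have -> : z - (J (comb w s) + \val (comb (fun b => val b) r)) =
      J (P z - comb w s) + (\val h - \val (comb (fun b => val b) r)).
    by rewrite hE linearB addrACA subrKC opprD addrA.
  rewrite (le_lt_trans (ler_rnormD _ _))// (splitr e) ltrD//.
    by rewrite (split_isometry JP).
  by rewrite -rnorm_kernelB.
have [D dD DT] : exists2 D : set Z, dense D & D #<= [set: T].
  by apply: (dense_of_total yt (e := fun n => inl (n, 0%N))) => m n [].
have kT : [set: kappa] #<= [set: T] := card_le_trans (kappa_min D dD) DT.
have [Bc|Bunc] := pselect (countable B).
  exfalso; apply: kappa_unc; apply: card_le_trans kT _.
  apply: (@card_le_trans _ _ _ [set: nat * nat + nat]); last exact: countableP.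
  have [f fI] : exists f : set_type B -> nat, injective f.
    have /countable_injP[g gI] := Bc; exists (g \o val) => b b' /= gb.
    by apply: val_inj; apply: gI => //; exact: valP.
  apply: (@rel_card_le _ _ _ _ (fun t s => s = match t with
    inl ij => inl ij | inr b => inr (f b) end)).
    by case=> [ij|b] _; [exists (inl ij) | exists (inr (f b))].
  by move=> [ij|b] [ij'|b'] s _ _ -> // [] => [->|/fI ->].
have [e eI] : exists e : nat -> set_type B, injective e.
  have /infiniteP : infinite_set B by move=> /finite_set_countable.
  move=> /card_le_fun[|e eB eI]; first by exists 0%N.
  exists (fun n => SigSub (mem_set (eB n I))) => m n /(congr1 val) /=.
  exact: eI.
have kB : [set: kappa] #<= [set: set_type B].
  apply: card_le_trans kT _; have [f fI] := infinite_seq_inj eI.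
  (* Pairs go to sequences of length at least 2 and basis elements to singletons, so the lengths
     keep the two kinds apart. *)
  apply: (@rel_card_le _ _ _ _ (fun t b => b = match t with
    inl ij => f (nseq (pickle ij).+2 (e 0%N)) | inr b => f [:: b] end)).
    by case=> [ij|b] _; [exists (f (nseq (pickle ij).+2 (e 0%N))) | exists (f [:: b])].
  move=> [ij|b] [ij'|b'] s _ _ -> /fI st.
  - by have := congr1 size st; rewrite !size_nseq => -[] /(pcan_inj (@pickleK _)) ->.
  - by have := congr1 size st; rewrite size_nseq.
  - by have := congr1 size st; rewrite size_nseq.
  - by have -> : b = b' := congr1 (head b) st.
have /card_bijP[f [g fK gK]] := Cantor_Bernstein kB Bkappa.
(* The bijection is between the subtypes of the full sets; [in1] and [in2] lead from kappa and from
   the basis to these. *)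
pose in1 (t : kappa) : [set: kappa] := SigSub (mem_set (I : [set: kappa] t)).
pose in2 (b : set_type B) : [set: set_type B] := SigSub (mem_set (I : [set: set_type B] b)).
pose phi t : set_type B := val (f (in1 t)); pose psi b : kappa := val (g (in2 b)).
have phiI t t' : phi t = phi t' -> t = t'.
  by move=> /val_inj /(can_inj fK) /(congr1 val).
have phiK b : phi (psi b) = b.
  rewrite /phi; have -> : in1 (psi b) = g (in2 b) by exact: val_inj.
  by rewrite gK.
exists dot, (fun t => val (phi t)); split => //.
  move=> t t'; rewrite Bo; congr (if _ then _ else _).
  by apply/asbool_equiv_eq; split=> [/phiI|->].
move=> z d d0; have [s sP] := Bt z d d0.
exists [seq (t.1, psi t.2) | t <- s]; congr (rnorm (z - _) < d): sP.
by rewrite /comb big_map; apply: eq_bigr => t _ /=; rewrite phiK.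
Qed.

End split_basis.
End density.

(** * The elementary class *)

Section elementary_class.
Context {R : realType} {k : scalar_kind}.
Notation K := (scalar_field R k).
Local Open Scope card_scope.

(** Modulo a principal ultrafilter a family is determined by its value at [i0]. *)
Lemma principal_ultrapower_isometric (I : Type) (i0 : I)
    (UF : UltraFilter (principal_filter i0)) (Z : normedModType K) :
  linearly_isometric Z (ultrapower UF Z).
Proof.
exists (diagonal UF Z); split; first by apply/isometryP => z; exact: rnorm_diagonal.
move=> q; exists (ultra_repr q i0); rewrite -[RHS]ultra_reprK.
by apply/ultra_class_eqP => e e0; apply/principal_filterP; rewrite /= subrr rnorm0.
Qed.

(* A principal ultrapower of the ultrapower avoids iterating ultrafilters. *)
Lemma ultrapower_elementarily_equivalent (I : Type) (U : set_system I)
    (UF : UltraFilter U) (X : completeNormedModType K) :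
  elementarily_equivalent (ultrapower UF X) X.
Proof.
exists unit, (principal_filter tt), (principal_filter_ultra tt), I, U, UF.
exact/linearly_isometric_sym/principal_ultrapower_isometric.
Qed.

Lemma l2_prod_isometric (X H H' : normedModType K) :
  linearly_isometric H H' -> linearly_isometric (l2_prod X H) (l2_prod X H').
Proof.
move=> [T [/isometryP iT sT]].
pose f (z : l2_prod X H) : l2_prod X H' := (z.1, T z.2).
have fl : linear f by move=> a x y; rewrite /f /= linearP.
exists (linear_of fl); split; first by apply/isometryP => z; rewrite !rnorm_l2_prod /= iT.
by move=> [x h]; have [h' <-] := sT h; exists (x, h').
Qed.

Lemma cantor_uncountable : ~ countable [set: nat -> bool].
Proof.
move=> /countable_injP[g gI].
pose d n := `[< exists f : nat -> bool, g f = n /\ ~~ f n >].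
have [dg|dg] := boolP (d (g d)).
  have /asboolP[f [/gI fE]] := dg; rewrite fE ?inE// => nd.
  by move: nd; rewrite dg.
by move/asboolP: (dg); apply; exists d.
Qed.

(** Each f : nat -> bool selects the subsequence of e indexed by the codes of its prefixes. Two
    different functions have different prefixes of all large lengths, so the classes of their
    subsequences are 1-separated. *)
Lemma ultrapower_uncountable_density (X : completeNormedModType K)
    (G : set_system nat) (GF : UltraFilter G) (e : nat -> X) (M : R) :
  (forall n, rnorm (e n) <= M) -> (forall m n, m <> n -> 1 <= rnorm (e m - e n)) ->
  eventually `<=` G ->
  forall A : set (ultrapower GF X), dense A -> ~ countable A.
Proof.
move=> eM esep oG A dA cA; apply: cantor_uncountable; apply: card_le_trans cA.
pose code (f : nat -> bool) n := pickle (mkseq f n).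
have cM (f : nat -> bool) : exists M : R, forall n, rnorm (e (code f n)) <= M by exists M.
apply: (separated_card_le dA (u := fun f => ultra_class GF (BoundedFamily (cM f)))).
move=> f g fg; rewrite -ultra_classB.
have [m fgm] : exists m, f m <> g m.
  by apply: contrapT => h; apply: fg; apply/funext => m; apply: contrapT => ?; apply: h; exists m.
set F := BoundedFamily _ - _; have h := @ultra_rnorm_cvg R k nat G GF X F.
apply: (cvgr_to_ge h).
(* The prefix of length n contains position m only when n > m. *)
apply: oG; exists m.+1 => // n /= mn; apply: esep => /(pcan_inj (@pickleK _)) fgn.
by apply: fgm; rewrite -(nth_mkseq false f mn) fgn nth_mkseq.
Qed.

End elementary_class.

(** * Categoricity of the l2-sum *)

Section categoricity.
Context {R : realType} {k : scalar_kind}.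
Notation K := (scalar_field R k).
Local Open Scope card_scope.
Variables (E : nat -> completeNormedModType K) (p : nat -> R).
Hypotheses (E_nonzero : forall n, exists x : E n, x != 0)
  (E_findim : forall n, finite_dimensional (E n)).
Hypotheses (p_gt2 : forall n, 2 < p n) (p_cvg : p n @[n --> \oo] --> (2 : R)).
Hypothesis hypa : forall (n : nat) (x y : E n),
  rnorm (x + y) ^+ 2 + rnorm (x - y) ^+ 2 >=
  2 * (rnorm x `^ p n + rnorm y `^ p n) `^ (2 / p n).
Hypothesis hypb : forall n : nat, exists B : seq (E n), is_basis B /\
  forall y : E n, y \in B -> exists2 x : E n, x \in B & lp_pair (p n) x y.

Let asym : asymptotically_hilbert E := hypa_asymptotically_hilbert p_gt2 p_cvg hypa.

(* S embeds Y isometrically in an ultrapower Z of E.  The map Psi embeds E in Z_U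
   through Y_U; its range is the canonical copy of E, so every element of the copy
   of E in Z is a limit of values of S. *)
Lemma elementarily_equivalent_split (Y : completeNormedModType K) :
  elementarily_equivalent Y (l2_sum E) ->
  exists (J : {linear l2_sum E -> Y}) (P : {linear Y -> l2_sum E}), hilbert_split J P.
Proof.
move=> [I [U [UF [I' [V [VF]]]]]] [F [/isometryP iF sF]].
have [Ti [TiK iTi]] := linearly_isometric_inv iF sF.
pose Z : normedModType K := ultrapower VF (l2_sum E).
have [JZ [PZ JPZ]] : exists (J : {linear l2_sum E -> Z}) (P : {linear Z -> l2_sum E}),
    hilbert_split J P.
  have h := ultrapower_split E_findim VF (identity_split (l2_sum E)) asym.
  by eexists; eexists; exact: h.
pose S : {linear Y -> Z} := F \o diagonal UF Y.
have iS y : rnorm (S y) = rnorm y by rewrite /= iF rnorm_diagonal.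
(* Z is already an ultrapower; its own ultrapower is split because Z is. *)
have JPU := ultrapower_split E_findim UF JPZ asym.
pose Psi : {linear l2_sum E -> ultrapower UF Z} := ultra_map UF iS \o (Ti \o JZ).
have iPsi x : rnorm (Psi x) = rnorm x.
  by rewrite /= [LHS]rnorm_ultra_map iTi (split_isometry JPZ).
have JS x : exists y, S y = JZ x.
  apply: isometry_closed_range => // e e0.
  (* The constant family [JZ x] and a family of values of S have the same class in the ultrapower of
     Z, so they are e-close at some index. *)
  have [z] := isometry_image_sup p_gt2 p_cvg hypa JPU iPsi hypb x.
  move=> /ultra_class_eqP/(_ e e0) /filter_ex[i /= h].
  by exists (ultra_repr (Ti (JZ z)) i); rewrite rnorm_distC.
have /choice[j jP] := JS.
have jl : linear j.
  by move=> a x y; apply: (isometry_inj iS); rewrite linearP !jP linearP.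
have Sj x : S (linear_of jl x) = JZ x by exact: jP.
exists (linear_of jl), (PZ \o S); split.
- by move=> x; rewrite -[RHS](splitK JPZ) -Sj.
- by move=> x h h0; rewrite -iS linearD Sj (split_sqr_rnormD JPZ) ?iS.
move=> h h' h0 h'0; rewrite -iS -(iS (h - h')) linearD linearB -(iS h) -(iS h').
by have [_ _ para] := JPZ; exact: para.
Qed.

Lemma exists_separated : exists e : nat -> l2_sum E, (forall n, rnorm (e n) <= 1) /\
  (forall m n, m <> n -> 1 <= rnorm (e m - e n)).
Proof.
have /all_sig[x x1] n : { x : E n | rnorm x = 1 }.
  apply: cid; have [x x0] := E_nonzero n.
  have rx : rnorm x != 0 by apply: contra_neq x0 => /rnorm_eq0.
  exists ((of_real (rnorm x)^-1 : K) *: x); rewrite rnormZ re_norm_of_real.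
  by rewrite ger0_norm ?invr_ge0 ?rnorm_ge0// mulVf.
exists (fun n => embed E n (x n)); split=> [n|m n mn]; first by rewrite rnorm_embed x1.
apply: le_trans (rnorm_l2_coord _ m); rewrite l2_sumBE.
by rewrite embed_id embed_neq ?subr0 ?x1//; exact/nesym.
Qed.

Lemma l2_sum_infinite_dimensional : ~ finite_dimensional (l2_sum E).
Proof.
move=> [B [_ Bspan]].
have /all_sig[x x0] n : { x : E n | x != 0 } by exact/cid/E_nonzero.
have xB n : in_span B (embed E n (x n)).
  by have [c ->] := Bspan (embed E n (x n)); exact: in_span_sum.
have [c /hasP[a /(nthP 0)[j jc <-] cj] csum] := span_dependent xB.
have coord_lin : linear (fun z : l2_sum E => z j) by [].
have := congr1 (linear_of coord_lin) csum; rewrite linear0 linear_sum.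
rewrite (bigD1 (Ordinal jc))//= big1 => [|i]; last first.
  rewrite -val_eqE /= => ij; rewrite embed_coord_neq ?scaler0//.
  exact/eqP.
rewrite addr0 embed_coord_id => /eqP; rewrite scaler_eq0 (negPf cj) /=.
exact/negP/x0.
Qed.

(* The cardinal is the density character of an ultrapower of E over nat, which has
   a separated family indexed by nat -> bool. *)
Lemma l2_sum_uncountably_categorical : uncountably_categorical (l2_sum E).
Proof.
split; first exact: l2_sum_infinite_dimensional.
have [e [eM esep]] := exists_separated.
have [G [GF oG]] := ultraFilterLemma eventually_filter.
pose Y : completeNormedModType K := ultrapower GF (l2_sum E).
have [|A dA Amin] := @exists_min_card Y (@dense Y); first by exists setT => O; rewrite setIT.
have Aunc : ~ countable A by exact: (ultrapower_uncountable_density eM esep oG dA).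
have kunc : ~ countable [set: set_type A].
  move=> c; apply: Aunc; apply: card_le_trans c.
  by have := card_setT A; rewrite card_eq_le => /andP[].
exists (set_type A); split => //.
- exists Y; split; first exact: ultrapower_elementarily_equivalent.
  split; first by exists A; split => //; exact/card_esym/card_setT.
  move=> B /Amin; apply: card_le_trans.
  by have := card_setT A; rewrite card_eq_le => /andP[].
move=> Y1 Y2 Y1E Y1k Y2E Y2k.
have [J1 [P1 JP1]] := elementarily_equivalent_split Y1E.
have [J2 [P2 JP2]] := elementarily_equivalent_split Y2E.
have [dot1 [u1 [ip1 o1 t1]]] := split_density_basis E_findim JP1 Y1k kunc.
have [dot2 [u2 [ip2 o2 t2]]] := split_density_basis E_findim JP2 Y2k kunc.
(* Both bases are indexed by kappa, so their Gram matrices coincide and matching the indices extends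
   to an isometry of the Hilbert complements. *)
have o12 a b : dot1 (u1 a) (u1 b) = dot2 (u2 a) (u2 b) by rewrite o1 o2.
have [F [iF _ sF]] := isometry_extension (eq_inner_comb ip1 ip2 o12) t1.
have [_ h1] := split_linearly_isometric JP1.
have [_ h2] := split_linearly_isometric JP2.
apply: (linearly_isometric_trans h1).
apply: linearly_isometric_trans (linearly_isometric_sym h2).
apply: l2_prod_isometric; exists F; split; first exact/isometryP.
by move=> y; apply: sF => d; exact: t2.
Qed.

End categoricity.

Theorem proposition5p2 (R : realType) (k : scalar_kind)
    (E : nat -> completeNormedModType (scalar_field R k))
    (E_nonzero : forall n, exists x : E n, x != 0)
    (E_findim : forall n, finite_dimensional (E n))
    (p : nat -> R)
    (p_gt2 : forall n, 2 < p n)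
    (p_cvg : p n @[n --> \oo] --> (2 : R))
    (hypa : forall (n : nat) (x y : E n),
      rnorm (x + y) ^+ 2 + rnorm (x - y) ^+ 2 >=
      2 * (rnorm x `^ p n + rnorm y `^ p n) `^ (2 / p n))
    (hypb : forall n : nat, exists B : seq (E n),
      is_basis B /\
      forall y : E n, y \in B -> exists2 x : E n, x \in B & lp_pair (p n) x y) :
  [/\ (forall (I : Type) (U : set_system I) (UF : UltraFilter U),
         exists H : completeNormedModType (scalar_field R k),
           is_hilbert H /\
           linearly_isometric (ultrapower UF (l2_sum E))
             (l2_prod (l2_sum E) H)),
      (forall (H : completeNormedModType (scalar_field R k)), is_hilbert H ->
         forall T : {linear l2_sum E -> l2_prod (l2_sum E) H},
           is_linear_isometry T ->
           range T = range (fun x : l2_sum E => l2_inl H x)) &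
      uncountably_categorical (l2_sum E)].
Proof.
have asym := hypa_asymptotically_hilbert p_gt2 p_cvg hypa.
split.
- move=> I U UF.
  have h := ultrapower_split E_findim UF (identity_split (l2_sum E)) asym.
  have [para iso] := split_linearly_isometric h.
  by eexists; split; [exact: parallelogram_is_hilbert para | exact: iso].
- move=> H /(@l2_prod_split _ _ (l2_sum E))[J [P [JP JE]]] T /isometryP iT.
  apply/seteqP; split=> [_ [x _ <-]|_ [y _ <-]].
    exists (P (T x)) => //; rewrite -JE; apply/esym.
    exact: (isometry_image_sub p_gt2 p_cvg hypa JP iT hypb).
  rewrite -JE; have [x <-] := isometry_image_sup p_gt2 p_cvg hypa JP iT hypb y.
  by exists x.
exact: (l2_sum_uncountably_categorical E_nonzero E_findim p_gt2 p_cvg hypa hypb).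
Qed.
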